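(* Assume the Standing Assumption and that the time constant $\ell$ is differentiable and strictly convex. Then almost surely there is a (random) set $\mathscr U_0\subseteq\mathscr U$ with countable complement, with $\mathbb{P}(\xi\in\mathscr U_0)=1$ for each fixed $\xi\in\mathscr U$, such that for every $\xi\in\mathscr U_0$ and all $x,y\in\mathbb{Z}^2$ the limit $$B^\xi(x,y)=\lim_{n\to\infty}\bigl(L(x,v_n)-L(y,v_n)\bigr)$$ exists for every sequence $v_n\to\xi\cdot\infty$ (and does not depend on the sequence). Moreover, for every $\xi\in\mathscr U$ the limits $B^{\xi+}(x,y)=\lim_{\zeta\to\xi,\ \zeta\cdot e_1>\xi\cdot e_1,\ \zeta\in\mathscr U_0}B^\zeta(x,y)$ and $B^{\xi-}(x,y)=\lim_{\zeta\to\xi,\ \zeta\cdot e_1<\xi\cdot e_1,\ \zeta\in\mathscr U_0}B^\zeta(x,y)$ exist, and for all $x,y,z\in\mathbb{Z}^2$: (i) (cocycle) $B^{\xi\pm}(x,y)=B^{\xi\pm}(x,z)+B^{\xi\pm}(z,y)$; (ii) (ergodicity) the process $\psi^{\xi\pm}_x=(W(x;1),W(x;2),B^{\xi\pm}(x,x+e_1),B^{\xi\pm}(x,x+e_2))$, indexed by $x\in\mathbb{Z}^2,\xi\in\mathscr U$, is stationary and jointly ergodic under lattice translations; (iii) (measurability) $B^{\xi\pm}(x,y)$ is measurable with respect to the weights attached to vertices $z$ with $z\ge x$ or $z\ge y$; (iv) (adaptedness) $\min_{i\in\{1,2\}}\bigl(W(x+e_i;i)-B^{\xi\pm}(x,x+e_i)\bigr)=0$;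 (v) (monotonicity) if $\xi\cdot e_1<\zeta\cdot e_1$ then $B^{\xi-}(x,x+e_1)\le B^{\xi+}(x,x+e_1)\le B^{\zeta-}(x,x+e_1)$ and $B^{\xi-}(x,x+e_2)\ge B^{\xi+}(x,x+e_2)\ge B^{\zeta-}(x,x+e_2)$; (vi) (one-sided continuity) if $\zeta_n\cdot e_1\searrow\xi\cdot e_1$ then $B^{\zeta_n\pm}(x,y)\to B^{\xi+}(x,y)$, and if $\zeta_n\cdot e_1\nearrow\xi\cdot e_1$ then $B^{\zeta_n\pm}(x,y)\to B^{\xi-}(x,y)$; for $\xi\in\mathscr U_0$ these coincide and $\zeta\mapsto B^\zeta(x,y)$ is continuous at $\xi$; (vii) (means) $(\mathbb{E}B^{\xi\pm}(0,e_1),\mathbb{E}B^{\xi\pm}(0,e_2))=\nabla\ell(\xi)$; in particular Busemann functions in two distinct directions have distinct expectations.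
   Context: Directed edge-weight first passage percolation on $\mathbb{Z}^2$: $e_1=(1,0)$, $e_2=(0,1)$, $x\le y$ coordinatewise. Weight $W(x;1)$ sits on edge $(x-e_1,x)$ and $W(x;2)$ on edge $(x-e_2,x)$. $L(x,y)$ is the minimum, over up-right nearest-neighbour paths from $x$ to $y$, of the sum of the edge weights along the path. Standing Assumption: the pairs $(W(x;1),W(x;2))$, $x\in\mathbb{Z}^2$, are i.i.d., non-constant, with $\mathbb{E}|W(0;i)|^{2+\epsilon}<\infty$ for some $\epsilon>0$, and $(0,0)$ is in the support of their joint law. The time constant is the deterministic function $\ell(s,t)=\lim_n L(0,(\lfloor ns\rfloor,\lfloor nt\rfloor))/n$ a.s. on $\mathbb{R}^2_{\ge0}$. $\mathscr U=\{(t,1-t):0<t<1\}$ is the set of directions; $v_n\to\xi\cdot\infty$ means $|v_n|\to\infty$ and $v_n/|v_n|\to\xi$. *)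

(* Defs.v *)
From HB Require Import structures.
From mathcomp Require Import all_boot all_order all_algebra.
From mathcomp Require Import all_classical all_reals all_analysis.
Import Order.TTheory GRing.Theory Num.Theory.
Import numFieldNormedType.Exports.

Set Implicit Arguments.
Unset Strict Implicit.
Unset Printing Implicit Defensive.

Local Open Scope classical_set_scope.
Local Open Scope ring_scope.

Definition Z2 := (int * int)%type.
Definition e1 : Z2 := (1%:Z, 0%:Z).
Definition e2 : Z2 := (0%:Z, 1%:Z).

Definition le2 (x y : Z2) : bool := (x.1 <= y.1) && (x.2 <= y.2).

Definition l1norm {R : realType} (v : Z2) : R := (`|v.1|%:~R + `|v.2|%:~R).

(* An up-right nearest-neighbour path from x is encoded by its sequence
   of steps: true = an e1 step, false = an e2 step. *)
Definition step (b : bool) : Z2 := if b then e1 else e2.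

Definition path_pos (x : Z2) (s : seq bool) (k : nat) : Z2 :=
  x + \sum_(b <- take k s) step b.

Definition path_end (x : Z2) (s : seq bool) : Z2 := path_pos x s (size s).

(* Edge weights: w z = (W(z;1), W(z;2)); W(z;1) sits on the edge (z-e1,z)
   and W(z;2) on the edge (z-e2,z).  The weight of a path is the sum of
   the weights of the edges it uses. *)
Definition path_weight {R : realType} (w : Z2 -> R * R) (x : Z2)
    (s : seq bool) : R :=
  \sum_(k < size s)
     (let v := path_pos x s k.+1 in
      if nth false s k then (w v).1 else (w v).2).

(* L(x,y) = minimum over up-right paths from x to y of the path weight
   (a minimum over a finite nonempty set when x <= y). *)
Definition passage_time {R : realType} (w : Z2 -> R * R) (x y : Z2) : R :=
  inf [set path_weight w x s | s in [set s | path_end x s = y]].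

Definition env {T : Type} {R : realType} (W : Z2 -> T -> R * R) (om : T)
  : Z2 -> R * R := fun z => W z om.

Definition iid_field {d} {T : measurableType d} {R : realType}
    (P : probability T R) (W : Z2 -> T -> R * R) : Prop :=
  [/\ (forall x, measurable_fun setT (W x)),
      (forall x (B : set (R * R)), measurable B ->
          P (W x @^-1` B) = P (W 0%R @^-1` B)) &
      (forall (s : seq Z2) (B : Z2 -> set (R * R)), uniq s ->
          (forall x, measurable (B x)) ->
          P (\bigcap_(x in [set` s]) (W x @^-1` B x))
          = (\prod_(x <- s) P (W x @^-1` B x))%E)].

Definition standing_assumption {d} {T : measurableType d} {R : realType}
    (P : probability T R) (W : Z2 -> T -> R * R) : Prop :=
  [/\ iid_field P W,
      ~ (exists c : R * R, P (W 0%R @^-1` [set c]) = 1%E),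
      (exists eps : R, 0 < eps /\
          (\int[P]_om ((`|(W 0%R om).1| `^ (2 + eps))%:E) < +oo)%E /\
          (\int[P]_om ((`|(W 0%R om).2| `^ (2 + eps))%:E) < +oo)%E) &
      (forall eps : R, 0 < eps ->
          (0 < P (W 0%R @^-1` [set p : R * R | (`|p.1| < eps)%R /\ (`|p.2| < eps)%R]))%E)].

Definition is_time_constant {d} {T : measurableType d} {R : realType}
    (P : probability T R) (W : Z2 -> T -> R * R) (ell : R * R -> R) : Prop :=
  forall s t : R, 0 <= s -> 0 <= t ->
    {ae P, forall om,
      (fun n : nat =>
         passage_time (env W om) 0 (Num.floor (n%:R * s), Num.floor (n%:R * t))
           / n%:R) @ \oo --> ell (s, t)}.

Definition inU {R : realType} (xi : R * R) : bool :=
  (0 < xi.1 < 1) && (xi.2 == 1 - xi.1).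
Definition Udir {R : realType} : set (R * R) := [set xi | inU xi].

Definition to_dir_infty {R : realType} (v : nat -> Z2) (xi : R * R) : Prop :=
  [/\ (forall M : R, \forall n \near \oo, M < l1norm (v n)),
      (fun n => (v n).1%:~R / l1norm (v n)) @ \oo --> xi.1 &
      (fun n => (v n).2%:~R / l1norm (v n)) @ \oo --> xi.2].

Definition cyl_sets {I : Type} {R : realType} : set (set (I -> R)) :=
  [set A | exists (i : I) (B : set R), measurable B /\ A = (fun f => f i) @^-1` B].
Definition cyl_sigma {I : Type} {R : realType} : set (set (I -> R)) :=
  <<s @cyl_sets I R >>.

Definition shiftZ {J : Type} {R : realType} (z : Z2) (f : Z2 * J -> R)
  : Z2 * J -> R := fun i => f (i.1 + z, i.2).

Definition stationary_ergodic {d} {T : measurableType d} {R : realType}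
    {J : Type} (P : probability T R) (Psi : T -> (Z2 * J -> R)) : Prop :=
  (forall (z : Z2) (G : set (Z2 * J -> R)), cyl_sigma G ->
      P (Psi @^-1` G) = P ((shiftZ z \o Psi) @^-1` G)) /\
  (forall G : set (Z2 * J -> R), cyl_sigma G ->
      (forall z : Z2, shiftZ z @^-1` G = G) ->
      P (Psi @^-1` G) = 0%E \/ P (Psi @^-1` G) = 1%E).

(* psi^{xi s}_x = (W(x;1), W(x;2), B^{xi s}(x,x+e1), B^{xi s}(x,x+e2)),
   indexed by (x, (xi, s, k)), s = true for "+", false for "-",
   k in {0,1,2,3} the component; set to 0 for xi outside U (these are
   not part of the process). *)
Definition psi_process {T : Type} {R : realType} (W : Z2 -> T -> R * R)
    (Bpm : bool -> R * R -> Z2 -> Z2 -> T -> R)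
  : T -> (Z2 * ((R * R) * bool * 'I_4) -> R) :=
  fun om i =>
    let x := i.1 in let xi := i.2.1.1 in let s := i.2.1.2 in
    if inU xi then
      match val i.2.2 with
      | 0%N => (W x om).1
      | 1%N => (W x om).2
      | 2%N => Bpm s xi x (x + e1) om
      | _ => Bpm s xi x (x + e2) om
      end
    else 0.

Definition future_sigma {T : Type} {R : realType} (W : Z2 -> T -> R * R)
    (x y : Z2) : set (set T) :=
  <<s [set A | exists (z : Z2) (B : set (R * R)),
                 [/\ le2 x z || le2 y z, measurable B & A = W z @^-1` B]] >>.

Definition measurable_wrt {T : Type} {R : realType} (F : set (set T))
    (f : T -> R) : Prop :=
  forall B : set R, measurable B -> F (f @^-1` B).

(* B xi : Busemann limit for xi in U0 om; Bpm true = B^{xi+},           *)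
(* Bpm false = B^{xi-}.                                                 *)
Definition busemann_pathwise {T : Type} {R : realType}
    (W : Z2 -> T -> R * R) (U0 : T -> set (R * R))
    (B : R * R -> Z2 -> Z2 -> T -> R)
    (Bpm : bool -> R * R -> Z2 -> Z2 -> T -> R) (om : T) : Prop :=
  let L := passage_time (env W om) in
  let Bp := Bpm true in let Bm := Bpm false in
  [/\
   U0 om `<=` Udir /\ countable (Udir `\` U0 om),
   (forall xi, U0 om xi -> forall (x y : Z2) (v : nat -> Z2),
       to_dir_infty v xi ->
       (fun n => L x (v n) - L y (v n)) @ \oo --> B xi x y om),
   (forall xi, inU xi -> forall x y : Z2,
      (forall eps : R, 0 < eps -> exists2 delta : R, 0 < delta &
         forall zeta, U0 om zeta -> xi.1 < zeta.1 < xi.1 + delta ->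
           `|B zeta x y om - Bp xi x y om| < eps) /\
      (forall eps : R, 0 < eps -> exists2 delta : R, 0 < delta &
         forall zeta, U0 om zeta -> xi.1 - delta < zeta.1 < xi.1 ->
           `|B zeta x y om - Bm xi x y om| < eps)) &
   [/\
   (forall s xi, inU xi -> forall x y z : Z2,
       Bpm s xi x y om = Bpm s xi x z om + Bpm s xi z y om),
   (forall s xi, inU xi -> forall x : Z2,
       Num.min ((W (x + e1) om).1 - Bpm s xi x (x + e1) om)
               ((W (x + e2) om).2 - Bpm s xi x (x + e2) om) = 0),
   (forall xi zeta, inU xi -> inU zeta -> xi.1 < zeta.1 -> forall x : Z2,
       (Bm xi x (x + e1) om <= Bp xi x (x + e1) om <= Bm zeta x (x + e1) om) /\
       (Bm zeta x (x + e2) om <= Bp xi x (x + e2) om <= Bm xi x (x + e2) om)),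
   (forall xi (zn : nat -> R * R) (x y : Z2), inU xi -> (forall n, inU (zn n)) ->
       ({homo (fun n => (zn n).1) : m n / (m <= n)%N >-> n <= m} /\
        (forall n, xi.1 < (zn n).1) /\ (fun n => (zn n).1) @ \oo --> xi.1 ->
        forall s, (fun n => Bpm s (zn n) x y om) @ \oo --> Bp xi x y om) /\
       ({homo (fun n => (zn n).1) : m n / (m <= n)%N >-> m <= n} /\
        (forall n, (zn n).1 < xi.1) /\ (fun n => (zn n).1) @ \oo --> xi.1 ->
        forall s, (fun n => Bpm s (zn n) x y om) @ \oo --> Bm xi x y om)) &
   (forall xi, U0 om xi -> forall x y : Z2,
       [/\ Bp xi x y om = B xi x y om, Bm xi x y om = B xi x y om &
           forall eps : R, 0 < eps -> exists2 delta : R, 0 < delta &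
             forall zeta, U0 om zeta -> `|zeta.1 - xi.1| < delta ->
               `|B zeta x y om - B xi x y om| < eps])]].

(* Main.v *)
Require Import Defs.
From HB Require Import structures.
From mathcomp Require Import all_boot all_order all_algebra.
From mathcomp Require Import all_classical all_reals all_analysis.
From mathcomp Require Import measurable_realfun.
From mathcomp Require Import zify ring lra.
Import Order.TTheory GRing.Theory Num.Theory.
Import numFieldNormedType.Exports.
Local Open Scope classical_set_scope.
Local Open Scope ring_scope.

Set Implicit Arguments.
Unset Strict Implicit.
Unset Printing Implicit Defensive.

(* Crossing of geodesics makes the increments L(x,v) - L(x+e1,v) monotone when v
   moves along an antidiagonal, and likewise for e2. Square integrability,
   independence and the strict convexity of the time constant give enough control to
   compare, almost surely, the increments towards any two far points lying in
   separated cones; monotonicity in the direction then produces the one-sided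
   limits B^{xi+-} in all directions at once, with at most countably many jumps.
   Fatou's lemma applied to increments on one side of xi bounds the means of the
   steps below by the partial derivatives of the time constant, and the cocycle
   property bounds xi . E B above by ell(xi); Euler's identity forces equality.
   Hence B^{xi+} and B^{xi-} have the same mean and agree almost surely for fixed
   xi. The whole family is an equivariant function of the i.i.d. environment, so
   ergodicity is the zero-one law for shift-invariant events. *)

(** For a single far point V the increments L(x,V) - L(y,V) may be atypical, and nothing is known
    about them beforehand. Two devices get around this. The endpoint is fixed and the start recedes
    from it along a ray: mean increments then telescope to the time constant, and a maximal
    inequality bounds the proportion of endpoints on the ray with a wrong backward average. Moreover
    V is a mere intermediary: increments towards p on one side of the ray and p' on the other are
    both compared with those towards V, and V drops out, so one good endpoint per probability level
    suffices.

    Strict convexity acts as follows. A geodesic from 0 to V through a point q off the ray would pay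
    about ell(q) to reach q, whereas a start far behind 0 reaches q at the price given by the
    tangent plane of ell along the ray; the gap between the two grows linearly in q and contradicts
    the backward averages.

    Chebyshev's bound, of order 1/r at scale r, is not summable over r, so rows are controlled at
    square scales only, whose consecutive ratios tend to 1.

    The limits are defined on every environment by iterated upper limits, so that measurability and
    equivariance are exact and not merely almost sure. *)

Ltac nat_lia :=
  first
  [ solve [ repeat match goal with h : ?A |- _ =>
              lazymatch type of A with
              | Prop => lazymatch A with
                        | is_true (leq _ _) => fail
                        | is_true (andb _ _) => fail
                        | @eq nat _ _ => fail
                        | _ => clear h
                        end
              end
            end; lia ]
  | lia ].

(** * Up-right paths and passage times *)

Section deterministic.
Context {R : realType}.
Implicit Types (w : Z2 -> R * R) (x y z v : Z2) (s t : seq bool) (b : bool).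

Definition edge w v b : R := if b then (w v).1 else (w v).2.

Lemma path_end0 x : path_end x [::] = x.
Proof. by rewrite /path_end /path_pos /= big_nil addr0. Qed.

Lemma path_pos0 x s : path_pos x s 0 = x.
Proof. by rewrite /path_pos take0 big_nil addr0. Qed.

Lemma path_pos_cons x b s k :
  path_pos x (b :: s) k.+1 = path_pos (x + step b) s k.
Proof. by rewrite /path_pos /= big_cons addrA. Qed.

Lemma path_end_cons x b s : path_end x (b :: s) = path_end (x + step b) s.
Proof. exact: path_pos_cons. Qed.

Lemma path_end_cat x s t : path_end x (s ++ t) = path_end (path_end x s) t.
Proof.
elim: s x => [|b s IH] x /=; first by rewrite path_end0.
by rewrite !path_end_cons IH.
Qed.

Lemma path_weight0 w x : path_weight w x [::] = 0.
Proof. by rewrite /path_weight big_ord0. Qed.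

Lemma path_weight_cons w x b s :
  path_weight w x (b :: s) = edge w (x + step b) b + path_weight w (x + step b) s.
Proof.
rewrite /path_weight /= big_ord_recl /=; congr (_ + _).
  by rewrite path_pos_cons path_pos0.
by apply: eq_bigr => k _; rewrite path_pos_cons.
Qed.

Lemma path_weight_cat w x s t :
  path_weight w x (s ++ t) = path_weight w x s + path_weight w (path_end x s) t.
Proof.
elim: s x => [|b s IH] x /=; first by rewrite path_end0 path_weight0 add0r.
by rewrite !path_weight_cons path_end_cons IH addrA.
Qed.

Lemma path_endE x s :
  path_end x s = (x.1 + (count id s)%:Z, x.2 + (count negb s)%:Z).
Proof.
elim: s x => [|b s IH] [x1 x2] /=; first by rewrite path_end0 !addr0.
rewrite path_end_cons IH; case: b => /=; congr pair; rewrite /=; lia.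
Qed.

Lemma path_size x s : size s = absz ((path_end x s).1 - x.1 + ((path_end x s).2 - x.2)).
Proof.
rewrite path_endE /= -(count_predC id s).
by rewrite (@eq_count _ (predC id) negb) //; lia.
Qed.

Lemma path_le2 x s : le2 x (path_end x s).
Proof. by rewrite path_endE /le2 /=; lia. Qed.

Lemma path_exists x y : le2 x y -> exists s, path_end x s = y.
Proof.
move=> /andP[h1 h2].
exists (nseq (absz (y.1 - x.1)%R) true ++ nseq (absz (y.2 - x.2)%R) false).
rewrite path_endE !count_cat !count_nseq /=.
by case: y h1 h2 => y1 y2 /= h1 h2; congr pair; lia.
Qed.

(** All up-right paths between two given points have the same length, so the infimum is a minimum
    over the finite type of Boolean tuples of that length. *)
Lemma pt_attained_le w x y : le2 x y -> exists s, [/\ path_end x s = y,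
  passage_time w x y = path_weight w x s &
  forall t, path_end x t = y -> passage_time w x y <= path_weight w x t].
Proof.
move=> /path_exists[s0 es0]; pose n := size s0.
pose t0 : n.-tuple bool := in_tuple s0.
pose P := fun t : n.-tuple bool => path_end x t == y.
have P0 : P t0 by rewrite /P es0.
case: (arg_minP (fun t : n.-tuple bool => path_weight w x t) P0) => t Pt tmin.
have tend : path_end x t = y by apply/eqP.
have tle s : path_end x s = y -> path_weight w x t <= path_weight w x s.
  move=> es; have sn : size s = n by rewrite (path_size x) es -es0 -path_size.
  have sz : size s == n by rewrite sn.
  by have := tmin (Tuple sz); rewrite /P /= es eqxx; apply.
have E : passage_time w x y = path_weight w x t.
  apply/eqP; rewrite eq_le; apply/andP; split.
    apply: ge_inf; last by exists (tval t).
    by exists (path_weight w x t) => _ [s /= es <-]; exact: tle.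
  apply: lb_le_inf; first by exists (path_weight w x t), (tval t).
  by move=> _ [s /= es <-]; exact: tle.
by exists t; split=> // s es; rewrite E; exact: tle.
Qed.

Lemma pt_attained w x y : le2 x y ->
  exists2 s, path_end x s = y & passage_time w x y = path_weight w x s.
Proof. by move=> /(pt_attained_le w)[s [? ? _]]; exists s. Qed.

Lemma pt_le w x s : passage_time w x (path_end x s) <= path_weight w x s.
Proof. by have [? [_ _]] := pt_attained_le w (path_le2 x s); apply. Qed.

(** The set of paths is empty and the infimum of the empty set is 0. This default lets measurability
    and integrability be proved for all pairs of points at once. *)
Lemma pt_not_le2 w x y : ~~ le2 x y -> passage_time w x y = 0.
Proof.
move=> nxy; rewrite /passage_time (_ : [set _ | _ in _] = set0) ?inf0//.
apply/seteqP; split=> // _ [s /= es _].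
by move: nxy; rewrite -es path_le2.
Qed.

Lemma le2_refl x : le2 x x. Proof. by rewrite /le2 !lexx. Qed.

Lemma le2_trans x y z : le2 x y -> le2 y z -> le2 x z.
Proof. by rewrite /le2; lia. Qed.

Lemma path_end_id x s : path_end x s = x -> s = [::].
Proof. by move=> e; apply: size0nil; rewrite (path_size x) e; lia. Qed.

Lemma pt_xx w x : passage_time w x x = 0.
Proof.
have [s /path_end_id -> ->] := pt_attained w (le2_refl x).
exact: path_weight0.
Qed.

Lemma pt_tri w x y z : le2 x y -> le2 y z ->
  passage_time w x z <= passage_time w x y + passage_time w y z.
Proof.
move=> /(pt_attained w)[s es ->] /(pt_attained w)[t et ->].
by rewrite -et -es -path_end_cat -path_weight_cat; exact: pt_le.
Qed.

(** Both pieces of an optimal path are optimal: each piece weighs at least its passage time, and the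
    triangle inequality leaves no room for a strict inequality. *)
Lemma pt_split w x s t :
  passage_time w x (path_end x (s ++ t)) = path_weight w x (s ++ t) ->
  passage_time w x (path_end x s) = path_weight w x s /\
  passage_time w (path_end x s) (path_end x (s ++ t)) = path_weight w (path_end x s) t.
Proof.
rewrite path_weight_cat path_end_cat => e.
have h1 := pt_le w x s; have h2 := pt_le w (path_end x s) t.
have h3 := pt_tri w (path_le2 x s) (path_le2 (path_end x s) t).
by split; apply/eqP; rewrite eq_le ?h1 ?h2 /=; lra.
Qed.

Lemma le2_step x b y : le2 (x + step b) y -> le2 x y.
Proof. by case: x y b => [a c] [d e] []; rewrite /le2 /=; lia. Qed.

Lemma pt_step_le w x b y : le2 (x + step b) y ->
  passage_time w x y <= edge w (x + step b) b + passage_time w (x + step b) y.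
Proof.
move=> /(pt_attained w)[s <- ->].
by rewrite -path_weight_cons -path_end_cons; exact: pt_le.
Qed.

Lemma pt_step_ex w x y : le2 x y -> x <> y -> exists b, le2 (x + step b) y /\
  passage_time w x y = edge w (x + step b) b + passage_time w (x + step b) y.
Proof.
move=> /(pt_attained w)[[|b s]]; first by rewrite path_end0.
rewrite path_end_cons => es E _; exists b; split; first by rewrite -es path_le2.
apply/eqP; rewrite eq_le pt_step_le -?es ?path_le2//= es E path_weight_cons.
by rewrite lerD2l -es pt_le.
Qed.

Lemma pt_end_le w x b y : le2 x y ->
  passage_time w x (y + step b) <= passage_time w x y + edge w (y + step b) b.
Proof.
move=> /(pt_attained w)[s <- ->].
have -> : path_end x s + step b = path_end x (s ++ [:: b]).
  by rewrite path_end_cat path_end_cons path_end0.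
rewrite (le_trans (pt_le _ _ _)) // path_weight_cat path_weight_cons path_weight0.
by rewrite addr0 path_end_cat path_end_cons path_end0.
Qed.

Lemma pt_end_ex w x y : le2 x y -> x <> y -> exists b, le2 x (y - step b) /\
  passage_time w x y = passage_time w x (y - step b) + edge w y b.
Proof.
move=> /(pt_attained w)[s]; case/lastP: s => [|s b]; first by rewrite path_end0.
rewrite -cats1 path_end_cat path_end_cons path_end0 => es E _; exists b.
have ye : y - step b = path_end x s by rewrite -es addrK.
rewrite ye path_le2; split=> //.
have [] := @pt_split w x s [:: b].
  by rewrite path_end_cat path_end_cons path_end0 es.
move=> -> _; rewrite E path_weight_cat path_weight_cons path_weight0 addr0.
by rewrite es.
Qed.

Lemma pt_end_min w x v b : le2 x v ->
  passage_time w x (v + step b + step (~~ b)) =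
  Num.min (passage_time w x (v + step (~~ b)) + edge w (v + step b + step (~~ b)) b)
    (passage_time w x (v + step b) + edge w (v + step b + step (~~ b)) (~~ b)).
Proof.
move=> xv; have xvb c : le2 x (v + step c).
  by move: xv; case: c; rewrite /le2 /=; lia.
apply/eqP; rewrite eq_le le_min; apply/andP; split.
  apply/andP; split; last exact: pt_end_le.
  by have := pt_end_le w b (xvb (~~ b)); rewrite addrAC.
have [||c [_ ->]] := @pt_end_ex w x (v + step b + step (~~ b)).
- by move: xv; case: (b); rewrite /le2 /=; lia.
- by move=> xE; move: xv; rewrite {1}xE; case: (b); rewrite /le2 /=; lia.
- have [->|->] : c = b \/ c = ~~ b by case: (b) (c) => [] []; auto.
    by rewrite [v + step b + _]addrAC addrK ge_min lexx.
  by rewrite addrK ge_min lexx orbT.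
Qed.

Lemma pt_line w x b y : le2 x y -> ~~ le2 x (y + step b - step (~~ b)) ->
  passage_time w x (y + step b) = passage_time w x y + edge w (y + step b) b.
Proof.
move=> xy nxy; have [||c [h ->]] := @pt_end_ex w x (y + step b).
- by move: xy; case: (b); rewrite /le2 /=; lia.
- by move=> xE; move: xy; rewrite {1}xE; case: (b); rewrite /le2 /=; lia.
- have cb : c = b by move: h nxy; case: (b) (c) => [] [] //= ->.
  by rewrite cb addrK.
Qed.

Lemma pt_start_min w x v : le2 (x + e1) v -> le2 (x + e2) v ->
  passage_time w x v =
  Num.min ((w (x + e1)).1 + passage_time w (x + e1) v)
          ((w (x + e2)).2 + passage_time w (x + e2) v).
Proof.
move=> xv1 xv2; apply/eqP; rewrite eq_le le_min; apply/andP; split.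
  by rewrite (pt_step_le w (b:=true) xv1) (pt_step_le w (b:=false) xv2).
have [||[] [_ ->]] := @pt_step_ex w x v.
- by move: xv1; rewrite /le2 /=; lia.
- by move=> xE; move: xv1; rewrite {1}xE /le2 /=; lia.
- by rewrite ge_min lexx.
- by rewrite ge_min lexx orbT.
Qed.

(** * Monotonicity of increments *)

Definition incr b w x v : R := passage_time w x v - passage_time w (x + step b) v.

(** This is the comparison principle behind the monotonicity of increments: replacing a minimum by
    one with shifted arguments moves it by an amount between the two shifts. *)
Lemma min_shift_between (c1 c2 i1 i2 : R) : i2 <= i1 ->
  i2 <= Num.min (c1 + i1) (c2 + i2) - Num.min c1 c2 <= i1 /\
  i2 <= Num.min (c2 + i2) (c1 + i1) - Num.min c2 c1 <= i1.
Proof.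
move=> i21; have H : i2 <= Num.min (c1 + i1) (c2 + i2) - Num.min c1 c2 <= i1.
  by case: (lerP (c1 + i1) (c2 + i2)) => h1; case: (lerP c1 c2) => h2; lra.
by split=> //; rewrite minC (minC c2).
Qed.

Lemma mulrn_Z2 x n : x *+ n = (x.1 * n%:Z, x.2 * n%:Z).
Proof.
have -> : x *+ n = (x.1 *+ n, x.2 *+ n) by elim: n => [//|n IH]; rewrite !mulrS IH.
by rewrite -[x.1 *+ n]mulr_natr -[x.2 *+ n]mulr_natr !natz.
Qed.

(* Both v |-> L(x,v) and v |-> L(x+e1,v) solve the same recursion at the endpoint,
   so the comparisons propagate from the boundary of the quadrant. *)
Lemma incr_monotone b w x v : le2 (x + step b) v ->
  incr b w x v <= incr b w x (v + step b) /\
  incr b w x (v + step (~~ b)) <= incr b w x v.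
Proof.
(* Coordinates on the quadrant above [x + step b], in which both inequalities become statements
   about two natural indices and the two axes are treated alike. *)
pose V m n := x + step b + step b *+ m + step (~~ b) *+ n.
move=> xv; have [m [n ->]] : exists m n : nat, v = V m n.
  rewrite /V; move: xv; case: x v b {V} => [a c] [d e] []; rewrite /le2 /= => h.
    exists (absz (d - a - 1)%R), (absz (e - c)%R); rewrite !mulrn_Z2 /=.
    by congr pair; rewrite /=; lia.
  exists (absz (e - c - 1)%R), (absz (d - a)%R); rewrite !mulrn_Z2 /=.
  by congr pair; rewrite /=; lia.
have VS1 m' n' : V m'.+1 n' = V m' n' + step b.
  by rewrite /V mulrSr !addrA [RHS]addrAC.
have VS2 m' n' : V m' n'.+1 = V m' n' + step (~~ b).
  by rewrite /V mulrSr !addrA.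
have xV m' n' : le2 (x + step b) (V m' n').
  by rewrite /V !mulrn_Z2; case: (b); rewrite /le2 /=; lia.
have xV0 m' n' : le2 x (V m' n') by exact: le2_step (xV m' n').
rewrite -VS1 -VS2.
(* On the axis in direction [b] the last step is forced for both starting points, so both passage
   times gain the same edge and the increment is constant. *)
have H0 m' : incr b w x (V m' 0) <= incr b w x (V m'.+1 0).
  rewrite VS1 /incr !pt_line//; first by rewrite /=; lra.
    by rewrite /V !mulrn_Z2; case: (b); rewrite /le2 /=; lia.
  by rewrite /V !mulrn_Z2; case: (b); rewrite /le2 /=; lia.
(* On the other axis the step is forced only from [x + step b]; from [x] the new edge is one
   competitor among others, which gives the inequality. *)
have K0 n' : incr b w x (V 0 n'.+1) <= incr b w x (V 0 n').
  rewrite VS2 /incr [X in _ - X <= _]pt_line//; last first.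
    by rewrite /V !mulrn_Z2; case: (b); rewrite /le2 /=; lia.
  by have := pt_end_le w (~~ b) (xV0 0 n'); lra.
have HK m' n' : incr b w x (V m' n') <= incr b w x (V m'.+1 n') ->
    incr b w x (V m' n'.+1) <= incr b w x (V m' n') ->
    incr b w x (V m' n'.+1) <= incr b w x (V m'.+1 n'.+1) <= incr b w x (V m'.+1 n').
  move=> h k; have := min_shift_between
    (passage_time w (x + step b) (V m'.+1 n') + edge w (V m'.+1 n'.+1) (~~ b))
    (passage_time w (x + step b) (V m' n'.+1) + edge w (V m'.+1 n'.+1) b) (le_trans k h).
  case=> _; have E y : le2 y (V m' n') -> passage_time w y (V m'.+1 n'.+1) =
    Num.min (passage_time w y (V m' n'.+1) + edge w (V m'.+1 n'.+1) b)
      (passage_time w y (V m'.+1 n') + edge w (V m'.+1 n'.+1) (~~ b)).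
    by move=> yV; rewrite VS2 !VS1 pt_end_min// -VS2.
  rewrite -E// => /andP[g1 g2].
  set I2 := incr b w x (V m' n'.+1) in g1 g2 *.
  set I1 := incr b w x (V m'.+1 n') in g1 g2 *.
  have -> : incr b w x (V m'.+1 n'.+1) =
     passage_time w x (V m'.+1 n'.+1) - passage_time w (x + step b) (V m'.+1 n'.+1).
    by [].
  have e1 : passage_time w (x + step b) (V m' n'.+1) + edge w (V m'.+1 n'.+1) b + I2 =
     passage_time w x (V m' n'.+1) + edge w (V m'.+1 n'.+1) b.
    by rewrite /I2 /incr; ring.
  have e2 : passage_time w (x + step b) (V m'.+1 n') + edge w (V m'.+1 n'.+1) (~~ b) + I1 =
     passage_time w x (V m'.+1 n') + edge w (V m'.+1 n'.+1) (~~ b).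
    by rewrite /I1 /incr; ring.
  by rewrite e1 e2 -E// in g1 g2; rewrite g1 g2.
have KH n' : (forall m', incr b w x (V m' n') <= incr b w x (V m'.+1 n')) ->
    forall m', incr b w x (V m' n'.+1) <= incr b w x (V m' n').
  move=> h; elim=> [|m' IH]; first exact: K0.
  by have /andP[] := HK _ _ (h m') IH.
have HH n' m' : incr b w x (V m' n') <= incr b w x (V m'.+1 n').
  elim: n' m' => [|n' IH] m'; first exact: H0.
  by have /andP[] := HK _ _ (IH m') (KH n' IH m').
by split; [exact: HH|exact: KH].
Qed.

Lemma incr_mono_n b w x v n : le2 (x + step b) v ->
  incr b w x v <= incr b w x (v + step b *+ n) /\
  incr b w x (v + step (~~ b) *+ n) <= incr b w x v.
Proof.
move=> xv; elim: n => [|n [IH1 IH2]]; first by rewrite !mulr0n !addr0.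
have h c : le2 (x + step b) (v + step c *+ n).
  by move: xv; rewrite mulrn_Z2; case: (b) c => [] []; rewrite /le2 /=; lia.
rewrite !mulrSr !addrA; split.
  by apply: le_trans IH1 _; have [] := @incr_monotone b w x _ (h b).
by apply: le_trans IH2; have [] := @incr_monotone b w x _ (h (~~ b)).
Qed.

Definition shift_env z w : Z2 -> R * R := fun x => w (x + z).

Lemma path_pos_shift x z s k : path_pos x s k + z = path_pos (x + z) s k.
Proof. by rewrite /path_pos addrAC. Qed.

Lemma pt_shift z w x y :
  passage_time (shift_env z w) x y = passage_time w (x + z) (y + z).
Proof.
congr inf; apply/seteqP; split=> _ [s /= es <-]; exists s.
- by rewrite -es /path_end path_pos_shift.
- by apply: eq_bigr => k _; rewrite /shift_env path_pos_shift.
- by apply: (addIr z); rewrite -es /path_end path_pos_shift.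
- by apply: eq_bigr => k _; rewrite /shift_env path_pos_shift.
Qed.

Definition swap2 (A : Type) (p : A * A) : A * A := (p.2, p.1).

Definition refl_env w : Z2 -> R * R := fun x => swap2 (w (swap2 x)).

Lemma path_end_refl x s : path_end (swap2 x) (map negb s) = swap2 (path_end x s).
Proof.
rewrite !path_endE /swap2 /= !count_map; congr (_ + _%:Z, _ + _%:Z).
by apply: eq_count => b /=; rewrite negbK.
Qed.

Lemma path_weight_refl w x s :
  path_weight (refl_env w) (swap2 x) (map negb s) = path_weight w x s.
Proof.
elim: s x => [|b s IH] x; first by rewrite !path_weight0.
rewrite /= !path_weight_cons.
have -> : swap2 x + step (~~ b) = swap2 (x + step b) by case: b.
by rewrite IH; congr (_ + _); case: b.
Qed.

Lemma pt_refl w x y :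
  passage_time (refl_env w) (swap2 x) (swap2 y) = passage_time w x y.
Proof.
have K : cancel (@swap2 int) (@swap2 int) by case.
congr inf; apply/seteqP; split=> _ [s /= es <-].
- exists (map negb s).
    by rewrite -(K x) path_end_refl es K.
  rewrite -path_weight_refl -map_comp map_id_in// => b _ /=; exact: negbK.
- by exists (map negb s); [rewrite path_end_refl es|exact: path_weight_refl].
Qed.

End deterministic.

(** * Real-valued expectations *)

Section expect.
Context {R : realType} {d : measure_display} {T : measurableType d}.
Variable P : probability T R.
Implicit Types (f g h : T -> R) (A B : set T).

Definition intg f := P.-integrable setT (EFin \o f).
Definition Ex f : R := Rintegral P setT f.
Definition pr A : R := fine (P A).

Lemma prE A : measurable A -> P A = (pr A)%:E.
Proof. by move=> mA; rewrite fineK// fin_num_measure. Qed.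

Lemma pr_ge0 A : 0 <= pr A. Proof. exact: fine_ge0. Qed.

Lemma pr_le A B : measurable A -> measurable B -> A `<=` B -> pr A <= pr B.
Proof. by move=> mA mB AB; rewrite -lee_fin -!prE// le_measure ?inE. Qed.

Lemma pr_le1 A : measurable A -> pr A <= 1.
Proof. by move=> mA; rewrite -lee_fin -prE// probability_le1. Qed.

Lemma pr_setC A : measurable A -> pr (~` A) = 1 - pr A.
Proof.
move=> mA; apply: EFin_inj; rewrite -prE ?probability_setC//; last exact: measurableC.
by rewrite prE// EFinB.
Qed.

Lemma pr_setU A B : measurable A -> measurable B -> pr (A `|` B) <= pr A + pr B.
Proof.
by move=> mA mB; rewrite -lee_fin EFinD -!prE//; [exact: measureU2|exact: measurableU].
Qed.

Lemma pr_bigcup (F : (set T)^nat) (c : R) : (forall n, measurable (F n)) ->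
  nondecreasing_seq F -> (forall n, pr (F n) <= c) -> pr (\bigcup_n F n) <= c.
Proof.
move=> mF ndF Fc; rewrite -lee_fin -prE; last exact: bigcupT_measurable.
have := @nondecreasing_cvg_mu _ _ _ P F mF (bigcupT_measurable _ mF) ndF.
move/cvg_lim => <- //; apply: lime_le.
  by apply: ereal_nondecreasing_is_cvgn => m n mn; rewrite le_measure ?inE//; exact/subsetPset/ndF.
by near=> n; rewrite /= prE// lee_fin.
Unshelve. all: by end_near. Qed.

Lemma pr_bigsetU (F : (set T)^nat) n : (forall k, measurable (F k)) ->
  pr (\big[setU/set0]_(k < n) F k) <= \sum_(k < n) pr (F k).
Proof.
move=> mF; elim: n => [|n IH]; first by rewrite !big_ord0 /pr measure0.
rewrite !big_ord_recr /=; apply: le_trans (pr_setU _ _) _ => //.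
  exact: bigsetU_measurable.
by rewrite lerD2r.
Qed.

Lemma intgD f g : intg f -> intg g -> intg (fun x => f x + g x).
Proof. by move=> hf hg; rewrite /intg; exact: (integrableD measurableT hf hg). Qed.

Lemma intgB f g : intg f -> intg g -> intg (fun x => f x - g x).
Proof. by move=> hf hg; rewrite /intg; exact: (integrableB measurableT hf hg). Qed.

Lemma intgZ (k : R) f : intg f -> intg (fun x => k * f x).
Proof. by move=> hf; rewrite /intg; exact: (integrableZl measurableT k hf). Qed.

Lemma intg_cst (k : R) : intg (fun=> k).
Proof. exact: (finite_measure_integrable_cst P k measurableT). Qed.

Lemma intg_indic A : measurable A -> intg (\1_A).
Proof. by move=> mA; apply: integrable_indic. Qed.

Lemma intg_norm f : intg f -> intg (fun x => `|f x|).
Proof. by move=> hf; exact: (integrable_norm hf). Qed.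

Lemma intg_meas f : intg f -> measurable_fun setT f.
Proof. by move=> /measurable_int /measurable_EFinP. Qed.

Lemma intg_le f g : measurable_fun setT f -> intg g ->
  (forall x, `|f x| <= g x) -> intg f.
Proof.
move=> mf hg fg; apply: (le_integrable measurableT _ _ hg).
  exact/measurable_EFinP.
by move=> x _ /=; rewrite lee_fin (le_trans (fg x))// ler_norm.
Qed.

Lemma intg_sum n (F : nat -> T -> R) : (forall k, (k < n)%N -> intg (F k)) ->
  intg (fun x => \sum_(k < n) F k x).
Proof.
elim: n => [|n IH] hF.
  by under eq_fun do rewrite big_ord0; exact: intg_cst.
under eq_fun do rewrite big_ord_recr /=.
by apply: intgD; [apply: IH => k kn; apply: hF; lia|apply: hF].
Qed.

Lemma ExD f g : intg f -> intg g -> Ex (fun x => f x + g x) = Ex f + Ex g.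
Proof. exact: RintegralD. Qed.

Lemma ExB f g : intg f -> intg g -> Ex (fun x => f x - g x) = Ex f - Ex g.
Proof. exact: RintegralB. Qed.

Lemma ExZ (k : R) f : intg f -> Ex (fun x => k * f x) = k * Ex f.
Proof. exact: RintegralZl. Qed.

Lemma Ex_cst (k : R) : Ex (fun=> k) = k.
Proof.
by rewrite /Ex /Rintegral integral_cst//= probability_setT mule1.
Qed.

Lemma Ex_le f g : intg f -> intg g -> (forall x, f x <= g x) -> Ex f <= Ex g.
Proof. by move=> hf hg fg; apply: le_Rintegral. Qed.

Lemma Ex_ge0 f : (forall x, 0 <= f x) -> 0 <= Ex f.
Proof. by move=> f0; apply: Rintegral_ge0. Qed.

Lemma Ex_indic A : measurable A -> Ex (\1_A) = pr A.
Proof. by move=> mA; rewrite /Ex /Rintegral integral_indic// setIT. Qed.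

Lemma Ex_sum n (F : nat -> T -> R) : (forall k, (k < n)%N -> intg (F k)) ->
  Ex (fun x => \sum_(k < n) F k x) = \sum_(k < n) Ex (F k).
Proof.
elim: n => [|n IH] hF.
  by under eq_fun do rewrite big_ord0; rewrite Ex_cst big_ord0.
under eq_fun do rewrite big_ord_recr /=.
have hn k : (k < n)%N -> intg (F k) by move=> kn; apply: hF; lia.
by rewrite ExD ?IH ?big_ord_recr//; [exact: intg_sum|exact: hF].
Qed.

Lemma ExE f : intg f -> (\int[P]_x (f x)%:E)%E = (Ex f)%:E.
Proof. by move=> hf; rewrite /Ex /Rintegral fineK// integrable_fin_num. Qed.

Lemma markov_pr f A (c : R) : 0 < c -> measurable A -> intg f ->
  (forall x, 0 <= f x) -> (forall x, A x -> c <= f x) -> pr A <= Ex f / c.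
Proof.
move=> c0 mA hf f0 Af; rewrite ler_pdivlMr// mulrC -Ex_indic// -ExZ; last exact: intg_indic.
apply: Ex_le => //; first by apply: intgZ; exact: intg_indic.
move=> x; rewrite indicE; case: (boolP (x \in A)) => [/set_mem/Af|_]; first by rewrite mulr1.
by rewrite mulr0.
Qed.

Definition sqint f := measurable_fun setT f /\ intg (fun x => f x ^+ 2).

Lemma sqint_intg f : sqint f -> intg f.
Proof.
move=> [mf h]; apply: (@intg_le f (fun x => 1 + f x ^+ 2)) => //.
  by apply: intgD => //; exact: intg_cst.
move=> x; rewrite -real_normK ?num_real//.
by have := sqr_ge0 (`|f x| - 1); have := normr_ge0 (f x); rewrite -subr_ge0; nra.
Qed.

Lemma sqint_mul f g : sqint f -> sqint g -> intg (fun x => f x * g x).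
Proof.
move=> [mf hf] [mg hg]; apply: (intg_le (measurable_funM mf mg) (intgD hf hg)).
move=> x; rewrite normrM -(real_normK (num_real (f x))) -(real_normK (num_real (g x))).
by have := sqr_ge0 (`|f x| - `|g x|); have := normr_ge0 (f x); have := normr_ge0 (g x); nra.
Qed.

Lemma sqint_le f g : measurable_fun setT f -> sqint g ->
  (forall x, `|f x| <= `|g x|) -> sqint f.
Proof.
move=> mf [mg hg] fg; split=> //; apply: (intg_le _ hg).
  exact: measurable_funX.
by move=> x; rewrite normrX -(real_normK (num_real (g x))) lerXn2r ?nnegrE.
Qed.

Lemma sqint_cst (k : R) : sqint (fun=> k).
Proof. by split; [exact: measurable_cst|exact: intg_cst]. Qed.

Lemma sqintD f g : sqint f -> sqint g -> sqint (fun x => f x + g x).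
Proof.
move=> hf hg; split; first by apply: measurable_funD; [case: hf|case: hg].
have -> : (fun x => (f x + g x) ^+ 2) = (fun x => f x ^+ 2 + g x ^+ 2 + 2 * (f x * g x)).
  by apply/funext => x; ring.
apply: intgD; first by apply: intgD; [case: hf|case: hg].
by apply: intgZ; exact: sqint_mul.
Qed.

Lemma sqint_norm f : sqint f -> sqint (fun x => `|f x|).
Proof.
move=> hf; apply: (sqint_le _ hf) => [|x]; last by rewrite normr_id.
by apply: measurableT_comp => //; case: hf.
Qed.

Lemma sqint_min f g : sqint f -> sqint g -> sqint (fun x => Num.min (f x) (g x)).
Proof.
move=> hf hg; have [mf _] := hf; have [mg _] := hg.
apply: (sqint_le _ (sqintD (sqint_norm hf) (sqint_norm hg))).
  exact: measurable_minr.
move=> x; rewrite [X in _ <= X]ger0_norm ?addr_ge0//.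
by case: (lerP (f x) (g x)) => _; rewrite ?lerDl ?lerDr.
Qed.

Lemma sqint_sum n (F : nat -> T -> R) : (forall k, (k < n)%N -> sqint (F k)) ->
  sqint (fun x => \sum_(k < n) F k x).
Proof.
elim: n => [|n IH] hF.
  by under eq_fun do rewrite big_ord0; exact: sqint_cst.
under eq_fun do rewrite big_ord_recr /=.
by apply: sqintD; [apply: IH => k kn; apply: hF; lia|apply: hF].
Qed.

End expect.

(** * Transport of integrals along measure-preserving maps *)

Section preserving.
Context {R : realType} {d d' : measure_display}.
Context {T : measurableType d} {U : measurableType d'}.
Variables (P : probability T R) (Q : probability U R) (phi : T -> U).
Hypothesis mphi : measurable_fun setT phi.
Hypothesis phiP : forall A, measurable A -> P (phi @^-1` A) = Q A.

Lemma ge0_integral_preserving (f : U -> \bar R) : measurable_fun setT f ->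
  (forall y, 0 <= f y)%E -> (\int[Q]_y f y = \int[P]_x f (phi x))%E.
Proof.
move=> mf f0; rewrite -[RHS](@ge0_integral_pushforward _ _ _ _ _ phi mphi P setT f)//.
by apply: eq_measure_integral => A mA _; exact/esym/phiP.
Qed.

Lemma intg_preserving (f : U -> R) : measurable_fun setT f ->
  intg Q f <-> intg P (f \o phi).
Proof.
move=> mf; have E : (\int[Q]_y `|(EFin \o f) y| = \int[P]_x `|(EFin \o f \o phi) x|)%E.
  rewrite ge0_integral_preserving//.
  by apply: measurableT_comp => //; exact/measurable_EFinP.
split=> /integrableP[_ h]; apply/integrableP; split.
- by apply/measurable_EFinP; exact: measurableT_comp.
- by move: h; rewrite E.
- exact/measurable_EFinP.
- by move: h; rewrite E.
Qed.

Lemma Ex_preserving (f : U -> R) : intg Q f -> Ex P (f \o phi) = Ex Q f.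
Proof.
move=> hf; have mf := intg_meas hf; rewrite /Ex /Rintegral; congr fine.
rewrite -[LHS](@integral_pushforward _ _ _ _ _ phi mphi P setT (EFin \o f))//.
- by apply: eq_measure_integral => A mA _; exact: phiP.
- exact/measurable_EFinP.
- by apply/(intg_preserving mf).
Qed.

Lemma sqint_preserving (f : U -> R) : sqint Q f -> sqint P (f \o phi).
Proof.
move=> [mf hf]; split; first exact: measurableT_comp.
by apply/(@intg_preserving (fun y => f y ^+ 2)) => //; exact: measurable_funX.
Qed.

End preserving.

Section indep.
Context {R : realType} {d : measure_display} {T : measurableType d}.
Variable P : probability T R.

(* The pair (X, Y) has the product law, so the claim is Fubini for (x, y) |-> x y. *)
Lemma Ex_indep_mul (X Y : T -> R) : measurable_fun setT X -> measurable_fun setT Y ->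
  intg P X -> intg P Y ->
  (forall A B, measurable A -> measurable B ->
     P (X @^-1` A `&` Y @^-1` B) = (P (X @^-1` A) * P (Y @^-1` B))%E) ->
  intg P (fun x => X x * Y x) -> Ex P (fun x => X x * Y x) = Ex P X * Ex P Y.
Proof.
move=> mX mY iX iY XY iXY.
pose mixX := isMeasurableFun.Build _ _ _ _ _ mX.
pose X' : {mfun T >-> R} := MeasurableFun.Pack (MeasurableFun.Class mixX).
pose mixY := isMeasurableFun.Build _ _ _ _ _ mY.
pose Y' : {mfun T >-> R} := MeasurableFun.Pack (MeasurableFun.Class mixY).
have mZ : measurable_fun setT (fun x => (X x, Y x)) by exact: measurable_fun_pair.
pose mixZ := isMeasurableFun.Build _ _ _ _ _ mZ.
pose Z' : {mfun T >-> (R * R)%type} := MeasurableFun.Pack (MeasurableFun.Class mixZ).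
pose m1 := distribution P X'; pose m2 := distribution P Y'.
have E C : measurable C -> (m1 \x m2)%E C = distribution P Z' C.
  apply: product_measure_unique => A B mA mB.
  exact: XY.
pose f (p : R * R) : \bar R := (p.1 * p.2)%:E.
have mf : measurable_fun setT f.
  by apply/measurable_EFinP; apply: measurable_funM.
have if0 : (distribution P Z').-integrable setT f.
  by apply: (@integrable_pushforward _ _ _ _ _ Z') => //; exact: iXY.
have if1 : (m1 \x m2)%E.-integrable setT f.
  apply/integrableP; split=> //.
  have /integrableP[_] := if0.
  by rewrite (eq_measure_integral (m1 \x m2)%E)// => C mC _; exact/esym/E.
apply: EFin_inj; rewrite EFinM -!ExE//.
transitivity (\int[m1 \x m2]_p f p)%E.
  rewrite (eq_measure_integral (distribution P Z')) => [|C mC _]; last exact: E.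
  by rewrite (@integral_pushforward _ _ _ _ _ Z')//; exact: iXY.
rewrite -integral12_prod_meas1//.
have i1 : m1.-integrable setT EFin.
  by apply: (@integrable_pushforward _ _ _ _ _ X') => //; exact: iX.
have i2 : m2.-integrable setT EFin.
  by apply: (@integrable_pushforward _ _ _ _ _ Y') => //; exact: iY.
have e2 : (\int[m2]_y y%:E = \int[P]_x (Y x)%:E)%E.
  by rewrite (@integral_pushforward _ _ _ _ _ Y')//; exact: iY.
transitivity (\int[m1]_x (x%:E * \int[P]_x (Y x)%:E))%E.
  apply: eq_integral => x _.
  rewrite (_ : fubini_F m2 f x = \int[m2]_y (x%:E * y%:E))%E//.
  by rewrite integralZl// e2.
rewrite (ExE iY) integralZr//; congr (_ * _)%E.
by rewrite (@integral_pushforward _ _ _ _ _ X')//; exact: iX.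
Qed.

End indep.

(** * The space of environments *)

Section env_space.
Context {R : realType}.

(** The parameter [S] makes one definition serve both the full product sigma-algebra and the
    information carried by a set of sites. *)
Definition cyl_env (S : set Z2) : set (set (Z2 -> R * R)) :=
  [set A | exists z B, [/\ S z, measurable B & A = (fun w => w z) @^-1` B]].

Definition envT := g_sigma_algebraType (cyl_env setT).

(** Finite rectangles generate the same sigma-algebra as the cylinders and are stable under
    intersection, as uniqueness of measures requires. *)
Definition rect_env (S : set Z2) : set (set (Z2 -> R * R)) :=
  [set A | exists (s : seq Z2) (B : Z2 -> set (R * R)),
    [/\ (forall z, z \in s -> S z), (forall z, measurable (B z)) &
        A = [set w | forall z, z \in s -> B z (w z)]]].

Lemma rect_env_setI S : setI_closed (rect_env S).
Proof.
move=> _ _ [s [B [sS mB ->]]] [s' [B' [sS' mB' ->]]].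
exists (s ++ s'), (fun z => (if z \in s then B z else setT) `&`
                            (if z \in s' then B' z else setT)); split.
- by move=> z; rewrite mem_cat => /orP[/sS|/sS'].
- by move=> z; apply: measurableI; case: ifP.
- apply/seteqP; split=> w /=.
    by move=> [h h'] z _; split; case: ifP => // zs; [exact: h|exact: h'].
  move=> h; split=> z zs; have := h z; rewrite mem_cat zs ?orbT => /(_ isT)[]//.
Qed.

Lemma rect_env_setT S : rect_env S setT.
Proof.
by exists [::], (fun=> setT); split=> //; apply/seteqP; split.
Qed.

Lemma sigma_rect_env S : <<s cyl_env S >> = <<s rect_env S >>.
Proof.
apply/seteqP; split; apply: smallest_sub; try exact: smallest_sigma_algebra.
  move=> _ [z [B [Sz mB ->]]]; apply: sub_sigma_algebra.
  exists [:: z], (fun=> B); split=> //; first by move=> y; rewrite inE => /eqP ->.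
  apply/seteqP; split=> w /=; first by move=> h y; rewrite inE => /eqP ->.
  by apply; rewrite inE.
move=> _ [s [B [sS mB ->]]].
have -> : [set w : Z2 -> R * R | forall z, z \in s -> B z (w z)] =
    \big[setI/setT]_(z <- s) ((fun w : Z2 -> R * R => w z) @^-1` B z).
  elim: s {sS} => [|y s IH]; first by rewrite big_nil; apply/seteqP; split.
  rewrite big_cons -IH; apply/seteqP; split=> w /=.
    by move=> h; split; [|move=> z zs]; apply: h; rewrite inE ?eqxx ?zs ?orbT.
  by move=> [h1 h2] z; rewrite inE => /orP[/eqP ->//|]; exact: h2.
rewrite big_seq; apply: (big_ind (fun A => <<s cyl_env S >> A)).
- exact: (@measurableT _ (g_sigma_algebraType (cyl_env S))).
- exact: (@measurableI _ (g_sigma_algebraType (cyl_env S))).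
- by move=> z zs; apply: sub_sigma_algebra; exists z, (B z); split=> //; exact: sS.
Qed.

Lemma measurable_coord (S : set Z2) z : S z ->
  measurable_fun setT (fun w : g_sigma_algebraType (cyl_env S) => w z).
Proof.
move=> Sz _ B mB; rewrite setTI; apply: sub_sigma_algebra.
by exists z, B.
Qed.

Lemma measurable_env d (T : measurableType d) (W : T -> envT) :
  (forall z, measurable_fun setT (fun t => W t z)) -> measurable_fun setT W.
Proof.
move=> mW; apply: (@measurability _ _ _ _ setT W (cyl_env setT)) => //.
move=> _ [_ [z [B [_ mB ->]]] <-].
exact: mW.
Qed.

Lemma measurable_shift_env z : measurable_fun setT (shift_env z : envT -> envT).
Proof. by apply: measurable_env => y; exact: measurable_coord. Qed.

(** Unfolding the first step writes L(x,y) by means of 0, sums, minima and edge weights, so a class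
    of functions closed under these operations contains it. Weights sit at the heads of edges, hence
    the site [x] itself never occurs; this is what later makes consecutive boxes disjoint. *)
Lemma pt_ind (T : Type) (W : T -> Z2 -> R * R) (K : (T -> R) -> Prop) x y :
  K (fun=> 0) -> (forall f g, K f -> K g -> K (fun t => f t + g t)) ->
  (forall f g, K f -> K g -> K (fun t => Num.min (f t) (g t))) ->
  (forall z b, le2 x z -> le2 z y -> z <> x -> K (fun t => edge (W t) z b)) ->
  K (fun t => passage_time (W t) x y).
Proof.
move=> K0 KD Km; have [n] := ubnP (absz (y.1 - x.1 + (y.2 - x.2))).
elim: n x => // n IH x xyn Ke.
have [xy|nxy] := boolP (le2 x y); last first.
  by under eq_fun do rewrite pt_not_le2//; exact: K0.
have [<-|nexy] := pselect (x = y).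
  by under eq_fun do rewrite pt_xx; exact: K0.
have Kb b : le2 (x + step b) y ->
    K (fun t => edge (W t) (x + step b) b + passage_time (W t) (x + step b) y).
  move=> xby; apply: KD.
    apply: Ke => //; first by case: (b); rewrite /le2 /=; lia.
    by case: (b); case: (x) => a c [] /=; lia.
  apply: IH => [|z c h1 h2 h3].
    by move: xby xyn xy; case: (b); rewrite /le2 /=; lia.
  apply: Ke => //; first exact: le2_step h1.
  by move=> zx; move: h1; rewrite zx; case: (b); rewrite /le2 /=; lia.
have [x1|x1] := boolP (le2 (x + e1) y); have [x2|x2] := boolP (le2 (x + e2) y).
- have -> : (fun t => passage_time (W t) x y) = (fun t => Num.min
      (edge (W t) (x + step true) true + passage_time (W t) (x + step true) y)
      (edge (W t) (x + step false) false + passage_time (W t) (x + step false) y)).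
    by apply/funext => t; rewrite (pt_start_min _ x1 x2).
  by apply: Km; exact: Kb.
- have -> : (fun t => passage_time (W t) x y) = (fun t =>
      (edge (W t) (x + step true) true + passage_time (W t) (x + step true) y)).
    by apply/funext => t; have [[] [h ->]] := pt_step_ex (W t) xy nexy; rewrite ?(negPf x2) in h *.
  exact: Kb.
- have -> : (fun t => passage_time (W t) x y) = (fun t =>
      (edge (W t) (x + step false) false + passage_time (W t) (x + step false) y)).
    by apply/funext => t; have [[] [h ->]] := pt_step_ex (W t) xy nexy; rewrite ?(negPf x1) in h *.
  exact: Kb.
- exfalso; move: xy x1 x2 nexy; case: x y {IH Ke Kb xyn} => [a b] [c e].
  rewrite /le2 /= => h1 h2 h3 h4; apply: h4.
  by congr pair; lia.
Qed.

Lemma measurable_edge d (T : measurableType d) (W : T -> Z2 -> R * R) z b :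
  measurable_fun setT (fun t => W t z) -> measurable_fun setT (fun t => edge (W t) z b).
Proof. by case: b => /= mW; apply: measurableT_comp mW. Qed.

Lemma measurable_pt d (T : measurableType d) (W : T -> Z2 -> R * R) x y :
  (forall z, le2 x z -> le2 z y -> z <> x -> measurable_fun setT (fun t => W t z)) ->
  measurable_fun setT (fun t => passage_time (W t) x y).
Proof.
move=> mW; apply: (pt_ind (K := fun f => measurable_fun setT f)).
- exact: measurable_cst.
- by move=> f g mf mg; exact: measurable_funD.
- by move=> f g mf mg; exact: measurable_minr.
- by move=> z b h1 h2 h3; apply: measurable_edge; exact: mW.
Qed.

Lemma measurable_pt_env x y :
  measurable_fun setT (fun w : envT => passage_time w x y).
Proof. by apply: measurable_pt => z _ _ _; exact: measurable_coord. Qed.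

Lemma cyl_env_measurable S (A : set envT) : <<s cyl_env S >> A -> measurable A.
Proof.
apply: smallest_sub; first exact: smallest_sigma_algebra.
by move=> _ [z [B [_ mB ->]]]; apply: sub_sigma_algebra; exists z, B.
Qed.

End env_space.

(** * Stationarity and independence of the law of the environment *)

Section law_of_env.
Context {R : realType} {d : measure_display} {T : measurableType d}.
Variables (P : probability T R) (W : Z2 -> T -> R * R).
Hypothesis iid : iid_field P W.

Let eW : T -> @envT R := env W.

Lemma measurable_env_W : measurable_fun setT eW.
Proof. by case: iid => mW _ _; apply: measurable_env => z; exact: mW. Qed.

HB.instance Definition _ := isMeasurableFun.Build _ _ _ _ eW measurable_env_W.

Definition env_law : probability (@envT R) R := distribution P eW.

Lemma env_lawE A : env_law A = P (env W @^-1` A). Proof. by []. Qed.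

Let PW z B := P (W z @^-1` B).

Lemma rect_prob (s : seq Z2) (B : Z2 -> set (R * R)) : (forall z, measurable (B z)) ->
  P (env W @^-1` [set w | forall z, z \in s -> B z (w z)]) =
  (\prod_(z <- undup s) PW z (B z))%E.
Proof.
case: iid => _ _ ind mB; rewrite -ind ?undup_uniq//; congr (P _).
apply/seteqP; split=> om /= h z; have := h z; rewrite /= mem_undup; exact.
Qed.

Lemma env_law_shift z (A : set (@envT R)) : measurable A -> env_law (shift_env z @^-1` A) = env_law A.
Proof.
move=> mA; have [mW idW ind] := iid.
pose sW : T -> @envT R := fun t => shift_env z (eW t).
have mS : measurable_fun setT sW by apply: measurable_env => y; exact: mW.
pose mixS := isMeasurableFun.Build _ _ _ _ _ mS.
pose S' : {mfun T >-> @envT R} := MeasurableFun.Pack (MeasurableFun.Class mixS).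
have := @measure_unique _ _ (@envT R) (rect_env setT) (fun=> setT) _ _ _ _
  (distribution P S') env_law _ _ A mA.
apply.
- by rewrite -sigma_rect_env.
- exact: rect_env_setI.
- by move=> _; exact: rect_env_setT.
- by rewrite bigcup_const//; exists 0%N.
- move=> _ [s [B [_ mB ->]]].
  rewrite [LHS](_ : _ = P (env W @^-1` [set w | forall y, y \in map (+%R^~ z) s ->
      B (y - z) (w y)])); last first.
    congr (P _); apply/seteqP; split=> om /= h y.
      by move=> /mapP[y' y's ->]; rewrite addrK; exact: h.
    by move=> ys; have := h (y + z); rewrite addrK; apply; apply: map_f.
  rewrite (@rect_prob (map (+%R^~ z) s) (fun y => B (y - z)))//.
  rewrite [RHS](@rect_prob s B)//.
  rewrite undup_map_inj; last exact: addIr.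
  rewrite big_map; apply: eq_bigr => y _; rewrite addrK.
  by rewrite /PW idW// [RHS]idW.
- by move=> _; rewrite ltey_eq fin_num_measure.
Qed.

(** As functions of [A], both sides are finite measures: the restriction of [P] to [C] and a
    multiple of [P]. They agree on a generating class stable under intersection. *)
Lemma indep_sigma (G : set (set T)) C : setI_closed G -> G setT ->
  G `<=` measurable -> measurable C ->
  (forall A, G A -> P (A `&` C) = (P C * P A)%E) ->
  forall A, <<s G >> A -> P (A `&` C) = (P C * P A)%E.
Proof.
move=> GI GT Gm mC GC A sA.
have := @g_sigma_algebra_measure_unique _ R T G (Gm) (fun=> setT) _ _
  (mrestr P mC) (mscale (NngNum (pr_ge0 P C)) P) GI _ _ A sA.
have sE B : mscale (NngNum (pr_ge0 P C)) P B = (P C * P B)%E by rewrite (prE P mC).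
move=> U; have : mrestr P mC A = mscale (NngNum (pr_ge0 P C)) P A.
  apply: U => //.
  - by rewrite bigcup_const//; exists 0%N.
  - by move=> B GB; exact: (etrans (GC B GB) (esym (sE B))).
  - move=> _; have h : (P (setT `&` C) < +oo)%E.
      by rewrite ltey_eq fin_num_measure//; exact: measurableI.
    exact: h.
by move=> e; exact: (etrans e (sE A)).
Qed.

(** The product formula gives independence of rectangles; [indep_sigma] then extends it one argument
    at a time. *)
Lemma env_law_indep (S S' : set Z2) A A' : S `&` S' = set0 ->
  <<s cyl_env S >> A -> <<s cyl_env S' >> A' ->
  env_law (A `&` A') = (env_law A * env_law A')%E.
Proof.
move=> SS'; rewrite !sigma_rect_env => sA sA'; have [mW _ _] := iid.
pose pre (S0 : set Z2) : set (set T) := [set env W @^-1` B | B in rect_env S0].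
have pre_m S0 : pre S0 `<=` measurable.
  move=> _ [_ [s [B [_ mB ->]]] <-]; rewrite -[X in measurable X]setTI.
  apply: measurable_env_W => //; apply: (@cyl_env_measurable R setT).
  by rewrite sigma_rect_env; apply: sub_sigma_algebra; exists s, B; split.
have pre_I S0 : setI_closed (pre S0).
  move=> _ _ [B rB <-] [B' rB' <-]; exists (B `&` B') => //.
  exact: rect_env_setI.
have pre_T S0 : pre S0 setT by exists setT => //; exact: rect_env_setT.
have sig S0 B : <<s rect_env S0 >> B -> <<s pre S0 >> (env W @^-1` B).
  have : <<s rect_env S0 >> `<=` [set B | <<s pre S0 >> (env W @^-1` B)].
    apply: smallest_sub.
      split.
      - exact: (@measurable0 _ (g_sigma_algebraType (pre S0))).
      - move=> C /= hC; rewrite setTD.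
        exact: (@measurableC _ (g_sigma_algebraType (pre S0))).
      - move=> F /= hF; rewrite preimage_bigcup.
        exact: (@bigcupT_measurable _ (g_sigma_algebraType (pre S0))).
    by move=> C rC; apply: sub_sigma_algebra; exists C.
  exact.
have mpre S0 B : <<s pre S0 >> B -> measurable B.
  apply: smallest_sub (B); last exact: pre_m.
  exact: sigma_algebra_measurable.
have rr A1 A2 : pre S A1 -> pre S' A2 -> P (A1 `&` A2) = (P A2 * P A1)%E.
  move=> [_ [s [B [sS mB ->]]] <-] [_ [s' [B' [sS' mB' ->]]] <-].
  rewrite !rect_prob// muleC.
  have ns z : z \in s -> z \notin s'.
    move=> zs; apply/negP => zs'.
    have : (S `&` S') z by split; [exact: sS|exact: sS'].
    by rewrite SS'.
  rewrite [X in P X](_ : _ = env W @^-1` [set w | forall z, z \in s ++ s' ->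
     (if z \in s then B z else B' z) (w z)]); last first.
    apply/seteqP; split=> om /=.
      move=> [h h'] z; rewrite mem_cat; case: ifP => /= [zs _|_ zs'];
        [exact: h|exact: h'].
    move=> h; split=> z zs.
      by have := h z; rewrite mem_cat zs; exact.
    have := h z; rewrite mem_cat zs orbT; case: ifP => [/ns|_]; last exact.
    by rewrite zs.
  rewrite (@rect_prob (s ++ s') (fun z => if z \in s then B z else B' z)); last first.
    by move=> z; case: ifP.
  rewrite undup_cat big_cat /=.
  have -> : [seq x <- undup s | x \notin s'] = undup s.
    by apply/all_filterP/allP => z; rewrite mem_undup; exact: ns.
  congr (_ * _)%E; rewrite !big_seq; apply: eq_bigr => z; rewrite mem_undup.
    by move=> ->.
  by case: ifP => [/ns/negPf ->|].
rewrite !env_lawE preimage_setI muleC.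
apply: (indep_sigma (G := pre S)) => //.
- exact: (mpre S' _ (sig S' A' sA')).
- move=> C preC; rewrite setIC muleC.
  apply: (indep_sigma (G := pre S')) => //; first exact: pre_m preC.
  + by move=> C' preC'; rewrite setIC rr// muleC.
  + exact: sig.
- exact: sig.
Qed.

End law_of_env.

(** * Sums over disjoint translates *)

Section site_law.
Context {R : realType}.
Local Notation E := (@envT R).

(** What the argument uses of the i.i.d. assumption, phrased for a law on environments so that it
    can be checked again for the reflected law. *)
Definition site_law (Q : probability E R) :=
  (forall z (A : set E), measurable A -> Q (shift_env z @^-1` A) = Q A) /\
  (forall S S' A A', S `&` S' = set0 -> <<s cyl_env S >> A ->
     <<s cyl_env S' >> A' -> Q (A `&` A') = (Q A * Q A')%E).

Variable Q : probability E R.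
Hypothesis QL : site_law Q.

Definition dep (S : set Z2) (f : E -> R) :=
  forall B, measurable B -> <<s cyl_env S >> (f @^-1` B).

Lemma dep_pt x y : dep [set z | le2 x z /\ le2 z y /\ z <> x]
  (fun w => passage_time w x y).
Proof.
set S := [set z | _] => B mB.
have := @measurable_pt R _ (g_sigma_algebraType (cyl_env S)) (fun w => w) x y.
move=> /(_ _ measurableT B mB); rewrite setTI; apply.
by move=> z h1 h2 h3; apply: measurable_coord.
Qed.

Lemma dep_shift S f z : dep S f -> dep [set y | S (y - z)] (f \o shift_env z).
Proof.
move=> df B mB.
have : <<s cyl_env S >> `<=`
    [set A | <<s @cyl_env R [set y | S (y - z)] >> (shift_env z @^-1` A)].
  apply: smallest_sub.
    split.
    - exact: (@measurable0 _ (g_sigma_algebraType (cyl_env [set y | S (y - z)]))).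
    - move=> C /= hC; rewrite setTD.
      exact: (@measurableC _ (g_sigma_algebraType (cyl_env [set y | S (y - z)]))).
    - move=> F /= hF; rewrite preimage_bigcup.
      exact: (@bigcupT_measurable _ (g_sigma_algebraType (cyl_env [set y | S (y - z)]))).
  move=> _ [y [C [Sy mC ->]]]; apply: sub_sigma_algebra.
  by exists (y + z), C; split=> //=; rewrite addrK.
by move=> /(_ _ (df B mB)).
Qed.

Lemma Ex_shift z f : intg Q f -> Ex Q (f \o shift_env z) = Ex Q f.
Proof.
by apply: Ex_preserving; [exact: measurable_shift_env|exact: QL.1].
Qed.

Lemma intg_shift z f : intg Q f -> intg Q (f \o shift_env z).
Proof.
move=> hf.
exact: ((intg_preserving (@measurable_shift_env R z) (QL.1 z) (intg_meas hf)).1 hf).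
Qed.

Lemma sqint_shift z f : sqint Q f -> sqint Q (f \o shift_env z).
Proof.
by apply: sqint_preserving; [exact: measurable_shift_env|exact: QL.1].
Qed.

Lemma pr_shift z (A : set E) : measurable A -> pr Q (shift_env z @^-1` A) = pr Q A.
Proof. by move=> mA; rewrite /pr QL.1. Qed.

Lemma Ex_dep_mul S S' f g : S `&` S' = set0 -> dep S f -> dep S' g ->
  sqint Q f -> sqint Q g -> Ex Q (fun w => f w * g w) = Ex Q f * Ex Q g.
Proof.
move=> SS' df dg hf hg; apply: Ex_indep_mul.
- by case: hf.
- by case: hg.
- exact: sqint_intg.
- exact: sqint_intg.
- by move=> A B mA mB; apply: (QL.2 S S') => //; [exact: df|exact: dg].
- exact: sqint_mul.
Qed.

Lemma dep_addr S f (c : R) : dep S f -> dep S (fun w => f w + c).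
Proof.
move=> df B mB; apply: (df ((fun x => x + c) @^-1` B)).
rewrite -[X in measurable X]setTI.
have : measurable_fun setT (fun x : R => x + c).
  by apply: measurable_funD; [exact: measurable_id|exact: measurable_cst].
by move=> /(_ measurableT B mB).
Qed.

(** Translates with disjoint sets of sites are uncorrelated after centring, so the variance of the
    sum is at most r times the second moment of [f], and Chebyshev's inequality applies. *)
Lemma chebyshev_translates S f (zs : nat -> Z2) (r : nat) (eta : R) :
  dep S f -> sqint Q f -> 0 < eta -> (0 < r)%N ->
  (forall i j, (i < j < r)%N ->
     [set y | S (y - zs i)] `&` [set y | S (y - zs j)] = set0) ->
  pr Q [set w | r%:R * (Ex Q f + eta) <= \sum_(j < r) f (shift_env (zs j) w)] <=
    Ex Q (fun w => f w ^+ 2) / (r%:R * eta ^+ 2).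
Proof.
move=> df hf eta0 r0 disj; pose mu := Ex Q f.
pose X j (w : E) : R := f (shift_env (zs j) w) + - mu.
have hX j : sqint Q (X j).
  by apply: sqintD; [exact: (sqint_shift (zs j) hf)|exact: sqint_cst].
have dX j : dep [set y | S (y - zs j)] (X j).
  by apply: dep_addr; exact: dep_shift.
have EX j : Ex Q (X j) = 0.
  rewrite ExD; last exact: intg_cst.
    by rewrite (Ex_shift (zs j) (sqint_intg hf)) Ex_cst subrr.
  exact: (intg_shift (zs j) (sqint_intg hf)).
set V := Ex Q (fun w => f w ^+ 2).
have EX2 j : Ex Q (fun w => X j w ^+ 2) <= V.
  have h0 : Ex Q ((fun w => (f w + - mu) ^+ 2) \o shift_env (zs j)) <= V.
    rewrite Ex_shift; last by case: (sqintD hf (sqint_cst Q (- mu))).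
    have -> : (fun w : E => (f w + - mu) ^+ 2) =
        (fun w => f w ^+ 2 + ((- 2 * mu) * f w + mu ^+ 2)).
      by apply/funext => w; ring.
    have i1 : intg Q f by exact: sqint_intg.
    have i2 : intg Q (fun w => f w ^+ 2) by case: hf.
    rewrite ExD//; last by apply: intgD; [exact: intgZ|exact: intg_cst].
    rewrite ExD//; [|exact: intgZ|exact: intg_cst].
    rewrite ExZ// Ex_cst -/V -/mu.
    by have := sqr_ge0 mu; nra.
  exact: h0.
have hS n : (n <= r)%N -> sqint Q (fun w => \sum_(j < n) X j w).
  by move=> _; exact: sqint_sum.
have ES n : (n <= r)%N -> Ex Q (fun w => (\sum_(j < n) X j w) ^+ 2) <= n%:R * V.
  elim: n => [|n IH] nr.
    rewrite (_ : (fun w => _) = (fun=> 0)); first by rewrite Ex_cst mul0r.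
    by apply/funext => w; rewrite big_ord0 expr0n.
  have nr' : (n <= r)%N by lia.
  have -> : (fun w => (\sum_(j < n.+1) X j w) ^+ 2) = (fun w =>
     (\sum_(j < n) X j w) ^+ 2 + (2 * (\sum_(j < n) X j w * X n w) + X n w ^+ 2)).
    apply/funext => w; rewrite big_ord_recr /= -mulr_suml; ring.
  have iXX j : intg Q (fun w => X j w * X n w) by exact: sqint_mul.
  have iS : intg Q (fun w => \sum_(j < n) X j w * X n w).
    exact: (@intg_sum R _ E Q n (fun j w => X j w * X n w) (fun j _ => iXX j)).
  rewrite ExD; [|by case: (hS _ nr')|]; last first.
    by apply: intgD; [exact: intgZ|case: (hX n)].
  rewrite ExD; [|exact: intgZ|by case: (hX n)].
  rewrite ExZ// (@Ex_sum R _ E Q n (fun j w => X j w * X n w))//.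
  rewrite big1 ?mulr0 ?add0r.
    by rewrite -natr1 mulrDl mul1r lerD// IH.
  move=> j _; rewrite (@Ex_dep_mul [set y | S (y - zs j)] [set y | S (y - zs n)])//.
    by rewrite EX mul0r.
  by apply: disj; have := ltn_ord j; lia.
have rp : 0 < r%:R :> R by rewrite ltr0n.
set A := [set w | _].
have mf : measurable_fun setT (fun w : E => \sum_(j < r) f (shift_env (zs j) w)).
  apply: (@intg_meas _ _ _ Q); apply: (@intg_sum R _ E Q r (fun j (w : E) => f (shift_env (zs j) w))).
  by move=> j _; exact: (intg_shift (zs j) (sqint_intg hf)).
have mA : measurable (A : set E).
  rewrite -[A]setTI; apply: (mf measurableT [set x | r%:R * (mu + eta) <= x]).
  rewrite (_ : [set x | _] = `[r%:R * (mu + eta), +oo[%classic) //.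
  by apply/seteqP; split=> x /=; rewrite in_itv /= ?andbT.
apply: le_trans (@markov_pr _ _ _ Q (fun w => (\sum_(j < r) X j w) ^+ 2) A
   ((r%:R * eta) ^+ 2) _ mA _ _ _) _.
- by rewrite exprn_gt0// mulr_gt0.
- by case: (hS r (leqnn r)).
- by move=> w; exact: sqr_ge0.
- move=> w; rewrite /A /= /X big_split /= sumr_const card_ord -[(- mu) *+ r]mulr_natl -/mu mulrDr.
  set y := \sum_(i < r) _; rewrite mulrN => h.
  have re0 : 0 <= r%:R * eta by rewrite mulr_ge0// ltW.
  have h' : r%:R * eta <= y - r%:R * mu by lra.
  by rewrite lerXn2r ?nnegrE// (le_trans re0).
- rewrite ler_pdivrMr ?exprn_gt0 ?mulr_gt0// (le_trans (ES r (leqnn r)))//.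
  rewrite -/V [X in _ <= X](_ : _ = r%:R * V)//.
  by field; rewrite !lt0r_neq0.
Qed.

End site_law.

(** * The time constant on integer vectors *)

Definition vec (m n : nat) : Z2 := (m%:Z, n%:Z).

Lemma vecD m n m' n' : vec (m + m') (n + n') = vec m n + vec m' n'.
Proof. by rewrite /vec; congr pair; rewrite /= PoszD. Qed.

Lemma le2_vec m n m' n' : le2 (vec m n) (vec m' n') = (m <= m')%N && (n <= n')%N.
Proof. by []. Qed.

Section time_constant.
Context {R : realType}.
Local Notation E := (@envT R).

Definition tc_dev (ell : R * R -> R) (m n : nat) (eps : R) (r : nat) : set E :=
  [set w | eps * r%:R < `|passage_time w 0 (vec (r * m) (r * n)) - r%:R * ell (m%:R, n%:R)|].

(** A deviation at some scale beyond [r0]. Smallness of its probability is the quantitative form of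
    almost sure convergence and controls all large scales at once. *)
Definition tc_tail ell m n eps r0 : set E :=
  \bigcup_(r in [set r | (r0 <= r)%N]) tc_dev ell m n eps r.

(* The hypotheses of the theorem, transported to the law Q of the environment. *)
Record percolation (Q : probability E R) (ell : R * R -> R) : Prop := Percolation {
  perc_site : site_law Q ;
  perc_sqint : forall b, sqint Q (fun w => edge w 0 b) ;
  perc_tail : forall m n eps del, 0 < eps -> 0 < del ->
    exists r0, pr Q (tc_tail ell m n eps r0) <= del ;
  perc_hom : forall (k : nat) (s t : R), (0 < k)%N -> 0 <= s -> 0 <= t ->
    ell (k%:R * s, k%:R * t) = k%:R * ell (s, t) ;
  perc_diff : forall xi : R * R, 0 < xi.1 -> 0 < xi.2 -> differentiable ell xi ;
  perc_conv : forall xi zeta : R * R, inU xi -> inU zeta -> xi <> zeta ->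
    forall t : R, 0 < t < 1 ->
    ell (t *: xi + (1 - t) *: zeta) < t * ell xi + (1 - t) * ell zeta }.

Variables (Q : probability E R) (ell : R * R -> R).
Hypothesis H : percolation Q ell.
Let QL := perc_site H.

Definition lam (m n : nat) : R := ell (m%:R, n%:R).

Lemma lam_hom k m n : (0 < k)%N -> lam (k * m) (k * n) = k%:R * lam m n.
Proof. by move=> k0; rewrite /lam !natrM (perc_hom H). Qed.

Lemma measurable_tc_tail m n eps r0 : measurable (tc_tail ell m n eps r0).
Proof.
apply: bigcup_measurable => r _.
have mf : measurable_fun setT (fun w : E =>
    `|passage_time w 0 (vec (r * m) (r * n)) - r%:R * ell (m%:R, n%:R)|).
  apply: measurableT_comp => //; apply: measurable_funB => //.
  exact: measurable_pt_env.
rewrite -[tc_dev _ _ _ _ _]setTI.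
apply: (mf measurableT [set x | eps * r%:R < x]).
rewrite (_ : [set x | _] = `]eps * r%:R, +oo[%classic) //.
by apply/seteqP; split=> x /=; rewrite in_itv /= ?andbT.
Qed.

Lemma sqint_edge z b : sqint Q (fun w => edge w z b).
Proof.
have := sqint_shift QL z (perc_sqint H b).
by rewrite /comp /shift_env /edge add0r.
Qed.

Lemma sqint_pt x y : sqint Q (fun w => passage_time w x y).
Proof.
apply: (@pt_ind R E (fun w => w) (fun f => sqint Q f)).
- exact: sqint_cst.
- by move=> f g; exact: sqintD.
- by move=> f g; exact: sqint_min.
- by move=> z b _ _ _; exact: sqint_edge.
Qed.

Lemma intg_pt x y : intg Q (fun w => passage_time w x y).
Proof. exact/sqint_intg/sqint_pt. Qed.

Definition ept (m n : nat) : R := Ex Q (fun w => passage_time w 0 (vec m n)).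

Lemma Ex_pt x m n : Ex Q (fun w => passage_time w x (x + vec m n)) = ept m n.
Proof.
rewrite /ept -(Ex_shift QL x (intg_pt 0 (vec m n))); congr (Ex Q _).
by apply/funext => w /=; rewrite pt_shift add0r addrC.
Qed.

Lemma pt_sum_le (w : E) m n r :
  passage_time w 0 (vec (r * m) (r * n)) <=
  \sum_(j < r) passage_time (shift_env (vec (j * m) (j * n)) w) 0 (vec m n).
Proof.
elim: r => [|r IH]; first by rewrite big_ord0 pt_xx.
rewrite big_ord_recr /= pt_shift add0r -vecD.
have -> : vec (m + r * m) (n + r * n) = vec (r.+1 * m) (r.+1 * n) by rewrite !mulSn.
apply: le_trans (lerD IH (lexx _)).
by apply: pt_tri; rewrite le2_vec; lia.
Qed.

(** A box without its base corner meets no later translate along its diagonal: two successive boxes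
    share only the corner that the later one omits. The offset [z] allows a chain of boxes to start
    anywhere. *)
Lemma box_disjoint m n (z : Z2) i j : (0 < m + n)%N -> (i < j)%N ->
  let S := [set y : Z2 | le2 0 y /\ le2 y (vec m n) /\ y <> 0] in
  [set y | S (y - (vec (i * m) (i * n) + z))] `&`
  [set y | S (y - (vec (j * m) (j * n) + z))] = set0.
Proof.
move=> mn ij S; apply/seteqP; split=> // -[a b] [[_ [h2 _]] [h3 [_ h4]]].
exfalso; apply: h4; move: h2 h3; case: z => [z1 z2].
have [k ->] : exists k, j = (i + k.+1)%N by exists (j - i).-1; lia.
rewrite /vec !mulnDl !mulSn /le2 /= => /andP[g1 g2] /andP[g3 g4].
have e0 : (0 : Z2) = (0%:Z, 0%:Z) by [].
by rewrite e0; congr pair; rewrite /=; lia.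
Qed.

(** Were the mean smaller by 2 eta, a chain of [r] boxes would keep L(0, r(m,n)) below r(lam - eta)
    except on a Chebyshev event. That event and the deviation event have probability at most 1/4
    each, yet together they would cover the space. *)
Lemma ept_ge m n : (0 < m + n)%N -> lam m n <= ept m n.
Proof.
move=> mn; rewrite leNgt; apply/negP => lt.
pose eta : R := (lam m n - ept m n) / 2.
have eta0 : 0 < eta by rewrite /eta; lra.
have q4 : 0 < 1 / 4 :> R by lra.
have [r0 hr0] := perc_tail H m n eta0 q4.
set f := fun w : E => passage_time w 0 (vec m n).
pose V := Ex Q (fun w => f w ^+ 2).
have V0 : 0 <= V by apply: Ex_ge0 => w; exact: sqr_ge0.
pose r := (r0 + (Num.truncn (4 * V / eta ^+ 2)).+1)%N.
have rp : 0 < r%:R :> R by rewrite ltr0n; lia.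
have hr : 4 * V / eta ^+ 2 < r%:R.
  apply: lt_le_trans (truncnS_gt _) _.
  by rewrite /r ler_nat leq_addl.
pose zs (j : nat) : Z2 := vec (j * m) (j * n) + 0.
pose S := [set y : Z2 | le2 0 y /\ le2 y (vec m n) /\ y <> 0].
have := @chebyshev_translates R Q QL S f zs r eta (@dep_pt R 0 (vec m n)) (sqint_pt 0 (vec m n)) eta0.
move=> /(_ ltac:(lia)) cheb.
have {}cheb := cheb (fun i j ij => box_disjoint 0 mn (proj1 (andP ij))).
set A := [set w | _] in cheb.
have mA : measurable (A : set E).
  have mf : measurable_fun setT (fun w : E => \sum_(j < r) f (shift_env (zs j) w)).
    apply: (@intg_meas _ _ _ Q).
    apply: (@intg_sum R _ E Q r (fun j (w : E) => f (shift_env (zs j) w))).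
    by move=> j _; exact: (intg_shift QL (zs j) (intg_pt _ _)).
  rewrite -[A]setTI; apply: (mf measurableT [set x | r%:R * (Ex Q f + eta) <= x]).
  rewrite (_ : [set x | _] = `[r%:R * (Ex Q f + eta), +oo[%classic) //.
  by apply/seteqP; split=> x /=; rewrite in_itv /= ?andbT.
have mT := measurable_tc_tail m n eta r0.
have cov : setT `<=` A `|` tc_tail ell m n eta r0.
  move=> w _; have [|] := lerP (r%:R * (Ex Q f + eta)) (\sum_(j < r) f (shift_env (zs j) w)).
    by left.
  move=> h; right; exists r => /=; first by lia.
  have := pt_sum_le w m n r.
  have -> : \sum_(j < r) passage_time (shift_env (vec (j * m) (j * n)) w) 0 (vec m n) =
     \sum_(j < r) f (shift_env (zs j) w).
    by apply: eq_bigr => j _; rewrite /zs addr0.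
  have e : Ex Q f + eta = lam m n - eta by rewrite /eta /ept -/f; field.
  rewrite e in h => h2; have := le_lt_trans h2 h.
  rewrite mulrBr => h3; rewrite /tc_dev /= -/(lam m n) distrC.
  by apply: lt_le_trans (ler_norm _); rewrite mulrC; lra.
have := pr_le Q measurableT (measurableU _ _ mA mT) cov.
have -> : pr Q setT = 1 by rewrite /pr probability_setT.
have := pr_setU Q mA mT.
have : pr Q A < 1 / 4 :> R.
  apply: le_lt_trans cheb _; rewrite -/V.
  rewrite ltr_pdivrMr; last by rewrite mulr_gt0// exprn_gt0.
  move: hr; rewrite ltr_pdivrMr; last by rewrite exprn_gt0.
  by nra.
by move: hr0; lra.
Qed.

(** The centred variable Y has nonnegative mean by [ept_ge], so an upper bound Y <= G with G >= 0 is
    enough, thanks to |Y| <= 2G - Y. On the rare deviation event Y is dominated by a sum over boxes,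
    and x <= t x^2 + 1/t takes the place of uniform integrability. *)
Lemma ept_L1 m n (eps : R) : (0 < m + n)%N -> 0 < eps -> exists M0, forall M, (M0 <= M)%N ->
  Ex Q (fun w => `|passage_time w 0 (vec (M * m) (M * n)) - M%:R * lam m n|) <= eps * M%:R.
Proof.
move=> mn eps0; set f := fun w : E => passage_time w 0 (vec m n) + - lam m n.
have hf : sqint Q f by apply: sqintD; [exact: sqint_pt|exact: sqint_cst].
pose V := Ex Q (fun w => f w ^+ 2).
have V0 : 0 <= V by apply: Ex_ge0 => w; exact: sqr_ge0.
(* Balances the two terms of [F]: the quadratic one has mean at most eps/8, and so has the indicator
   one once the tail event has probability at most eps t / 8. With the constant eps/8 in [G], the
   mean of 2G is at most 3/4 of eps M. *)
pose t := eps / (8 * (V + 1)).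
have t0 : 0 < t by rewrite divr_gt0//; lra.
have d0 : 0 < eps / 8 by lra.
have et0 : 0 < eps * t / 8 by rewrite divr_gt0// mulr_gt0.
have [M0 hM0] := perc_tail H m n d0 et0.
exists M0.+1 => M MM0; have Mp : (0 < M)%N by lia.
have MpR : 0 < M%:R :> R by rewrite ltr0n.
set A := tc_tail ell m n (eps / 8) M0 in hM0.
have mA : measurable A by exact: measurable_tc_tail.
set Y := fun w : E => passage_time w 0 (vec (M * m) (M * n)) - M%:R * lam m n.
have iY : intg Q Y by apply: intgB; [exact: intg_pt|exact: intg_cst].
have EY : 0 <= Ex Q Y.
  rewrite ExB ?Ex_cst; [|exact: intg_pt|exact: intg_cst].
  by rewrite -lam_hom// subr_ge0 ept_ge// -mulnDr muln_gt0 Mp.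
pose F j (w : E) : R := t * (f (shift_env (vec (j * m) (j * n)) w)) ^+ 2 + t^-1 * \1_A w.
have iF j : intg Q (F j).
  apply: intgD; last by apply: intgZ; exact: intg_indic.
  by apply: intgZ; case: (sqint_shift QL (vec (j * m) (j * n)) hf).
have EF j : Ex Q (F j) = t * V + t^-1 * pr Q A.
  have i1 : intg Q (fun w => f (shift_env (vec (j * m) (j * n)) w) ^+ 2).
    by case: (sqint_shift QL (vec (j * m) (j * n)) hf).
  rewrite ExD; [|exact: intgZ|by apply: intgZ; exact: intg_indic].
  rewrite ExZ// ExZ ?Ex_indic//; last exact: intg_indic.
  congr (t * _ + _).
  exact: (Ex_shift QL (vec (j * m) (j * n)) (proj2 hf)).
pose G w := eps / 8 * M%:R + \sum_(j < M) F j w.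
have iG : intg Q G.
  by apply: intgD; [exact: intg_cst|exact: (@intg_sum R _ E Q M F)].
have YG w : `|Y w| <= 2 * G w - Y w.
  suff : Y w <= G w.
    have : 0 <= G w.
      have e8 : 0 <= eps / 8 * M%:R by rewrite mulr_ge0// ltW.
      rewrite /G addr_ge0//.
      apply: sumr_ge0 => j _; rewrite addr_ge0// mulr_ge0 ?sqr_ge0// ltW//.
      by rewrite invr_gt0.
    move: (G w) (Y w) => g y g0 yg.
    by have [y0|y0] := lerP 0 y; [rewrite ger0_norm//|rewrite ltr0_norm//]; lra.
  have [h|h] := lerP (Y w) (eps / 8 * M%:R).
    apply: le_trans h _; rewrite /G lerDl.
    apply: sumr_ge0 => j _; rewrite addr_ge0// mulr_ge0 ?sqr_ge0// ltW//.
    by rewrite invr_gt0.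
  have Aw : A w.
    exists M => /=; first by lia.
    by rewrite /tc_dev /= -/(lam m n); apply: lt_le_trans h (ler_norm _).
  have : Y w <= \sum_(j < M) f (shift_env (vec (j * m) (j * n)) w).
    rewrite /Y /f big_split /= sumr_const card_ord -[(- _) *+ M]mulr_natl mulrN lerD2r.
    exact: pt_sum_le.
  move=> /le_trans; apply; rewrite /G.
  apply: le_trans (_ : \sum_(j < M) F j w <= _); last first.
    by rewrite lerDr mulr_ge0// ltW.
  apply: ler_sum => j _; rewrite /F indicE mem_set//= mulr1.
  set x := f _; have := sqr_ge0 (t * x - 1).
  have tt : t * t^-1 = 1 by rewrite mulfV// lt0r_neq0.
  have ti : 0 < t^-1 by rewrite invr_gt0.
  have -> : t * x ^+ 2 = t^-1 * (t * x) ^+ 2 by rewrite exprMn; field; rewrite lt0r_neq0.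
  have -> : x = t^-1 * (t * x) by rewrite mulrA mulVf ?mul1r// lt0r_neq0.
  by nra.
apply: le_trans (Ex_le (intg_norm iY) (intgB (intgZ 2 iG) iY) YG) _.
rewrite ExB//; last exact: intgZ.
rewrite ExZ// /G ExD; [|exact: intg_cst|exact: (@intg_sum R _ E Q M F)].
rewrite Ex_cst (@Ex_sum R _ E Q M F)//.
under eq_bigr do rewrite EF.
rewrite sumr_const card_ord -[(_ + _) *+ M]mulr_natl.
have b1 : t * V <= eps / 8.
  rewrite /t mulrAC ler_pdivrMr; last by lra.
  by nra.
have b2 : t^-1 * pr Q A <= eps / 8.
  by rewrite mulrC ler_pdivrMr//; lra.
by nra.
Qed.

Lemma ept_le m n (eps : R) : (0 < m + n)%N -> 0 < eps -> exists M0, forall M, (M0 <= M)%N ->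
  ept (M * m) (M * n) <= M%:R * (lam m n + eps).
Proof.
move=> mn eps0; have [M0 hM0] := ept_L1 mn eps0; exists M0 => M /hM0 h.
have i1 : intg Q (fun w => passage_time w 0 (vec (M * m) (M * n)) - M%:R * lam m n).
  by apply: intgB; [exact: intg_pt|exact: intg_cst].
have := Ex_le i1 (intg_norm i1) (fun w => ler_norm _).
rewrite ExB ?Ex_cst; [|exact: intg_pt|exact: intg_cst].
by rewrite -/(ept _ _); move: h; rewrite mulrDr mulrC; lra.
Qed.

(** Subadditivity holds for the means by stationarity and the triangle inequality; [ept_ge] on the
    left and [ept_le] on the right transfer it to the time constant after scaling by a large M. *)
Lemma lam_subadd m n m' n' : (0 < m + n)%N -> (0 < m' + n')%N ->
  lam (m + m') (n + n') <= lam m n + lam m' n'.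
Proof.
move=> mn mn'; apply/ler_addgt0Pr => eps eps0.
have e2 : 0 < eps / 2 by lra.
have [M0 h0] := ept_le mn e2; have [M1 h1] := ept_le mn' e2.
pose M := (maxn M0 M1).+1.
have Mp : 0 < M%:R :> R by rewrite ltr0n.
have {}h0 := h0 M ltac:(lia); have {}h1 := h1 M ltac:(lia).
have : ept (M * (m + m')) (M * (n + n')) <= ept (M * m) (M * n) + ept (M * m') (M * n').
  rewrite -(Ex_pt (vec (M * m) (M * n)) (M * m') (M * n')) -ExD; last 2 first.
    exact: intg_pt.
    exact: intg_pt.
  apply: Ex_le; first exact: intg_pt.
    by apply: intgD; exact: intg_pt.
  move=> w; rewrite -vecD -!mulnDr; apply: pt_tri; rewrite le2_vec; nia.
have : lam (M * (m + m')) (M * (n + n')) <= ept (M * (m + m')) (M * (n + n')).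
  by apply: ept_ge; nia.
by rewrite lam_hom//; move: h0 h1; nra.
Qed.

Section gradient.
Variables a b : nat.
Hypotheses (a0 : (0 < a)%N) (b0 : (0 < b)%N).

Definition grad1 : R := 'D_(1, 0) ell (a%:R, b%:R).
Definition grad2 : R := 'D_(0, 1) ell (a%:R, b%:R).

Lemma directional (xi : R * R) (v1 v2 : R) (eps : R) : 0 < xi.1 -> 0 < xi.2 -> 0 < eps ->
  exists2 del : R, 0 < del & forall h, 0 < `|h| < del ->
   `|h^-1 * (ell (xi.1 + h * v1, xi.2 + h * v2) - ell xi) -
     (v1 * 'D_(1, 0) ell xi + v2 * 'D_(0, 1) ell xi)| <= eps.
Proof.
move=> x1 x2 eps0; have df := perc_diff H x1 x2.
have -> : v1 * 'D_(1, 0) ell xi + v2 * 'D_(0, 1) ell xi = 'D_(v1, v2) ell xi.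
  rewrite !deriveE// -![_ * _]/(_ *: _) -!linearZ -linearD.
  congr ('d ell xi _); apply: injective_projections;
    by rewrite /= /GRing.scale /= ?mulr0 ?mulr1 ?addr0 ?add0r.
have /= := diff_derivable (v := (v1, v2)) df.
rewrite /derivable => cv.
move/cvgrPdist_le : cv => /(_ eps eps0).
rewrite /derive; set l := lim _.
move=> [del /= del0 hdel].
exists del => // h /andP[h0 hd].
have := hdel h; rewrite /ball_ /= sub0r normrN => /(_ hd) /(_ _).
rewrite -normr_gt0 => /(_ h0).
rewrite distrC; congr (_ <= _); congr `|_ - _|.
rewrite [LHS]/(_ * _); congr (_ * (ell _ - _)).
by rewrite /= addrC; apply: injective_projections.
Qed.

(** By homogeneity the first two terms form a difference quotient of [ell] at (a,b) with step 1/C in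
    the direction (m,n). *)
Lemma lam_grad m n (eps : R) : 0 < eps -> exists C0, forall C, (C0 <= C)%N ->
  `|lam (C * a + m) (C * b + n) - C%:R * lam a b - (m%:R * grad1 + n%:R * grad2)| <= eps.
Proof.
move=> eps0; have aR : 0 < a%:R :> R by rewrite ltr0n.
have bR : 0 < b%:R :> R by rewrite ltr0n.
have [del del0 hdel] := @directional (a%:R, b%:R) m%:R n%:R eps aR bR eps0.
exists (Num.truncn del^-1).+1 => C hC; have C0 : (0 < C)%N by lia.
have CR : 0 < C%:R :> R by rewrite ltr0n.
have := hdel C%:R^-1; rewrite gtr0_norm ?invr_gt0// CR /=.
have -> : C%:R^-1 < del.
  rewrite invf_plt ?posrE//; apply: lt_le_trans (truncnS_gt _) _.
  by rewrite ler_nat.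
move=> /(_ isT); rewrite invrK mulrBr -(perc_hom H) ?addr_ge0 ?mulr_ge0 ?invr_ge0//.
have e k l : C%:R * (k%:R + C%:R^-1 * l%:R) = (C * k + l)%:R :> R.
  by rewrite natrD natrM; field; rewrite lt0r_neq0.
by rewrite /= !e.
Qed.

(** The tangent plane along the ray supports [ell]: subadditivity bounds the difference quotients of
    [lam_grad] by lam m n. *)
Lemma lam_ge_grad m n : (0 < m + n)%N -> m%:R * grad1 + n%:R * grad2 <= lam m n.
Proof.
move=> mn; apply/ler_addgt0Pr => eps eps0.
have [C0 /(_ C0.+1 (leqnSn _))] := lam_grad m n eps0.
rewrite ler_norml => /andP[h _].
have := @lam_subadd (C0.+1 * a) (C0.+1 * b) m n ltac:(nia) mn.
by rewrite [X in _ <= X + _ -> _]lam_hom//; lra.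
Qed.

Lemma lam_grad_eq : lam a b = a%:R * grad1 + b%:R * grad2.
Proof.
apply/eqP; rewrite -subr_eq0 -normr_le0; apply/ler_addgt0Pr => eps eps0.
have [C0 /(_ C0.+1 (leqnSn _))] := lam_grad a b eps0.
have -> : (C0.+1 * a + a = C0.+2 * a)%N by lia.
have -> : (C0.+1 * b + b = C0.+2 * b)%N by lia.
rewrite lam_hom// add0r -[in X in X * lam a b - _ - _]natr1 mulrDl mul1r.
by rewrite [C0.+1%:R * _ + _]addrC addrK.
Qed.

Lemma lam_norm m n : (0 < m + n)%N ->
  ell (m%:R / (m + n)%:R, n%:R / (m + n)%:R) = lam m n / (m + n)%:R.
Proof.
move=> mn; have mnR : 0 < (m + n)%:R :> R by rewrite ltr0n.
apply: (mulfI (lt0r_neq0 mnR)); rewrite -(perc_hom H) ?divr_ge0//.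
by rewrite ![_%:R * (_ / _)]mulrC !divfK ?lt0r_neq0.
Qed.

(** For non-collinear vectors strict convexity makes subadditivity strict; it is then compared with
    the supporting plane at the sum (m + a, n + b). *)
Lemma lam_strict m n : (0 < m)%N -> (0 < n)%N -> (m * b)%N <> (a * n)%N ->
  m%:R * grad1 + n%:R * grad2 < lam m n.
Proof.
move=> m0 n0 mbna.
suff h : lam (m + a) (n + b) < lam m n + lam a b.
  have := @lam_ge_grad (m + a) (n + b) ltac:(lia).
  by rewrite !natrD; move: h; rewrite lam_grad_eq; lra.
have ab : 0 < (a + b)%:R :> R by rewrite ltr0n; lia.
have mn : 0 < (m + n)%:R :> R by rewrite ltr0n; lia.
have inUn p q : (0 < p)%N -> (0 < q)%N -> inU (p%:R / (p + q)%:R, q%:R / (p + q)%:R : R).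
  move=> p0 q0; have pq : 0 < (p + q)%:R :> R by rewrite ltr0n; lia.
  rewrite /inU /=; apply/andP; split.
    apply/andP; split; first by rewrite divr_gt0// ltr0n.
    by rewrite ltr_pdivrMr// mul1r ltr_nat; lia.
  by apply/eqP; rewrite natrD; field; rewrite -natrD lt0r_neq0.
pose xi : R * R := (m%:R / (m + n)%:R, n%:R / (m + n)%:R).
pose zeta : R * R := (a%:R / (a + b)%:R, b%:R / (a + b)%:R).
have ne : xi <> zeta.
  move=> [/eqP]; rewrite eqr_div ?lt0r_neq0// -!natrM eqr_nat => /eqP e _.
  by apply: mbna; nia.
(* With this weight the convex combination of the two normalized vectors is the normalization of
   their sum. *)
pose t : R := (m + n)%:R / (m + a + (n + b))%:R.
have D : (m + a + (n + b))%:R = (m + n)%:R + (a + b)%:R :> R by rewrite -natrD; congr _%:R; lia.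
have Dp : 0 < (m + n)%:R + (a + b)%:R :> R by lra.
have t01 : 0 < t < 1.
  by rewrite /t D divr_gt0//= ltr_pdivrMr// mul1r; lra.
have := perc_conv H (inUn m n m0 n0) (inUn a b a0 b0) ne t01.
have -> : t *: xi + (1 - t) *: zeta =
    ((m + a)%:R / (m + a + (n + b))%:R, (n + b)%:R / (m + a + (n + b))%:R).
  have s0 := lt0r_neq0 Dp.
  have nm := lt0r_neq0 mn; have nb := lt0r_neq0 ab.
  rewrite /t /xi /zeta D (natrD _ m a) (natrD _ n b).
  move: s0 nm nb; move: ((m + n)%:R : R) ((a + b)%:R : R) => p q s0 nm nb.
  by apply: injective_projections; rewrite /= /GRing.scale /=; field; rewrite s0 nm nb.
rewrite lam_norm ?lam_norm; [|lia|lia|lia].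
have -> : t * (lam m n / (m + n)%:R) + (1 - t) * (lam a b / (a + b)%:R) =
    (lam m n + lam a b) / (m + a + (n + b))%:R.
  have nm := lt0r_neq0 mn; have nb := lt0r_neq0 ab; have s0 := lt0r_neq0 Dp.
  rewrite /t D; move: s0 nm nb; move: ((m + n)%:R : R) ((a + b)%:R : R) => p q s0 nm nb.
  by field; rewrite s0 nm nb.
by rewrite ltr_pM2r// invr_gt0 D.
Qed.

(** The gap between [ell] and its tangent plane along the ray (a,b): nonnegative, homogeneous, zero
    on the ray and positive off it. *)
Definition phi (m n : nat) : R := lam m n - (m%:R * grad1 + n%:R * grad2).

(** On a row to the left of the ray, (I0,H0) lies in the cone spanned by (i,H0) and (a,b); the gap
    is subadditive and vanishes on the ray, so it can only shrink towards the ray. *)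
Lemma phi_mono (I0 H0 i : nat) : (i <= I0)%N -> (0 < H0)%N -> (I0 * b < a * H0)%N ->
  phi I0 H0 <= phi i H0.
Proof.
move=> iI h0 hs; have [->//|iI'] : i = I0 \/ (i < I0)%N by lia.
(* Cramer's rule for al (I0,H0) = be (i,H0) + ga (a,b), with denominators cleared. *)
pose al := (a * H0 - i * b)%N; pose be := (a * H0 - I0 * b)%N; pose ga := ((I0 - i) * H0)%N.
have al0 : (0 < al)%N by rewrite /al; nia.
have be0 : (0 < be)%N by rewrite /be; nia.
have ga0 : (0 < ga)%N by rewrite /ga; nia.
have bal : (be <= al)%N by rewrite /al /be; nia.
have E1 : (al * I0 = be * i + ga * a)%N by rewrite /al /be /ga; nia.
have E2 : (al * H0 = be * H0 + ga * b)%N by rewrite /al /be /ga; nia.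
have := @lam_subadd (be * i) (be * H0) (ga * a) (ga * b) ltac:(nia) ltac:(nia).
rewrite -E1 -E2 !lam_hom// lam_grad_eq.
have pi : 0 <= phi i H0 by rewrite subr_ge0; apply: lam_ge_grad; lia.
have R1 : al%:R * I0%:R = be%:R * i%:R + ga%:R * a%:R :> R by rewrite -!natrM -natrD E1.
have R2 : al%:R * H0%:R = be%:R * H0%:R + ga%:R * b%:R :> R by rewrite -!natrM -natrD E2.
have aR : 0 < al%:R :> R by rewrite ltr0n.
have bR : be%:R <= al%:R :> R by rewrite ler_nat.
move=> h; rewrite -(ler_pM2l aR); apply: le_trans (_ : be%:R * phi i H0 <= _); last first.
  by rewrite ler_wpM2r.
have G1 : al%:R * I0%:R * grad1 = (be%:R * i%:R + ga%:R * a%:R) * grad1 by rewrite R1.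
have G2 : al%:R * H0%:R * grad2 = (be%:R * H0%:R + ga%:R * b%:R) * grad2 by rewrite R2.
by rewrite /phi; move: h G1 G2; rewrite !mulrBr !mulrDr !mulrDl !mulrA; lra.
Qed.

End gradient.

End time_constant.

(** * A maximal inequality along a ray *)

Section maximal.
Context {R : realType}.
Implicit Types (al : nat -> R) (la : R).

(** Some forward average from [i], over at most [N] terms, exceeds [la]. The finite horizon keeps
    the covering argument inside an interval only [N] longer. *)
Definition heavy al la N i :=
  [exists m : 'I_N, la * m.+1%:R < \sum_(i <= j < i + m.+1) al j].

(* Greedy covering: a heavy index pays for the whole block that witnesses it. *)
Lemma heavy_count al la N T i0 : (forall i, 0 <= al i) -> 0 < la ->
  la * (\sum_(i0 <= i < i0 + T) (heavy al la N i)%:R) <= \sum_(i0 <= i < i0 + T + N) al i.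
Proof.
move=> al0 la0; have [n] := ubnP T; elim: n T i0 => // n IH T i0 Tn.
have pos m p : 0 <= \sum_(m <= i < p) al i by apply: sumr_ge0.
have [->|T0] := eqVneq T 0%N.
  by rewrite addn0 big_geq ?mulr0.
have [hv|nhv] := boolP (heavy al la N i0); last first.
  rewrite big_ltn; last by lia.
  rewrite (negPf nhv) add0r [X in _ <= X]big_ltn; last by lia.
  have := IH T.-1 i0.+1 ltac:(lia).
  have -> : (i0.+1 + T.-1 = i0 + T)%N by lia.
  by move=> h; apply: le_trans h _; rewrite lerDr.
have /existsP[m hm] := hv.
have mN : (m < N)%N by [].
have le1 p q : \sum_(p <= i < q) (heavy al la N i)%:R <= (q - p)%:R :> R.
  apply: le_trans (_ : \sum_(p <= i < q) 1 <= _).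
    by apply: ler_sum => i _; case: heavy.
  by rewrite sumr_const_nat.
have [mT|mT] := leqP T m.+1.
  rewrite [X in _ <= X](@big_cat_nat _ _ _ (i0 + m.+1)) /=; [|lia|lia].
  apply: le_trans (_ : \sum_(i0 <= j < i0 + m.+1) al j <= _); last by rewrite lerDl.
  apply: le_trans (ltW hm); rewrite ler_pM2l//.
  apply: le_trans (le1 _ _) _; rewrite ler_nat; lia.
rewrite (@big_cat_nat _ _ _ (i0 + m.+1)) /=; [|lia|lia].
rewrite [X in _ <= X](@big_cat_nat _ _ _ (i0 + m.+1)) /=; [|lia|lia].
rewrite mulrDr lerD//.
  apply: le_trans (ltW hm); rewrite ler_pM2l//.
  by apply: le_trans (le1 _ _) _; rewrite ler_nat; lia.
have := IH (T - m.+1)%N (i0 + m.+1)%N ltac:(lia).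
by have -> : (i0 + m.+1 + (T - m.+1) = i0 + T)%N by lia.
Qed.

End maximal.

Section ray.
Context {R : realType}.
Local Notation E := (@envT R).
Variables (Q : probability E R) (ell : R * R -> R).
Hypothesis H : percolation Q ell.
Let QL := perc_site H.
Variables (a b : nat) (c : Z2).
Hypotheses (a0 : (0 < a)%N) (b0 : (0 < b)%N).

Definition ray k : Z2 := vec (k * a) (k * b).

Lemma rayE k : ray k = vec (k * a) (k * b). Proof. by []. Qed.

Lemma rayD k l : ray (k + l) = ray k + ray l.
Proof. by rewrite /ray !mulnDl vecD. Qed.

Lemma ray_ge0 k : le2 0 (ray k). Proof. by rewrite /ray /le2 /=; lia. Qed.

(** The endpoint is fixed and the start recedes along the ray: one more block of length M should
    cost M ell(a,b), and this is the error. *)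
Definition block_dev (M : nat) (V : Z2) (w : E) (j : nat) : R :=
  `|passage_time w (- ray (M * j.+1)) V - passage_time w (- ray (M * j)) V
    - M%:R * lam ell a b|.

Definition dev_bad (M N : nat) (la : R) (V : Z2) (i : nat) : set E :=
  [set w | heavy (block_dev M V w) la N i].

Lemma measurable_block_dev M V j : measurable_fun setT (fun w => block_dev M V w j).
Proof.
apply: measurableT_comp => //; apply: measurable_funB => //.
by apply: measurable_funB; exact: measurable_pt_env.
Qed.

Lemma intg_block_dev M V j : intg Q (fun w => block_dev M V w j).
Proof.
apply: (@intg_norm _ _ _ Q (fun w : E => passage_time w (- ray (M * j.+1)) V -
  passage_time w (- ray (M * j)) V - M%:R * lam ell a b)).
by apply: intgB; [apply: intgB; exact: (intg_pt H)|exact: intg_cst].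
Qed.

Lemma measurable_dev_bad M N la V i : measurable (dev_bad M N la V i).
Proof.
rewrite (_ : dev_bad M N la V i = \bigcup_(m in [set m | (m < N)%N])
   [set w : E | la * m.+1%:R < \sum_(i <= j < i + m.+1) block_dev M V w j]); last first.
  apply/seteqP; split=> w /=.
    by move=> /existsP[m hm]; exists m => //=.
  by move=> [m /= mN hm]; apply/existsP; exists (Ordinal mN).
apply: bigcup_measurable => m _; set g := fun w : E => \sum_(i <= j < i + m.+1) block_dev M V w j.
have mg : measurable_fun setT g.
  by apply: measurable_sum => j; exact: measurable_block_dev.
rewrite -[X in measurable X]setTI; apply: (mg measurableT [set x | la * m.+1%:R < x]).
rewrite (_ : [set x | _] = `]la * m.+1%:R, +oo[%classic) //.
by apply/seteqP; split=> x /=; rewrite in_itv /= ?andbT.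
Qed.

Lemma block_dev_shift M V w i j :
  block_dev M (V + ray (i * M)) w j = block_dev M V (shift_env (ray (i * M)) w) (i + j).
Proof.
rewrite /block_dev !pt_shift.
have e k : - ray (M * (i + k)) + ray (i * M) = - ray (M * k).
  by rewrite mulnDr rayD [(M * i)%N]mulnC opprD addrAC addNr add0r.
by rewrite -addnS !e.
Qed.

(** Moving the endpoint forward by [i] blocks is, up to a translation, the same as reading the
    blocks from index [i]. A count of heavy indices for one endpoint thereby becomes an average over
    endpoints. *)
Lemma dev_bad_shift M N la V i :
  dev_bad M N la (V + ray (i * M)) 0 = shift_env (ray (i * M)) @^-1` dev_bad M N la V i.
Proof.
have S m' (al : nat -> R) : \sum_(i <= j < i + m') al j = \sum_(0 <= j < 0 + m') al (i + j)%N.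
  rewrite -{1}[i]add0n big_addn addKn add0n.
  by apply: eq_bigr => j _; rewrite addnC.
have D w m' : \sum_(0 <= j < 0 + m') block_dev M (V + ray (i * M)) w j =
    \sum_(i <= j < i + m') block_dev M V (shift_env (ray (i * M)) w) j.
  by rewrite S; apply: eq_bigr => j _; exact: block_dev_shift.
apply/seteqP; split=> w /= /existsP[m hm]; apply/existsP; exists m; move: hm.
  by rewrite D.
by rewrite -D.
Qed.

Definition eray k : R := Ex Q (fun w => passage_time w 0 (ray k + c)).

Lemma eray_ge : exists C : R, forall k, le2 0 (ray k + c) -> k%:R * lam ell a b - C <= eray k.
Proof.
pose l := (absz c.1 + absz c.2)%N.
(* The endpoint is brought back to the ray by a stretch from [c] to [ray l], whose mean cost does
   not depend on [k]. *)
have hl : le2 c (ray l) by rewrite /ray /le2 /=; apply/andP; split; nia.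
pose C0 := Ex Q (fun w => passage_time w c (ray l)).
exists (C0 - l%:R * lam ell a b) => k hk.
have h1 : (k + l)%:R * lam ell a b <= Ex Q (fun w => passage_time w 0 (ray (k + l))).
  have [kl0|kl0] := eqVneq (k + l)%N 0%N.
    rewrite kl0 mul0r /ray; apply: Ex_ge0 => w.
    by rewrite (_ : vec _ _ = 0)// pt_xx.
  by rewrite -(lam_hom H) ?lt0n// /ray (ept_ge H)//; nia.
have h2 : Ex Q (fun w => passage_time w (ray k + c) (ray (k + l))) = C0.
  rewrite /C0 -(Ex_shift QL (ray k) (intg_pt H c (ray l))); congr (Ex Q _).
  by apply/funext => w /=; rewrite pt_shift rayD addrC [ray l + _]addrC.
have : Ex Q (fun w => passage_time w 0 (ray (k + l))) <= eray k + C0.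
  rewrite -h2 -ExD; [|exact: (intg_pt H)|exact: (intg_pt H)].
  apply: Ex_le; first exact: (intg_pt H).
    by apply: intgD; exact: (intg_pt H).
  move=> w; apply: pt_tri => //; rewrite rayD.
  by move: hl; rewrite /le2 /=; lia.
by move: h1; rewrite natrD mulrDl; lra.
Qed.

Lemma eray_shift k i M :
  Ex Q (fun w => passage_time w (- ray (M * i)) (ray k + c)) = eray (k + i * M).
Proof.
rewrite /eray -(Ex_shift QL (- ray (M * i)) (intg_pt H 0 (ray (k + i * M) + c))); congr (Ex Q _).
apply/funext => w /=; rewrite pt_shift add0r; congr (passage_time _ _ _).
by rewrite rayD [(i * M)%N]mulnC addrAC addrK.
Qed.

(** An increment A = L(x,V) - L(y,V) never exceeds X = L(x,y), so |A - ML| <= |X - ML| + (X - A).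
    The first term is controlled in mean by convergence in L1, and the means of the increments A
    telescope. *)
Lemma sum_block_dev M k0 (eps : R) T : le2 0 (ray k0 + c) ->
  Ex Q (fun w => `|passage_time w 0 (ray M) - M%:R * lam ell a b|) <= eps ->
  \sum_(i < T) Ex Q (fun w => block_dev M (ray k0 + c) w i) <=
    T%:R * (2 * eps + M%:R * lam ell a b) - (eray (k0 + T * M) - eray k0).
Proof.
move=> hk heps.
set ML := M%:R * lam ell a b in heps *.
elim: T => [|T IH]; first by rewrite big_ord0 mul0r mul0n addn0 subrr subrr.
rewrite big_ord_recr /=; set V := ray k0 + c in IH *.
pose x := - ray (M * T.+1); pose y := - ray (M * T).
have xy : x + ray M = y by rewrite /x /y mulnS addnC rayD opprD addrAC addrK.
have xy2 : le2 x y by rewrite -xy; have := ray_ge0 M; rewrite /le2 /=; lia.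
have yV : le2 y V.
  by apply: le2_trans hk; have := ray_ge0 (M * T); rewrite /y /le2 /=; lia.
have iX : intg Q (fun w => passage_time w x y - ML).
  by apply: intgB; [exact: (intg_pt H)|exact: intg_cst].
have EXn : Ex Q (fun w => `|passage_time w x y - ML|) <= eps.
  apply: le_trans heps.
  have i0 : intg Q (fun w => `|passage_time w 0 (ray M) - ML|).
    apply: (@intg_norm _ _ _ Q (fun w : E => passage_time w 0 (ray M) - ML)).
    by apply: intgB; [exact: (intg_pt H)|exact: intg_cst].
  rewrite -(Ex_shift QL x i0) le_eqVlt; apply/orP; left; apply/eqP; congr (Ex Q _).
  by apply/funext => w /=; rewrite pt_shift add0r [ray M + x]addrC xy.
have EX : Ex Q (fun w => passage_time w x y) <= ML + eps.
  have := Ex_le iX (intg_norm iX) (fun w => ler_norm _).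
  rewrite ExB ?Ex_cst; [|exact: (intg_pt H)|exact: intg_cst].
  by move: EXn; lra.
have key w : block_dev M V w T <= `|passage_time w x y - ML| +
   (passage_time w x y - (passage_time w x V - passage_time w y V)).
  rewrite /block_dev -/x -/y -/ML.
  have t := pt_tri w xy2 yV.
  move: t; move: (passage_time w x y) (passage_time w x V) (passage_time w y V) => p q r t.
  rewrite ler_norml; have := ler_norm (p - ML); have := ler_norm (- (p - ML)).
  by rewrite normrN; lra.
have iB : intg Q (fun w => passage_time w x V - passage_time w y V).
  by apply: intgB; exact: (intg_pt H).
have := Ex_le (intg_block_dev M V T)
  (intgD (intg_norm iX) (intgB (intg_pt H x y) iB)) key.
rewrite ExD; [|exact: intg_norm|by apply: intgB => //; exact: (intg_pt H)].
rewrite ExB//; last exact: (intg_pt H).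
rewrite ExB; [|exact: (intg_pt H)|exact: (intg_pt H)].
rewrite /x /y !eray_shift -/x -/y.
rewrite -natr1 mulrDl mul1r; move: IH EX EXn; lra.
Qed.

Lemma dev_bad_average M N (la eps : R) k0 : le2 0 (ray k0 + c) -> 0 < eps -> 0 < la ->
  Ex Q (fun w => `|passage_time w 0 (ray M) - M%:R * lam ell a b|) <= eps ->
  exists T0, forall T, (T0 <= T)%N ->
    \sum_(i < T) pr Q (dev_bad M N la (ray (k0 + i * M) + c) 0) <= T%:R * (3 * eps / la).
Proof.
move=> hk eps0 la0 heps; have [C hC] := eray_ge.
pose D := C + eray k0 - k0%:R * lam ell a b.
(* Chosen so that D <= (T - 2N) eps; then 2 eps (T + N) + D is at most 3 eps T. *)
exists (2 * N + (Num.truncn (D / eps)).+1)%N => T hT.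
set V := ray k0 + c.
have e1 i : pr Q (dev_bad M N la (ray (k0 + i * M) + c) 0) = pr Q (dev_bad M N la V i).
  rewrite -(pr_shift QL (ray (i * M)) (measurable_dev_bad M N la V i)) -dev_bad_shift.
  by rewrite rayD /V [in RHS]addrAC.
under eq_bigr do rewrite e1.
have e2 w : la * \sum_(i < T) \1_(dev_bad M N la V i) w <= \sum_(i < T + N) block_dev M V w i.
  have := @heavy_count R (block_dev M V w) la N T 0 (fun i => normr_ge0 _) la0.
  rewrite !add0n !big_mkord; congr (_ * _ <= _); apply: eq_bigr => i _.
  rewrite indicE; congr (_%:R); congr nat_of_bool.
  by apply/idP/idP => [h|/set_mem]; [exact/mem_set|].
have iI i : intg Q (\1_(dev_bad M N la V i)).
  by apply: intg_indic; exact: measurable_dev_bad.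
have : la * \sum_(i < T) pr Q (dev_bad M N la V i) <=
    \sum_(i < T + N) Ex Q (fun w => block_dev M V w i).
  have -> : \sum_(i < T) pr Q (dev_bad M N la V i) =
      \sum_(i < T) Ex Q (\1_(dev_bad M N la V i)).
    by apply: eq_bigr => i _; rewrite Ex_indic//; exact: measurable_dev_bad.
  rewrite -(@Ex_sum R _ E Q T (fun i => \1_(dev_bad M N la V i)))// -ExZ; last first.
    exact: (@intg_sum R _ E Q T (fun i => \1_(dev_bad M N la V i))).
  rewrite -(@Ex_sum R _ E Q (T + N) (fun i w => block_dev M V w i)); last first.
    by move=> i _; exact: intg_block_dev.
  apply: Ex_le => //.
    by apply: intgZ; exact: (@intg_sum R _ E Q T (fun i => \1_(dev_bad M N la V i))).
  by apply: (@intg_sum R _ E Q (T + N) (fun i w => block_dev M V w i)) => i _; exact: intg_block_dev.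
move=> h; have := le_trans h (sum_block_dev (T + N) hk heps).
have := hC (k0 + (T + N) * M)%N.
have -> : le2 0 (ray (k0 + (T + N) * M) + c).
  by apply: le2_trans hk _; have := ray_ge0 ((T + N) * M); rewrite rayD /le2 /=; lia.
move=> /(_ isT); rewrite [(k0 + (T + N) * M)%:R]natrD natrM => g1 g2.
have hD : D <= (T%:R - 2 * N%:R) * eps.
  rewrite -ler_pdivrMr//; apply: le_trans (ltW (truncnS_gt _)) _.
  rewrite -natrM -natrB; last by lia.
  by move: hT; rewrite ler_nat; move: (Num.truncn _) => t; lia.
rewrite mulrA ler_pdivlMr// mulrC.
have NR : 0 <= N%:R :> R by [].
rewrite natrD in g2; move: g1 g2 hD; rewrite /D; nra.
Qed.

End ray.

(** * Geodesics to far points keep their direction *)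

Section rows.
Context {R : realType}.
Implicit Types (w : Z2 -> R * R) (x y V p q : Z2).

Lemma split_row (s : seq bool) k : (k <= count negb s)%N ->
  exists s1 s2, s = s1 ++ s2 /\ count negb s1 = k.
Proof.
elim: s k => [|b s IH] k /=; first by rewrite leqn0 => /eqP ->; exists [::], [::].
case: k => [|k]; first by move=> _; exists [::], (b :: s).
case: b => /= hk.
  by have [s1 [s2 [-> h]]] := IH k.+1 hk; exists (true :: s1), s2.
have [s1 [s2 [-> h]]] := IH k hk; exists (false :: s1), s2; split=> //=.
by rewrite h.
Qed.

(** Some geodesic from 0 to [V] meets the row of [p] weakly to the right of [p]. Additivity of
    passage times expresses this without choosing a geodesic. *)
Definition crosses w V p := exists q, [/\ q.2 = p.2, p.1 <= q.1, le2 0 q, le2 q V &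
  passage_time w 0 V = passage_time w 0 q + passage_time w q V].

(** An optimal path that avoids [0,X] on the lower row has already passed X there, and an up-right
    path never returns to the left. *)
Lemma crosses_of_row w V p (rho X : int) : le2 0 V -> 0 <= rho -> rho <= p.2 ->
  p.2 <= V.2 -> p.1 <= X ->
  (forall q, q.2 = rho -> 0 <= q.1 <= X -> le2 q V ->
     passage_time w 0 V < passage_time w 0 q + passage_time w q V) ->
  crosses w V p.
Proof.
move=> V0 r0 rp pV pX hrow.
have [s es E] := pt_attained w V0.
have split_eq s1 s2 : s = s1 ++ s2 -> passage_time w 0 V =
    passage_time w 0 (path_end 0 s1) + passage_time w (path_end 0 s1) V.
  move=> ss; have := @pt_split R w 0 s1 s2; rewrite -ss es => /(_ E)[-> ->].
  by rewrite E ss path_weight_cat.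
have V2 : V.2 = (count negb s)%:Z by rewrite -es path_endE /= add0r.
have [|s1 [s2 [e1 c1]]] := @split_row s (absz p.2); first by lia.
have [|s11 [s12 [e2 c2]]] := @split_row s1 (absz rho); first by lia.
have q2 : (path_end 0 s1).2 = p.2 by rewrite path_endE /= c1; lia.
have r2 : (path_end 0 s11).2 = rho by rewrite path_endE /= c2; lia.
have le12 : le2 (path_end 0 s11) (path_end 0 s1) by rewrite e2 path_end_cat path_le2.
have le1V : le2 (path_end 0 s1) V by rewrite -es e1 path_end_cat path_le2.
exists (path_end 0 s1); split=> //; [|exact: path_le2|exact: split_eq e1].
have [h|h] := ltrP X (path_end 0 s11).1; first by move: le12; rewrite /le2; lia.
have := hrow (path_end 0 s11) r2.
have -> : 0 <= (path_end 0 s11).1 <= X.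
  by rewrite h andbT path_endE /=; lia.
move=> /(_ isT (le2_trans le12 le1V)).
by rewrite -(split_eq s11 (s12 ++ s2)) ?ltxx// e1 e2 catA.
Qed.

Lemma row_le w x k : passage_time w x (x + vec k 0) <=
  \sum_(j < k) `|edge w (x + vec j.+1 0) true|.
Proof.
elim: k => [|k IH]; first by rewrite big_ord0 (_ : vec 0 0 = 0)// addr0 pt_xx.
rewrite big_ord_recr /=.
have e : x + vec k.+1 0 = x + vec k 0 + step true.
  by apply: injective_projections; rewrite /=; lia.
rewrite e; apply: le_trans (pt_end_le w true _) _.
  by rewrite /le2 /=; lia.
by rewrite lerD// ler_norm.
Qed.

End rows.

Lemma sum_inv_sq {R : realType} k0 n : (0 < k0)%N ->
  \sum_(k < n) ((k0.+1 + k) ^ 2)%:R^-1 <= k0%:R^-1 :> R.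
Proof.
move=> k00.
suff : \sum_(k < n) ((k0.+1 + k) ^ 2)%:R^-1 <= k0%:R^-1 - (k0 + n)%:R^-1 :> R.
  by move=> h; apply: le_trans h _; rewrite lerBlDr lerDl invr_ge0.
elim: n => [|n IH]; first by rewrite big_ord0 addn0 subrr.
rewrite big_ord_recr /=; apply: le_trans (lerD IH (lexx _)) _.
have -> : (k0.+1 + n = (k0 + n).+1)%N by lia.
have -> : (k0 + n.+1 = (k0 + n).+1)%N by lia.
move: (k0 + n)%N (ltn_addr n k00) => m m0.
have mR : 0 < m%:R :> R by rewrite ltr0n.
suff : ((m.+1 ^ 2)%:R^-1 : R) <= m%:R^-1 - m.+1%:R^-1.
  move: (k0%:R^-1 : R) (m%:R^-1 : R) (m.+1%:R^-1 : R) ((m.+1 ^ 2)%:R^-1 : R) => x y z t.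
  by lra.
have -> : m%:R^-1 - m.+1%:R^-1 = (m * m.+1)%:R^-1 :> R.
  by rewrite natrM -natr1; field; rewrite natr1 !lt0r_neq0// ltr0n.
rewrite lef_pV2 ?posrE ?ltr0n; [rewrite ler_nat|..]; nia.
Qed.

(** * Rows avoided by geodesics to a good endpoint *)

Section core.
Context {R : realType}.
Local Notation E := (@envT R).
Variables (Q : probability E R) (ell : R * R -> R).
Hypothesis H : percolation Q ell.
Let QL := perc_site H.
Variables (a b : nat) (c : Z2).
Hypotheses (a0 : (0 < a)%N) (b0 : (0 < b)%N).
Local Notation lam := (lam ell).
Local Notation ray := (ray a b).
Local Notation g1 := (grad1 ell a b).
Local Notation g2 := (grad2 ell a b).
Let m1 : R := Ex Q (fun w => `|edge w 0 true|).

Definition row_sum (w : E) (x : Z2) (k : nat) : R := \sum_(j < k) `|edge w (x + vec j.+1 0) true|.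

(** The passage starts behind the origin, at -rMC(a,b), and ends at the grid point rM(i,Hh). Here
    [mu] will be the mean over one of the [r] boxes that join them, and [M] is the slack allowed per
    box. *)
Definition slow (M C Hh : nat) (mu : R) (i r : nat) : set E :=
  [set w | r%:R * (mu + M%:R) <= passage_time w (- ray (r * M * C)) (vec (r * M * i) (r * M * Hh))].

Definition heavy_row (M Hh i r : nat) : set E :=
  [set w | (r * M)%:R * (m1 + 1) <= row_sum w (vec (r * M * i) (r * M * Hh)) (r * M)].

Lemma measurable_ge (f : E -> R) (x : R) : measurable_fun setT f ->
  measurable [set w | x <= f w].
Proof.
move=> mf; rewrite -[X in measurable X]setTI; apply: (mf measurableT [set y | x <= y]).
rewrite (_ : [set y | _] = `[x, +oo[%classic) //.
by apply/seteqP; split=> y /=; rewrite in_itv /= ?andbT.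
Qed.

Lemma measurable_slow M C Hh mu i r : measurable (slow M C Hh mu i r).
Proof. by apply: measurable_ge; exact: measurable_pt_env. Qed.

Lemma measurable_row_sum x k : measurable_fun setT (fun w => row_sum w x k).
Proof.
apply: measurable_sum => j; apply: measurableT_comp => //.
by apply: measurable_edge; exact: measurable_coord.
Qed.

Lemma measurable_heavy_row M Hh i r : measurable (heavy_row M Hh i r).
Proof. by apply: measurable_ge; exact: measurable_row_sum. Qed.

Lemma slow_bound M C Hh i : (0 < M)%N -> (0 < C)%N -> exists V : R, 0 <= V /\
  forall r, (0 < r)%N ->
  pr Q (slow M C Hh (ept Q (M * (C * a + i)) (M * (C * b + Hh))) i r) <= V / r%:R.
Proof.
move=> M0 C0; pose m' := (M * (C * a + i))%N; pose n' := (M * (C * b + Hh))%N.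
pose f := fun w : E => passage_time w 0 (vec m' n').
exists (Ex Q (fun w => f w ^+ 2)); split; first by apply: Ex_ge0 => w; exact: sqr_ge0.
move=> r r0; pose zs (j : nat) : Z2 := vec (j * m') (j * n') + - ray (r * M * C).
have mn : (0 < m' + n')%N by rewrite /m' /n'; nia.
have MR : 0 < M%:R :> R by rewrite ltr0n.
have rR : 0 < r%:R :> R by rewrite ltr0n.
pose S := [set y : Z2 | le2 0 y /\ le2 y (vec m' n') /\ y <> 0].
have := @chebyshev_translates R Q QL S f zs r M%:R (@dep_pt R 0 (vec m' n'))
   (sqint_pt H 0 (vec m' n')) MR r0
   (fun i0 j ij => box_disjoint _ mn (proj1 (andP ij))).
set A := [set w | _] => cheb.
have mA : measurable (A : set E).
  apply: measurable_ge; apply: (@intg_meas _ _ _ Q).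
  apply: (@intg_sum R _ E Q r (fun j (w : E) => f (shift_env (zs j) w))).
  by move=> j _; exact: (intg_shift QL (zs j) (intg_pt H _ _)).
apply: le_trans (pr_le Q (measurable_slow _ _ _ _ _ _) mA _) _.
  move=> w; rewrite /slow /A /= => h; apply: le_trans h _.
  have := pt_sum_le (shift_env (- ray (r * M * C)) w) m' n' r.
  rewrite pt_shift add0r.
  have -> : vec (r * m') (r * n') + - ray (r * M * C) = vec (r * M * i) (r * M * Hh).
    rewrite !rayE /vec /m' /n'; apply: injective_projections; rewrite /= ; nia.
  move=> /le_trans; apply; rewrite le_eqVlt; apply/orP; left; apply/eqP.
  apply: eq_bigr => j _; congr (passage_time _ _ _).
  by apply/funext => y; rewrite /shift_env /zs addrA.
apply: le_trans cheb _; apply: ler_wpM2l.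
  by apply: Ex_ge0 => w; exact: sqr_ge0.
rewrite lef_pV2 ?posrE ?mulr_gt0 ?exprn_gt0// ler_peMr ?(ltW rR)//.
by rewrite exprn_ege1// ler1n.
Qed.

Lemma heavy_row_bound M Hh i : (0 < M)%N -> exists V : R, 0 <= V /\
  forall r, (0 < r)%N -> pr Q (heavy_row M Hh i r) <= V / r%:R.
Proof.
move=> M0; pose f := fun w : E => `|edge w 0 true|.
have sf : sqint Q f by exact/sqint_norm/(sqint_edge H).
exists (Ex Q (fun w => f w ^+ 2)); split; first by apply: Ex_ge0 => w; exact: sqr_ge0.
move=> r r0; pose x := vec (r * M * i) (r * M * Hh).
pose zs (j : nat) : Z2 := x + vec j.+1 0.
have rM0 : (0 < r * M)%N by nia.
have rR : 0 < r%:R :> R by rewrite ltr0n.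
have rMR : 0 < (r * M)%:R :> R by rewrite ltr0n.
pose S := [set y : Z2 | y = 0].
have dS : dep S f.
  move=> B mB.
  have : measurable_fun setT (fun w : g_sigma_algebraType (cyl_env S) => `|edge w 0 true : R|).
    apply: measurableT_comp => //; apply: measurable_edge.
    by apply: measurable_coord.
  by move=> /(_ measurableT B mB); rewrite setTI.
have disj i0 j : (i0 < j < r * M)%N ->
    [set y | S (y - zs i0)] `&` [set y | S (y - zs j)] = set0.
  move=> ij; apply/seteqP; split=> // y [/eqP + /eqP].
  rewrite !subr_eq0 => /eqP -> /eqP; rewrite /zs => /addrI; rewrite /vec => -[].
  by lia.
have := @chebyshev_translates R Q QL S f zs (r * M) 1 dS sf ltr01 rM0 disj.
rewrite -/m1 expr1n mulr1 => cheb.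
have e : heavy_row M Hh i r = [set w | (r * M)%:R * (m1 + 1) <=
    \sum_(j < r * M) f (shift_env (zs j) w)].
  apply/seteqP; split=> w; rewrite /heavy_row /= /row_sum => h; apply: le_trans h _;
    apply: ler_sum => j _; by rewrite /f /edge /shift_env /zs add0r.
rewrite e; apply: le_trans cheb _; apply: ler_wpM2l.
  by apply: Ex_ge0 => w; exact: sqr_ge0.
by rewrite lef_pV2 ?posrE// ler_nat; nia.
Qed.

(* On the complement of the bad events no geodesic to V meets the row r M H in [0, r M I]. *)
Lemma row_avoided (M C I Hh r : nat) (V : Z2) (w : E) : (0 < M)%N -> (0 < C)%N -> (0 < I)%N ->
  (0 < Hh)%N -> (I * b < a * Hh)%N -> (0 < r)%N ->
  `|g1| + m1 + 10 <= phi ell a b I Hh ->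
  (forall i, (i <= I)%N -> lam (C * a + i) (C * b + Hh) - C%:R * lam a b <=
      i%:R * g1 + Hh%:R * g2 + 1) ->
  (forall i, (i <= I)%N -> ept Q (M * (C * a + i)) (M * (C * b + Hh)) <=
      M%:R * (lam (C * a + i) (C * b + Hh) + 1)) ->
  (forall i, (i <= I)%N -> ~ tc_dev ell i Hh 1 (r * M) w) ->
  (forall i, (i <= I)%N ->
      ~ slow M C Hh (ept Q (M * (C * a + i)) (M * (C * b + Hh))) i r w) ->
  (forall i, (i <= I)%N -> ~ heavy_row M Hh i r w) ->
  le2 0 V -> le2 (vec (r * M * I) (r * M * Hh)) V ->
  `|passage_time w (- ray (r * M * C)) V - passage_time w 0 V - (r * M * C)%:R * lam a b|
     <= (r * M)%:R ->
  forall q : Z2, q.2 = (r * M * Hh)%:Z -> 0 <= q.1 <= (r * M * I)%:Z ->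
    passage_time w 0 V < passage_time w 0 q + passage_time w q V.
Proof.
move=> M0 C0 I0 Hh0 hs r0 hphi hC hM hE1 hE2 hE3 V0 hV hE4 q q2 /andP[q1 q1'].
have rM0 : (0 < r * M)%N by nia.
have rMR : 0 < (r * M)%:R :> R by rewrite ltr0n.
have [k qk] : exists k : nat, q = vec k (r * M * Hh).
  by exists (absz q.1); case: q q1 q1' q2 => q1 q2 /= h1 h2 ->; rewrite /vec gez0_abs.
have kI : (k <= r * M * I)%N by move: q1'; rewrite qk.
(* The point [q] is enclosed between neighbouring grid points, so finitely many grid directions
   control the whole row. The right neighbour bounds L(0,q) from below, the left one bounds L(q,V)
   from below. *)
have [i [iI ki1 ki2]] : exists i, [/\ (i < I)%N, (r * M * i <= k)%N & (k <= r * M * i.+1)%N].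
  have [->|kI'] := eqVneq k (r * M * I)%N.
    by exists I.-1; split; nia.
  exists (k %/ (r * M))%N; split.
  - by rewrite ltn_divLR// mulnC; lia.
  - by rewrite mulnC leq_trunc_div.
  - by rewrite mulnC; have := ltn_ceil k rM0; lia.
pose qi := vec (r * M * i) (r * M * Hh); pose qj := vec (r * M * i.+1) (r * M * Hh).
have qiq : q = qi + vec (k - r * M * i) 0 by rewrite qk /qi -vecD; congr vec; lia.
have qqj : qj = q + vec (r * M * i.+1 - k) 0 by rewrite qk /qj -vecD; congr vec; lia.
have qV : le2 q V.
  by apply: le2_trans hV; rewrite qk le2_vec; lia.
have T1 : passage_time w 0 qj <= passage_time w 0 q + passage_time w q qj.
  by apply: pt_tri; rewrite ?qk /qj ?le2_vec; [rewrite /le2 /=; lia|lia].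
have T2 : passage_time w qi V <= passage_time w qi q + passage_time w q V.
  by apply: pt_tri => //; rewrite qk /qi le2_vec; lia.
have T3 : passage_time w (- ray (r * M * C)) V <=
    passage_time w (- ray (r * M * C)) qi + passage_time w qi V.
  apply: pt_tri; first by rewrite /qi /le2 /=; lia.
  by apply: le2_trans qV; rewrite qk /qi le2_vec; lia.
(* The two horizontal detours are disjoint parts of one row segment of length rM, so its weight is
   paid once. *)
have T4 : passage_time w qi q + passage_time w q qj <= (r * M)%:R * (m1 + 1).
  apply: le_trans (_ : row_sum w qi (r * M) <= _); last first.
    by have := hE3 i ltac:(nat_lia); rewrite /heavy_row /= => /negP; rewrite -ltNge => /ltW.
  have e : (r * M = (k - r * M * i) + (r * M * i.+1 - k))%N by lia.
  rewrite e /row_sum big_split_ord /=; apply: lerD.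
    by rewrite {1}qiq; exact: row_le.
  rewrite qqj; apply: le_trans (row_le _ _ _) _.
  apply: ler_sum => j _; rewrite qiq -addrA -vecD addn0 addnS //.
have F1 : (r * M)%:R * (lam i.+1 Hh - 1) <= passage_time w 0 qj.
  have := hE1 i.+1 iI; rewrite /tc_dev /= mul1r => /negP; rewrite -leNgt.
  by rewrite -/(lam i.+1 Hh) ler_norml /qj => /andP[+ _]; lra.
have F2 : passage_time w (- ray (r * M * C)) qi <=
    (r * M)%:R * (lam (C * a + i) (C * b + Hh) + 2).
  have := hE2 i ltac:(nat_lia); rewrite /slow /= => /negP; rewrite -ltNge => /ltW h.
  apply: le_trans h _; have := hM i ltac:(nat_lia).
  have rR : 0 < r%:R :> R by rewrite ltr0n.
  rewrite natrM -[r%:R * M%:R * _]mulrA ler_pM2l//; move: (ept _ _ _) => y; lra.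
have F3 := hC i ltac:(nat_lia).
have F4 : phi ell a b I Hh <= phi ell a b i.+1 Hh by apply: (phi_mono H).
have F5 : i.+1%:R = i%:R + 1 :> R by rewrite natr1.
have F6 := ler_norm (- g1); rewrite normrN in F6.
move: hE4; rewrite ler_norml [(r * M * C)%:R]natrM => /andP[F7 _].
move: F4 hphi; rewrite /phi F5 => F4 hphi.
(* In units of rM the errors are 1 for the deviation of L(0,qj), 2 for the slow event and the mean,
   1 for the gradient, 1 for the backward average and m1 + 1 for the row; |g1| pays for passing from
   [i] to [i.+1]. The assumed gap |g1| + m1 + 10 exceeds their total. *)
have G : (r * M)%:R * (lam (C * a + i) (C * b + Hh)) <=
   (r * M)%:R * (C%:R * lam a b + (i%:R * g1 + Hh%:R * g2 + 1)).
  by rewrite ler_pM2l//; lra.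
have G2 : (r * M)%:R * ((i%:R + 1) * g1 + Hh%:R * g2 + (- g1 + m1 + 10)) <=
   (r * M)%:R * lam i.+1 Hh.
  by rewrite ler_pM2l//; lra.
move: T1 T2 T3 T4 F1 F2 F7 G G2.
move: (passage_time w 0 qj) (passage_time w 0 q) (passage_time w q qj) (passage_time w qi V)
  (passage_time w qi q) (passage_time w q V) (passage_time w (- ray (r * M * C)) V)
  (passage_time w (- ray (r * M * C)) qi) (passage_time w 0 V) => x1 x2 x3 x4 x5 x6 x7 x8 x9.
move: ((r * M)%:R : R) rMR (lam i.+1 Hh) (lam (C * a + i) (C * b + Hh)) (lam a b)
  (i%:R : R) (Hh%:R : R) (C%:R : R) => rM rMp y1 y2 y3 y4 y5 y6.
rewrite !(mulrDr, mulrBr, mulrDl, mulrA, mulrN, mulr1).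
by lra.
Qed.

End core.

Lemma mem_bigsetU (T : Type) (F : nat -> set T) n j w : (j < n)%N -> F j w ->
  (\big[setU/set0]_(i < n) F i) w.
Proof.
elim: n => // n IH; rewrite big_ord_recr /= ltnS leq_eqVlt => /orP[/eqP ->|jn] Fj.
  by right.
by left; exact: IH.
Qed.

(** * Cones avoided by geodesics, for most endpoints on a ray *)

Section core_average.
Context {R : realType}.
Local Notation E := (@envT R).
Variables (Q : probability E R) (ell : R * R -> R).
Hypothesis H : percolation Q ell.
Variables (a b : nat) (c : Z2).
Hypotheses (a0 : (0 < a)%N) (b0 : (0 < b)%N).
Local Notation lam := (lam ell).
Local Notation ray := (ray a b).
Local Notation g1 := (grad1 ell a b).
Local Notation g2 := (grad2 ell a b).
Let m1 : R := Ex Q (fun w => `|edge w 0 true|).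

Definition left_good (I0 H0 n0 n1 : nat) (V : Z2) (w : E) := forall p : Z2, le2 0 p ->
  p.1 * H0%:Z <= I0%:Z * p.2 -> n0%:Z <= p.2 <= n1%:Z -> crosses w V p.

Lemma uniform_bound n (p : nat -> nat -> Prop) :
  (forall i, exists k0, forall k, (k0 <= k)%N -> p i k) ->
  exists k0, forall k, (k0 <= k)%N -> forall i, (i <= n)%N -> p i k.
Proof.
move=> h; elim: n => [|n [k0 IH]].
  have [k0 hk] := h 0%N; exists k0 => k kk i; rewrite leqn0 => /eqP ->; exact: hk.
have [k1 hk] := h n.+1; exists (maxn k0 k1) => k kk i; rewrite leq_eqVlt => /orP[/eqP ->|].
  by apply: hk; lia.
by rewrite ltnS => /IH; apply; lia.
Qed.

Lemma uniform_max n (v : nat -> R -> Prop) :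
  (forall i, exists x, 0 <= x /\ v i x) -> (forall i x y, x <= y -> v i x -> v i y) ->
  exists x, 0 <= x /\ forall i, (i <= n)%N -> v i x.
Proof.
move=> h mono; elim: n => [|n [x [x0 IH]]].
  by have [x [x0 hx]] := h 0%N; exists x; split=> // i; rewrite leqn0 => /eqP ->.
have [y [y0 hy]] := h n.+1; exists (x + y); split; first exact: addr_ge0.
move=> i; rewrite leq_eqVlt => /orP[/eqP ->|].
  by apply: mono hy; rewrite lerDr.
by rewrite ltnS => /IH; apply: mono; rewrite lerDl.
Qed.

Lemma isqrt_exists n d : (0 < d)%N -> exists k, (k ^ 2 * d <= n < k.+1 ^ 2 * d)%N.
Proof.
move=> d0; have ex : exists k, (k ^ 2 * d <= n)%N by exists 0%N.
have bd k : (k ^ 2 * d <= n)%N -> (k <= n)%N by nia.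
case: (ex_maxnP ex bd) => k hk kmax; exists k; rewrite hk /= ltnNge.
by apply/negP => /kmax; lia.
Qed.

Lemma block_sum M V (w : E) m (x : R) :
  \sum_(0 <= j < m) block_dev ell a b M V w j <= x ->
  `|passage_time w (- ray (M * m)) V - passage_time w 0 V - (M * m)%:R * lam a b| <= x.
Proof.
move=> h; apply: le_trans h; elim: m => [|m IH].
  by rewrite big_geq// muln0 (_ : - ray 0 = 0) ?subrr ?mul0r ?subr0 ?normr0.
rewrite big_nat_recr //=; apply: le_trans (lerD IH (lexx _)).
rewrite /block_dev; apply: le_trans (ler_normD _ _).
rewrite le_eqVlt; apply/orP; left; apply/eqP; congr `|_|.
rewrite !natrM -[m.+1%:R]natr1; ring.
Qed.

(** The time-constant, slow and row events do not involve the endpoint; only the backward averages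
    do, and these are small on average over [i]. The threshold [n0] precedes [n1], so the range of
    heights can later grow without loss, and [M], [k0], [T] may be any large values, so several
    applications can share them. *)
Lemma core_average I0 H0 (del : R) : (0 < H0)%N -> (I0 * b < a * H0)%N -> 0 < del ->
  exists M0, forall M, (M0 <= M)%N -> exists n0, forall n1, exists k1, forall k0, (k1 <= k0)%N ->
  exists T0, forall T, (T0 <= T)%N -> exists Bad : nat -> set E,
  [/\ forall i, measurable (Bad i), \sum_(i < T) pr Q (Bad i) <= T%:R * del &
      forall i w, ~ Bad i w -> left_good I0 H0 n0 n1 (ray (k0 + i * M) + c) w].
Proof.
move=> H00 hs del0.
have m10 : 0 <= m1 by apply: Ex_ge0.
have phi0 : 0 < phi ell a b (I0 + a) (H0 + b).
  by rewrite subr_gt0; apply: (lam_strict H) => //; nia.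
have [I [Hh [[Ip Hp] Is Is0 hphi]]] : exists I Hh, [/\ (0 < I)%N /\ (0 < Hh)%N,
    (I * b < a * Hh)%N, (I0 * Hh < H0 * I)%N & `|g1| + m1 + 10 <= phi ell a b I Hh].
  (* The sum of (I0,H0) and (a,b) points strictly between the two directions, where the gap is
     positive; homogeneity scales it up to the size that [row_avoided] asks for. *)
  pose F := (Num.truncn ((`|g1| + m1 + 10) / phi ell a b (I0 + a) (H0 + b))).+1.
  have Fp : (0 < F)%N by [].
  exists (F * (I0 + a))%N, (F * (H0 + b))%N; split.
  - by rewrite !muln_gt0 !addn_gt0 a0 b0 !orbT.
  - by rewrite -mulnA [X in (_ < X)%N]mulnCA ltn_pmul2l//; move: hs; clear; nia.
  - by rewrite mulnCA [X in (_ < X)%N]mulnCA ltn_pmul2l//; move: hs; clear; nia.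
  - have -> : phi ell a b (F * (I0 + a)) (F * (H0 + b)) = F%:R * phi ell a b (I0 + a) (H0 + b).
      by rewrite /phi (lam_hom H)// !natrM !natrD; ring.
    by rewrite -ler_pdivrMr//; apply/ltW/truncnS_gt.
have [C1 hC1] := @uniform_bound I (fun i C => lam (C * a + i) (C * b + Hh) - C%:R * lam a b <=
      i%:R * g1 + Hh%:R * g2 + 1) (fun i => ltac:(
   have [C0 h] := @lam_grad R Q ell H a b a0 b0 i Hh 1 ltr01;
   exists C0 => k /h; rewrite ler_norml => /andP[_]; rewrite lerBlDl; exact)).
have [C [C0 hC]] : exists C, (0 < C)%N /\ forall i, (i <= I)%N ->
    lam (C * a + i) (C * b + Hh) - C%:R * lam a b <= i%:R * g1 + Hh%:R * g2 + 1.
  by exists C1.+1; split=> // i iI; apply: hC1.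
clear C1 hC1.
have CR : 0 < C%:R :> R by rewrite ltr0n.
(* With la = M/C, the bound 3 (eps M) / la of [dev_bad_average] becomes del/4. *)
pose eps : R := del / (12 * C%:R).
have eps0 : 0 < eps by rewrite divr_gt0// mulr_gt0.
have CH i : (0 < C * a + i + (C * b + Hh))%N by rewrite !addn_gt0 Hp !orbT.
have [M1 hM1] := @uniform_bound I (fun i M => ept Q (M * (C * a + i)) (M * (C * b + Hh)) <=
      M%:R * (lam (C * a + i) (C * b + Hh) + 1)) (fun i => ltac:(
   have [M0 h] := @ept_le R Q ell H (C * a + i) (C * b + Hh) 1 (CH i) ltr01;
   exists M0 => k /h; exact)).
have [M2 hM2] := @ept_L1 R Q ell H a b eps (ltn_addr b a0) eps0.
exists (maxn M1 M2).+1 => M hM; have M0 : (0 < M)%N by apply: leq_trans hM.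
have MR : 0 < M%:R :> R by rewrite ltr0n.
have {}hM1 := hM1 M (leq_trans (leqW (leq_maxl _ _)) hM).
have {}hM2 := hM2 M (leq_trans (leqW (leq_maxr _ _)) hM).
have d4 : 0 < del / (4 * I.+1%:R) by rewrite divr_gt0// mulr_gt0.
have [r1 hr1] := @uniform_bound I (fun i r =>
    pr Q (tc_tail ell i Hh 1 r) <= del / (4 * I.+1%:R)) (fun i => ltac:(
   have [r0 h] := perc_tail H i Hh ltr01 d4;
   exists r0 => k kr; apply: le_trans h; apply: pr_le;
     [exact: measurable_tc_tail|exact: measurable_tc_tail|];
   move=> w [r /= hr hw]; exists r => //=; exact: leq_trans hr)).
have {}hr1 := hr1 r1 (leqnn _).
have mono (x y : R) (r : nat) : x <= y -> x / r%:R <= y / r%:R.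
  by move=> xy; rewrite ler_wpM2r// invr_ge0.
have [V2 [V20 hV2]] := @uniform_max I (fun i x => forall r, (0 < r)%N ->
    pr Q (slow a b M C Hh (ept Q (M * (C * a + i)) (M * (C * b + Hh))) i r) <= x / r%:R)
  (fun i => slow_bound H a0 b0 Hh i M0 C0)
  (fun i x y xy h r r0 => le_trans (h r r0) (mono x y r xy)).
have [V3 [V30 hV3]] := @uniform_max I (fun i x => forall r, (0 < r)%N ->
    pr Q (heavy_row Q M Hh i r) <= x / r%:R)
  (fun i => heavy_row_bound H a0 b0 Hh i M0)
  (fun i x y xy h r r0 => le_trans (h r r0) (mono x y r xy)).
pose VV := I.+1%:R * (V2 + V3).
have VV0 : 0 <= VV by rewrite mulr_ge0// addr_ge0.
(* [K] puts all scales beyond the tail threshold, makes consecutive squares close enough for the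
   slope comparison below, and leaves a small remainder of the series of inverse squares. *)
have [K [K0 Kr1 KI hK]] : exists K, [/\ (0 < K)%N, (r1 <= K)%N,
    (2 * I0 * Hh + 1 <= K)%N & VV / K%:R <= del / 4].
  exists (r1 + (2 * I0 * Hh + 1) + (Num.truncn (4 * VV / del)).+1)%N; split.
  - by rewrite addnS.
  - by rewrite -addnA leq_addr.
  - by rewrite addnAC leq_addl.
  rewrite ler_pdivrMr ?ltr0n ?addnS// mulrC -ler_pdivrMr; last by lra.
  have -> : VV / (del / 4) = 4 * VV / del by field; rewrite lt0r_neq0.
  by apply: le_trans (ltW (truncnS_gt _)) _; rewrite ler_nat ltnS leq_addl.
exists (K.+1 ^ 2 * (M * Hh))%N => n1.
(* A backward stretch at scale r consists of rC <= N blocks; an average error of at most [la] per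
   block sums to rM, the error tolerated by [row_avoided]. *)
pose N := (n1 ^ 2 * C)%N; pose la : R := M%:R / C%:R.
have la0 : 0 < la by rewrite divr_gt0.
exists (n1 ^ 2 * M * I + n1 ^ 2 * M * Hh + n1 + absz c.1 + absz c.2)%N => k0 hk0.
have hbig k : (k0 <= k)%N ->
    le2 (vec (n1 ^ 2 * M * I + n1) (n1 ^ 2 * M * Hh + n1)) (ray k + c).
  move=> kk; have k1 := leq_trans hk0 kk; rewrite rayE /le2 /=; apply/andP; split.
    have k2 : (k <= k * a)%N by rewrite leq_pmulr.
    by move: k1 k2; clear; move: (n1 ^ 2 * M * I)%N (n1 ^ 2 * M * Hh)%N (k * a)%N; lia.
  have k2 : (k <= k * b)%N by rewrite leq_pmulr.
  by move: k1 k2; clear; move: (n1 ^ 2 * M * I)%N (n1 ^ 2 * M * Hh)%N (k * b)%N; lia.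
have hV0 k : (k0 <= k)%N -> le2 0 (ray k + c).
  by move=> /hbig; apply: le2_trans.
have [T0 hT0] := @dev_bad_average R Q ell H a b c a0 b0 M N la (eps * M%:R) k0
   (hV0 k0 (leqnn _)) (mulr_gt0 eps0 MR) la0 hM2.
exists T0 => T TT0.
pose B1 : set E := \big[setU/set0]_(i < I.+1) tc_tail ell i Hh 1 r1.
(* The scales are squares so that bounds of order 1/r can be summed. *)
pose S k i : set E := slow a b M C Hh (ept Q (M * (C * a + i)) (M * (C * b + Hh))) i ((K.+1 + k) ^ 2)
    `|` heavy_row Q M Hh i ((K.+1 + k) ^ 2).
pose B2k k : set E := \big[setU/set0]_(i < I.+1) S k i.
pose B2 : set E := \big[setU/set0]_(k < n1) B2k k.
have mB1 : measurable B1.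
  by apply: bigsetU_measurable => i _; exact: measurable_tc_tail.
have mS k i : measurable (S k i).
  by apply: measurableU; [exact: measurable_slow|exact: measurable_heavy_row].
have mB2k k : measurable (B2k k) by apply: bigsetU_measurable => i _; exact: mS.
have mB2 : measurable B2 by apply: bigsetU_measurable => k _; exact: mB2k.
have pB1 : pr Q B1 <= del / 4.
  apply: le_trans (@pr_bigsetU _ _ _ Q (fun i => tc_tail ell i Hh 1 r1) I.+1 _) _.
    by move=> k; exact: measurable_tc_tail.
  apply: le_trans (_ : \sum_(k < I.+1) del / (4 * I.+1%:R) <= _).
    by apply: ler_sum => k _; apply: hr1; rewrite -ltnS.
  rewrite sumr_const card_ord -[_ *+ I.+1]mulr_natl le_eqVlt; apply/orP; left; apply/eqP.
  have i0 : I.+1%:R != 0 :> R by rewrite pnatr_eq0.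
  by move: (I.+1%:R : R) i0 => y y0; field.
have pB2 : pr Q B2 <= del / 4.
  apply: le_trans (@pr_bigsetU _ _ _ Q B2k n1 mB2k) _.
  apply: le_trans (_ : \sum_(k < n1) VV * ((K.+1 + k) ^ 2)%:R^-1 <= _); last first.
    rewrite -mulr_sumr; apply: le_trans hK; apply: ler_wpM2l => //.
    exact: sum_inv_sq.
  apply: ler_sum => k _.
  apply: le_trans (@pr_bigsetU _ _ _ Q (S k) I.+1 (mS k)) _.
  apply: le_trans (_ : \sum_(i < I.+1) (V2 + V3) / ((K.+1 + k) ^ 2)%:R <= _).
    apply: ler_sum => i _; have iI : (i <= I)%N by rewrite -ltnS.
    apply: le_trans (pr_setU Q (measurable_slow _ _ _ _ _ _ _ _) (measurable_heavy_row _ _ _ _ _)) _.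
    rewrite mulrDl; apply: lerD; [apply: hV2|apply: hV3] => //; rewrite expn_gt0.
  by rewrite sumr_const card_ord -[_ *+ I.+1]mulr_natl /VV mulrA.
pose B4 i := dev_bad ell a b M N la (ray (k0 + i * M) + c) 0.
have mB4 i : measurable (B4 i) by exact: measurable_dev_bad.
exists (fun i => B1 `|` B2 `|` B4 i); split.
- by move=> i; apply: measurableU => //; exact: measurableU.
- apply: le_trans (_ : \sum_(i < T) (del / 2 + pr Q (B4 i)) <= _).
    apply: ler_sum => i _; apply: le_trans (pr_setU Q (measurableU _ _ mB1 mB2) (mB4 i)) _.
    rewrite lerD2r; apply: le_trans (pr_setU Q mB1 mB2) _; lra.
  rewrite big_split /= sumr_const card_ord -[_ *+ T]mulr_natl.
  have := hT0 T TT0; rewrite -/(B4 _).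
  have -> : 3 * (eps * M%:R) / la = del / 4.
    by rewrite /la /eps; field; rewrite !lt0r_neq0.
  have TR : 0 <= T%:R :> R by [].
  by move: (\sum_(i < T) _) => x; nra.
move=> i w nB; have nB1 : ~ B1 w by move=> h; apply: nB; left; left.
have nB2 : ~ B2 w by move=> h; apply: nB; left; right.
have nB4 : ~ B4 i w by move=> h; apply: nB; right.
have nE1 j : (j <= I)%N -> ~ tc_tail ell j Hh 1 r1 w.
  by move=> jI h; apply: nB1; exact: (@mem_bigsetU _ (fun i => tc_tail ell i Hh 1 r1) _ j).
have nE23 k j : (k < n1)%N -> (j <= I)%N -> ~ S k j w.
  move=> kn jI h; apply: nB2; apply: (@mem_bigsetU _ B2k _ k) => //.
  exact: (@mem_bigsetU _ (S k) _ j).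
set V := ray (k0 + i * M) + c in nB4 *.
have VV1 := hbig (k0 + i * M)%N (leq_addr _ _); rewrite -/V in VV1.
move=> p p0 pc /andP[pn0 pn1].
have MHp : (0 < M * Hh)%N by rewrite muln_gt0 M0.
(* The height of [p] lies between two consecutive controlled rows. Using the lower one costs a
   factor (k+1)^2 / k^2 in the slope, absorbed by the strict inequality between I0/H0 and I/Hh. *)
have [k /andP[hk1 hk2]] := @isqrt_exists (absz p.2) (M * Hh) MHp.
have p10 : 0 <= p.1 by move: p0; rewrite /le2 => /andP[].
have p20 : 0 <= p.2 by move: p0; rewrite /le2 => /andP[].
have pn0' : (K.+1 ^ 2 * (M * Hh) <= absz p.2)%N.
  by move: pn0 p20; clear; move: (K.+1 ^ 2 * (M * Hh))%N; lia.
have pn1' : (absz p.2 <= n1)%N by move: pn1 p20; clear; lia.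
have kK : (K.+1 <= k)%N.
  rewrite leqNgt; apply/negP => kK.
  have : (k.+1 ^ 2 * (M * Hh) <= K.+1 ^ 2 * (M * Hh))%N.
    by rewrite leq_mul2r leq_exp2r// kK orbT.
  by move=> h; have := leq_trans hk2 (leq_trans h pn0'); rewrite ltnn.
have kn1 : (k <= n1)%N.
  apply: leq_trans pn1'; apply: leq_trans hk1; apply: leq_trans (leq_pmulr _ MHp).
  by rewrite -{1}[k]expn1 leq_pexp2l// (leq_trans _ kK).
pose r := (k ^ 2)%N; have r0 : (0 < r)%N by rewrite /r expn_gt0 (leq_trans _ kK).
have rn1 : (r <= n1 ^ 2)%N by rewrite /r leq_exp2r.
have kr : (k <= r)%N by rewrite /r -{1}[k]expn1 leq_pexp2l// (leq_trans _ kK).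
have kE : (K.+1 + (k - K.+1) = k)%N by rewrite subnKC.
have ij : (k - K.+1 < n1)%N.
  by apply: leq_trans kn1; rewrite ltn_subrL /= (leq_trans _ kK).
have [VV11 VV12] : (n1 ^ 2 * M * I + n1)%:Z <= V.1 /\ (n1 ^ 2 * M * Hh + n1)%:Z <= V.2.
  by move: VV1; rewrite /le2 => /andP[].
apply: (@crosses_of_row R w V p (r * M * Hh)%:Z (r * M * I)%:Z).
- exact: hV0 (leq_addr _ _).
- by [].
- by move: hk1 p20; rewrite -/r mulnA; clear; move: (r * M * Hh)%N; lia.
- by move: VV12 pn1; move: (V.2) (n1 ^ 2 * M * Hh)%N => v y; clear; lia.
- have e1 : (I0 * Hh * k.+1 ^ 2 <= H0 * I * k ^ 2)%N.
    have hk : (2 * (I0 * Hh) + 1 <= k)%N by rewrite mulnA; apply: leq_trans (ltnW kK).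
    move: Is0 hk; clear; move: (I0 * Hh)%N (H0 * I)%N => y z yz hk.
    have h1 : (y * (2 * k + 1) <= k ^ 2)%N by nia.
    have : (y.+1 * k ^ 2 <= z * k ^ 2)%N by rewrite leq_mul2r yz orbT.
    by nia.
  have e2 : (absz p.1 * H0 <= I0 * absz p.2)%N by move: pc p10 p20; clear; nia.
  have e3 : (absz p.1 * H0 <= r * M * I * H0)%N.
    apply: leq_trans e2 _.
    apply: (@leq_trans (I0 * (k.+1 ^ 2 * (M * Hh)))); first by rewrite leq_mul2l ltnW ?orbT.
    rewrite /r; have := leq_mul e1 (leqnn M).
    have -> : (I0 * (k.+1 ^ 2 * (M * Hh)) = I0 * Hh * k.+1 ^ 2 * M)%N by clear; ring.
    by have -> : (k ^ 2 * M * I * H0 = H0 * I * k ^ 2 * M)%N by clear; ring.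
  have e4 : (absz p.1 <= r * M * I)%N by rewrite leq_pmul2r in e3.
  by move: e4 p10; clear; move: (r * M * I)%N; lia.
- move=> q q2 q1 qV.
  apply: (@row_avoided R Q ell H a b a0 b0 M C I Hh r V w M0 C0 Ip Hp Is r0 hphi hC hM1) => //.
  + move=> j jI h; apply: (nE1 j jI); exists (r * M)%N => //=.
    apply: leq_trans Kr1 _; apply: leq_trans (ltnW kK) _; apply: leq_trans kr _.
    by rewrite leq_pmulr.
  + by move=> j jI h; apply: (nE23 _ _ ij jI); left; rewrite kE.
  + by move=> j jI h; apply: (nE23 _ _ ij jI); right; rewrite kE.
  + exact: hV0 (leq_addr _ _).
  + apply: le2_trans VV1; rewrite le2_vec.
    have h1 : (r * M * I <= n1 ^ 2 * M * I)%N by rewrite !leq_mul2r rn1 !orbT.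
    have h2 : (r * M * Hh <= n1 ^ 2 * M * Hh)%N by rewrite !leq_mul2r rn1 !orbT.
    by rewrite (leq_trans h1 (leq_addr _ _)) (leq_trans h2 (leq_addr _ _)).
  + have -> : (r * M * C = M * (r * C))%N by rewrite mulnAC mulnC.
    apply: block_sum.
    have rC0 : (0 < r * C)%N by rewrite muln_gt0 r0.
    have rCN : ((r * C).-1 < N)%N.
      by rewrite prednK// /N leq_mul2r rn1 orbT.
    rewrite leNgt; apply/negP => h; apply: nB4; apply/existsP; exists (Ordinal rCN) => /=.
    rewrite prednK// add0n; apply: le_lt_trans h.
    rewrite /la le_eqVlt; apply/orP; left; apply/eqP.
    by rewrite !natrM; field; rewrite lt0r_neq0.
Qed.

End core_average.

(** * Reflection in the diagonal *)

Section reflection.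
Context {R : realType}.
Local Notation E := (@envT R).
Variables (Q : probability E R) (ell : R * R -> R).
Hypothesis H : percolation Q ell.
Let QL := perc_site H.

Definition reflE (w : E) : E := refl_env w.

Lemma measurable_reflE : measurable_fun setT reflE.
Proof.
apply: measurable_env => z.
have -> : (fun t : E => reflE t z) = (fun p : R * R => (p.2, p.1)) \o (fun w : E => w (swap2 z)).
  by [].
apply: measurableT_comp; last exact: measurable_coord.
by apply: measurable_fun_pair; [exact: measurable_snd|exact: measurable_fst].
Qed.

HB.instance Definition _ := isMeasurableFun.Build _ _ _ _ reflE measurable_reflE.

Definition refl_law : probability E R := distribution Q reflE.

Lemma refl_lawE A : refl_law A = Q (reflE @^-1` A). Proof. by []. Qed.

Lemma sigma_reflE S A : <<s cyl_env S >> A ->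
  <<s @cyl_env R [set z | S (swap2 z)] >> (reflE @^-1` A).
Proof.
have : <<s cyl_env S >> `<=`
    [set A | <<s @cyl_env R [set z | S (swap2 z)] >> (reflE @^-1` A)].
  apply: smallest_sub.
    split.
    - exact: (@measurable0 _ (g_sigma_algebraType (cyl_env [set z | S (swap2 z)]))).
    - move=> C /= hC; rewrite setTD.
      exact: (@measurableC _ (g_sigma_algebraType (cyl_env [set z | S (swap2 z)]))).
    - move=> F /= hF; rewrite preimage_bigcup.
      exact: (@bigcupT_measurable _ (g_sigma_algebraType (cyl_env [set z | S (swap2 z)]))).
  move=> _ [z [B [Sz mB ->]]]; apply: sub_sigma_algebra.
  exists (swap2 z), ((fun p : R * R => (p.2, p.1)) @^-1` B); split=> //.
    by rewrite /=; case: z Sz.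
  rewrite -[X in measurable X]setTI.
  have : measurable_fun setT (fun p : R * R => (p.2, p.1)).
    by apply: measurable_fun_pair; [exact: measurable_snd|exact: measurable_fst].
  exact.
by move=> h /h.
Qed.

Definition swap_ell (p : R * R) : R := ell (swap2 p).

Lemma pt_reflE w m n : passage_time (reflE w) 0 (vec m n) = passage_time w 0 (vec n m).
Proof. exact: (pt_refl w 0 (vec n m)). Qed.

Lemma tc_tail_refl m n eps r0 :
  reflE @^-1` tc_tail swap_ell m n eps r0 = tc_tail ell n m eps r0.
Proof.
apply/seteqP; split=> w [r hr]; rewrite /tc_dev /= => h; exists r => //.
  by move: h; rewrite pt_reflE.
by rewrite /tc_dev /= pt_reflE.
Qed.

(** Exchanging the coordinates exchanges the two sides of a ray, so statements about geodesics
    passing to the right of a cone also yield those about passing above it. *)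
Lemma percolation_refl : percolation refl_law swap_ell.
Proof.
split.
- split.
    move=> z A mA; rewrite !refl_lawE.
    rewrite [X in Q X](_ : _ = shift_env (swap2 z) @^-1` (reflE @^-1` A)).
      by rewrite QL.1// -[X in measurable X]setTI; exact: measurable_reflE.
    apply/seteqP; split=> w /=; rewrite (_ : shift_env z (reflE w) = reflE (shift_env (swap2 z) w))//;
      by apply/funext => y; rewrite /reflE /refl_env /shift_env; congr (swap2 (w _)); case: y => ? ?; case: (z).
  move=> S S' A A' SS' sA sA'; rewrite !refl_lawE preimage_setI.
  apply: (QL.2 _ _ _ _ _ (sigma_reflE sA) (sigma_reflE sA')).
  apply/seteqP; split=> // z /= [Sz S'z].
  have : (S `&` S') (swap2 z) by [].
  by rewrite SS'.
- move=> b; have [mf hf] := perc_sqint H (~~ b).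
  have me : measurable_fun setT (fun w : E => edge w 0 b).
    by apply: measurable_edge; exact: measurable_coord.
  split=> //; apply/(@intg_preserving R _ _ E E Q refl_law reflE measurable_reflE) => //.
    exact: measurable_funX.
  by move: hf; congr (intg Q _); apply/funext => w /=; case: (b).
- move=> m n eps del eps0 del0; have [r0 h] := perc_tail H n m eps0 del0.
  by exists r0; move: h; rewrite /pr refl_lawE tc_tail_refl.
- by move=> k s t k0 s0 t0; rewrite /swap_ell /swap2 /= (perc_hom H).
- move=> xi x1 x2; apply: (@differentiable_comp R _ _ _ (@swap2 R) ell).
    apply: differentiable_pair.
      by apply: linear_differentiable => y; exact: cvg_snd.
    by apply: linear_differentiable => y; exact: cvg_fst.
  exact: (perc_diff H).
- move=> xi zeta hxi hzeta ne t t01.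
  have inUs (p : R * R) : inU p -> inU (swap2 p).
    case: p => p q; rewrite /inU /swap2 /= => /andP[/andP[h1 h2] /eqP ->].
    by apply/andP; split; [apply/andP; split; lra|apply/eqP; ring].
  have := @perc_conv _ _ _ H (swap2 xi) (swap2 zeta) (inUs _ hxi) (inUs _ hzeta) _ t t01.
  apply; move=> [e1 e2]; apply: ne.
  by move: e1 e2; case: xi {hxi} => ? ?; case: zeta {hzeta} => ? ? /= -> ->.
Qed.

End reflection.

(** * Ordering of increments *)

Section star.
Context {R : realType}.
Local Notation E := (@envT R).

(** From [p] to the crossing point [q] the increment grows by monotonicity along the row; from [q]
    to [V] it grows because L(0,V) splits at [q] while L(e1,V) satisfies the triangle inequality
    there. *)
Lemma crosses_incr (w : E) (V p : Z2) : le2 e1 p -> crosses w V p ->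
  incr true w 0 p <= incr true w 0 V.
Proof.
move=> p1 [q [q2 pq q0 qV e]].
have -> : incr true w 0 V = passage_time w 0 V - passage_time w e1 V by rewrite /incr add0r.
have [n qE] : exists n : nat, q = p + step true *+ n.
  exists (absz (q.1 - p.1)%R); rewrite mulrn_Z2.
  by apply: injective_projections; rewrite /=; lia.
have h := (incr_mono_n (b := true) (x := 0) w n _).1; rewrite add0r in h.
apply: le_trans (h _ p1) _; rewrite -qE /incr add0r.
have e1q : le2 e1 q by apply: le2_trans p1 _; rewrite /le2 q2 pq lexx.
by have := pt_tri w e1q qV; rewrite /=; lra.
Qed.

(** The reverse comparison for e2 needs L(e2,V) to split at [q], so the geodesic starts at e2; hence
    the shifted environment and the endpoint V - e2. *)
Lemma crosses_incr_e2 (w : E) (V p : Z2) : le2 e2 p ->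
  crosses (shift_env e2 w) (V - e2) (p - e2) -> incr false w 0 V <= incr false w 0 p.
Proof.
move=> p1 [q' [q2 pq q0 qV]]; rewrite !pt_shift subrK add0r => e.
pose q := q' + e2; rewrite -/q in e.
have qE2 : q.2 = p.2 by move: q2; rewrite /q /=; lia.
have qE1 : p.1 <= q.1 by move: pq; rewrite /q /=; lia.
have {}qV : le2 q V by move: qV; rewrite /q /le2 /=; lia.
have e2q : le2 e2 q by move: q0; rewrite /q /le2 /=; lia.
have q00 : le2 0 q by move: q0; rewrite /q /le2 /=; lia.
have [n qE] : exists n : nat, q = p + step true *+ n.
  move: qE1 qE2; move: (q) => z z1 z2; exists (absz (z.1 - p.1)%R); rewrite mulrn_Z2.
  by apply: injective_projections; move: z1 z2; rewrite /=; clear; lia.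
have h := (incr_mono_n (b := false) (x := 0) w n _).2; rewrite add0r in h.
apply: le_trans (h _ p1); rewrite -[~~ false]/true -qE /incr add0r.
by have := pt_tri w q00 qV; rewrite /=; lra.
Qed.

Definition ordered (w : E) (p p' : Z2) :=
  incr true w 0 p <= incr true w 0 p' /\ incr false w 0 p' <= incr false w 0 p.

Lemma incr_refl b (w : E) v : incr b (reflE w) 0 (swap2 v) = incr (~~ b) w 0 v.
Proof.
rewrite /incr (pt_refl w 0 v) !add0r.
by have := pt_refl w (step (~~ b)) v; case: b => /= ->.
Qed.

(** Each increment towards [p] and each towards [p'] is compared with the one towards [V], which
    then disappears from the conclusion. *)
Lemma ordered_of_crosses (w : E) (V p p' : Z2) : le2 (e1 + e2) p -> le2 (e1 + e2) p' ->
  crosses w V p -> crosses (shift_env e2 w) (V - e2) (p - e2) ->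
  crosses (reflE w) (swap2 V) (swap2 p') ->
  crosses (shift_env e2 (reflE w)) (swap2 V - e2) (swap2 p' - e2) -> ordered w p p'.
Proof.
move=> hp hp' c1 c2 c3 c4.
have h1 := crosses_incr (w := w) (V := V) (p := p) _ c1.
have h2 := crosses_incr_e2 (w := w) (V := V) (p := p) _ c2.
have h3 := crosses_incr (w := reflE w) (V := swap2 V) (p := swap2 p') _ c3.
have h4 := crosses_incr_e2 (w := reflE w) (V := swap2 V) (p := swap2 p') _ c4.
rewrite !incr_refl /= in h3 h4.
split.
  apply: le_trans (h1 _) (h4 _); first by move: hp; rewrite /le2 /=; lia.
  by move: hp'; rewrite /le2 /=; lia.
apply: le_trans (h3 _) (h2 _); first by move: hp'; rewrite /le2 /=; lia.
by move: hp; rewrite /le2 /=; lia.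
Qed.

(** The margins [n0.+2] and [- 1] leave room to translate by e2 and stay in the cone, also after
    reflection for [p']. *)
Definition cone_pair (I0 H0 I1 H1 n0 : nat) (p p' : Z2) :=
  [&& (n0.+2%:Z <= p.1), (n0.+2%:Z <= p.2), (n0.+2%:Z <= p'.1), (n0.+2%:Z <= p'.2),
      p.1 * H0%:Z <= I0%:Z * (p.2 - 1) & p'.2 * H1%:Z <= I1%:Z * (p'.1 - 1)].

Definition star_fail I0 H0 I1 H1 n0 n1 : set E := \bigcup_(pp : Z2 * Z2)
  [set w | cone_pair I0 H0 I1 H1 n0 pp.1 pp.2 /\ pp.1.2 <= n1%:Z /\ pp.2.1 <= n1%:Z /\
           ~ ordered w pp.1 pp.2].

Lemma measurable_incr b x v : measurable_fun setT (fun w : E => incr b w x v).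
Proof. by apply: measurable_funB; exact: measurable_pt_env. Qed.

Lemma measurable_le_set (f g : E -> R) : measurable_fun setT f -> measurable_fun setT g ->
  measurable [set w | f w <= g w].
Proof.
move=> mf mg; rewrite (_ : [set w | _] = [set w | 0 <= g w - f w]).
  by apply: measurable_ge; exact: measurable_funB.
by apply/seteqP; split=> w /=; rewrite subr_ge0.
Qed.

Lemma measurable_star_fail I0 H0 I1 H1 n0 n1 : measurable (star_fail I0 H0 I1 H1 n0 n1).
Proof.
apply: countable_bigcupT_measurable; first exact: countableP.
move=> [p p'] /=.
have [[h1 [h2 h3]]|h] := pselect (cone_pair I0 H0 I1 H1 n0 p p' /\ p.2 <= n1%:Z /\ p'.1 <= n1%:Z); last first.
  rewrite (_ : [set w | _] = set0) //; apply/seteqP; split=> // w [? [? [? _]]].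
  by apply: h.
rewrite (_ : [set w | _] = ~` ([set w | incr true w 0 p <= incr true w 0 p'] `&`
    [set w | incr false w 0 p' <= incr false w 0 p])).
  by apply: measurableC; apply: measurableI; apply: measurable_le_set; exact: measurable_incr.
by apply/seteqP; split=> w /=; [case=> _ [_ []]|].
Qed.

Variables (Q : probability E R) (ell : R * R -> R).
Hypothesis H : percolation Q ell.
Let QL := perc_site H.

(** Four crossings are required: starts 0 and e2, on each side of the ray. Each fails with small
    probability on average over the endpoints. Since the event does not mention the endpoint, one
    index good for all four at once is enough. *)
Lemma star_fail_small (I0 H0 I1 H1 a b : nat) (del : R) :
  (0 < a)%N -> (0 < b)%N -> (0 < H0)%N -> (0 < H1)%N ->
  (I0 * b < a * H0)%N -> (I1 * a < b * H1)%N -> 0 < del ->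
  exists n0, forall n1, pr Q (star_fail I0 H0 I1 H1 n0 n1) <= del.
Proof.
move=> a0 b0 H00 H10 hs0 hs1 del0; have d4 : 0 < del / 4 by lra.
have [M1 h1] := core_average H 0 a0 b0 H00 hs0 d4.
have [M2 h2] := core_average H (- e2) a0 b0 H00 hs0 d4.
have [M3 h3] := core_average (percolation_refl H) 0 b0 a0 H10 hs1 d4.
have [M4 h4] := core_average (percolation_refl H) (- e2) b0 a0 H10 hs1 d4.
pose M := (M1 + M2 + M3 + M4)%N.
have [n1' {}h1] := h1 M ltac:(rewrite /M; lia).
have [n2' {}h2] := h2 M ltac:(rewrite /M; lia).
have [n3' {}h3] := h3 M ltac:(rewrite /M; lia).
have [n4' {}h4] := h4 M ltac:(rewrite /M; lia).
exists (n1' + n2' + n3' + n4')%N => n1.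
have [k1 {}h1] := h1 n1; have [k2 {}h2] := h2 n1.
have [k3 {}h3] := h3 n1; have [k4 {}h4] := h4 n1.
pose k := (k1 + k2 + k3 + k4)%N.
have [T1 {}h1] := h1 k ltac:(rewrite /k; lia).
have [T2 {}h2] := h2 k ltac:(rewrite /k; lia).
have [T3 {}h3] := h3 k ltac:(rewrite /k; lia).
have [T4 {}h4] := h4 k ltac:(rewrite /k; lia).
pose T := (T1 + T2 + T3 + T4).+1.
have [B1 [m1 s1 g1]] := h1 T ltac:(rewrite /T; lia).
have [B2 [m2 s2 g2]] := h2 T ltac:(rewrite /T; lia).
have [B3 [m3 s3 g3]] := h3 T ltac:(rewrite /T; lia).
have [B4 [m4 s4 g4]] := h4 T ltac:(rewrite /T; lia).
have TR : 0 < T%:R :> R by rewrite ltr0n.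
pose f i := pr Q (B1 i) + pr Q (B2 i) + (pr (refl_law Q) (B3 i) + pr (refl_law Q) (B4 i)).
(* The four averages are at most del/4 each, so some index has a total at most [del]. *)
have [i iT hi] : exists2 i, (i < T)%N & f i <= del.
  apply: contrapT => hn.
  have : \sum_(i < T) f i <= T%:R * del.
    by rewrite /f !big_split /=; move: s1 s2 s3 s4; lra.
  apply/negP; rewrite -ltNge.
  have -> : T%:R * del = \sum_(i < T) del by rewrite sumr_const card_ord mulr_natl.
  apply: ltr_sum => [|j _]; first by apply/hasP; exists ord0 => //; rewrite mem_index_enum.
  by rewrite ltNge; apply/negP => hj; apply: hn; exists j.
have {}g1 := g1 i; have {}g2 := g2 i; have {}g3 := g3 i; have {}g4 := g4 i.
pose A := B1 i `|` (shift_env e2 @^-1` B2 i) `|`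
   (reflE @^-1` (B3 i) `|` reflE @^-1` (shift_env e2 @^-1` (B4 i))).
have ms (B : set E) : measurable B -> measurable (shift_env e2 @^-1` B : set E).
  by move=> mB; rewrite -[X in measurable X]setTI; exact: measurable_shift_env.
have mr (B : set E) : measurable B -> measurable (@reflE R @^-1` B).
  by move=> mB; rewrite -[X in measurable X]setTI; exact: measurable_reflE.
have mA1 : measurable (B1 i `|` (shift_env e2 @^-1` B2 i) : set E).
  by apply: measurableU => //; exact: ms.
have mA2 : measurable (reflE @^-1` (B3 i) `|` reflE @^-1` (shift_env e2 @^-1` (B4 i)) : set E).
  by apply: measurableU; apply: mr => //; exact: ms.
have mA : measurable (A : set E) by exact: measurableU.
apply: le_trans (pr_le Q (measurable_star_fail _ _ _ _ _ _) mA _) _; last first.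
  apply: le_trans hi; apply: le_trans (pr_setU Q mA1 mA2) _; rewrite /f; apply: lerD.
    apply: le_trans (pr_setU Q (m1 i) (ms _ (m2 i))) _.
    by rewrite (pr_shift QL).
  apply: le_trans (pr_setU Q (mr _ (m3 i)) (mr _ (ms _ (m4 i)))) _.
  apply: lerD => //.
  by rewrite -(pr_shift (perc_site (percolation_refl H)) e2 (m4 i)).
move=> w [[p p'] _ /= [cp [pn1 [pn2 nord]]]].
apply: contrapT => nA; apply: nord.
have nB1 : ~ B1 i w by move=> h; apply: nA; left; left.
have nB2 : ~ B2 i (shift_env e2 w) by move=> h; apply: nA; left; right.
have nB3 : ~ B3 i (reflE w) by move=> h; apply: nA; right; left.
have nB4 : ~ B4 i (shift_env e2 (reflE w)) by move=> h; apply: nA; right; right.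
have {}g1 := g1 _ nB1; have {}g2 := g2 _ nB2; have {}g3 := g3 _ nB3; have {}g4 := g4 _ nB4.
move: cp; rewrite /cone_pair => /and5P[c1 c2 c3 c4 /andP[c5 c6]].
set V := ray a b (k + i * M).
have sV : swap2 V = ray b a (k + i * M) by [].
rewrite addr0 -/V in g1; rewrite -/V in g2; rewrite addr0 -sV in g3; rewrite -sV in g4.
clear -g1 g2 g3 g4 c1 c2 c3 c4 c5 c6 pn1 pn2.
apply: (@ordered_of_crosses w V).
- by move: c1 c2; rewrite /le2 /=; clear; lia.
- by move: c3 c4; rewrite /le2 /=; clear; lia.
- apply: g1.
  + by move: c1 c2; rewrite /le2 /=; clear; lia.
  + by move: c5; clear; nia.
  + by move: c2 pn1; clear; lia.
- apply: g2.
  + by move: c1 c2; rewrite /le2 /=; clear; lia.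
  + by move: c5; rewrite /= subr0; clear; lia.
  + by move: c2 pn1; rewrite /=; clear; lia.
- apply: g3.
  + by move: c3 c4; rewrite /le2 /=; clear; lia.
  + by move: c6; rewrite /=; clear; nia.
  + by move: c3 pn2; rewrite /=; clear; lia.
- apply: g4.
  + by move: c3 c4; rewrite /le2 /=; clear; lia.
  + by move: c6; rewrite /= subr0; clear; lia.
  + by move: c3 pn2; rewrite /=; clear; lia.
Qed.

Definition star_null I0 H0 I1 H1 : set E :=
  \bigcap_n0 \bigcup_n1 star_fail I0 H0 I1 H1 n0 n1.

Lemma measurable_star_null I0 H0 I1 H1 : measurable (star_null I0 H0 I1 H1).
Proof.
apply: bigcapT_measurable => n0; apply: bigcupT_measurable => n1.
exact: measurable_star_fail.
Qed.

Lemma star_null0 (I0 H0 I1 H1 a b : nat) :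
  (0 < a)%N -> (0 < b)%N -> (0 < H0)%N -> (0 < H1)%N ->
  (I0 * b < a * H0)%N -> (I1 * a < b * H1)%N -> Q (star_null I0 H0 I1 H1) = 0%E.
Proof.
move=> a0 b0 H00 H10 hs0 hs1; rewrite prE; last exact: measurable_star_null.
congr EFin; apply/eqP; rewrite eq_le pr_ge0 andbT; apply/ler_addgt0Pr => del del0.
have [n0 hn0] := star_fail_small a0 b0 H00 H10 hs0 hs1 del0.
have mU : measurable (\bigcup_n1 star_fail I0 H0 I1 H1 n0 n1).
  by apply: bigcupT_measurable => n1; exact: measurable_star_fail.
rewrite add0r; apply: le_trans (pr_le Q (measurable_star_null _ _ _ _) mU _) _.
  by move=> w /(_ n0 I).
apply: pr_bigcup => // [n1|m n mn]; first exact: measurable_star_fail.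
apply/subsetPset => w [pp _ [h1 [h2 [h3 h4]]]]; exists pp => //; split=> //.
by split; [|split=> //]; lia.
Qed.

End star.

(** * Directional filters on the lattice *)

Section cones.
Context {R : realType}.
Implicit Types (t xi eta : R) (p x : Z2).

(** The direction p.1/(p.1 + p.2) lies in [t1,t2], written without division. Both coordinates are at
    least [n0], so points near the axes are excluded even for [0,1]. *)
Definition cone t1 t2 (n0 : nat) p :=
  [&& n0%:Z <= p.1, n0%:Z <= p.2,
      t1 * (p.1 + p.2)%:~R <= p.1%:~R & p.1%:~R <= t2 * (p.1 + p.2)%:~R].

Lemma coneS t1 t2 n0 t1' t2' n0' p : t1' <= t1 -> t2 <= t2' -> (n0' <= n0)%N ->
  cone t1 t2 n0 p -> cone t1' t2' n0' p.
Proof.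
move=> h1 h2 h3 /and4P[c1 c2 c3 c4].
have s0 : 0 <= (p.1 + p.2)%:~R :> R by rewrite ler0z; move: c1 c2; clear; lia.
apply/and4P; split; [by move: c1 h3; clear; lia|by move: c2 h3; clear; lia|..].
  by apply: le_trans c3; rewrite ler_wpM2r.
by apply: le_trans c4 _; rewrite ler_wpM2r.
Qed.

Definition vdir t (n : nat) : Z2 := (Num.floor (n%:R * t), Num.floor (n%:R * (1 - t))).

Lemma archi_mul (c d : R) : 0 < d -> exists N, forall n, (N <= n)%N -> c <= n%:R * d.
Proof.
move=> d0; exists (Num.truncn (c / d)).+1 => n nN.
rewrite -ler_pdivrMr//; apply: le_trans (ltW (truncnS_gt _)) _.
by rewrite ler_nat.
Qed.

Lemma vdir_cone t1 t t2 x n0 : 0 <= t1 -> t1 < t -> t < t2 -> 0 < t < 1 ->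
  exists N, forall n, (N <= n)%N -> cone t1 t2 n0 (x + vdir t n).
Proof.
move=> t10 h1 h2 /andP[t0 t1'].
pose x1 : R := x.1%:~R; pose x2 : R := x.2%:~R.
have [N1 hN1] := @archi_mul (n0%:R + 1 - x1) t t0.
have [N2 hN2] := @archi_mul (n0%:R + 1 - x2) (1 - t) ltac:(lra).
have [N3 hN3] := @archi_mul (t1 * (x1 + x2) - x1 + 1) (t - t1) ltac:(lra).
have [N4 hN4] := @archi_mul (x1 - t2 * (x1 + x2 - 2)) (t2 - t) ltac:(lra).
exists (N1 + N2 + N3 + N4)%N => n nN.
have {}hN1 := hN1 n ltac:(lia); have {}hN2 := hN2 n ltac:(lia).
have {}hN3 := hN3 n ltac:(lia); have {}hN4 := hN4 n ltac:(lia).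
set p := x + vdir t n.
pose f1 : R := (Num.floor (n%:R * t))%:~R; pose f2 : R := (Num.floor (n%:R * (1 - t)))%:~R.
have p1 : p.1%:~R = x1 + f1 by rewrite /p /= intrD.
have p2 : p.2%:~R = x2 + f2 by rewrite /p /= intrD.
have f1l : f1 <= n%:R * t by exact: floor_le_tmp.
have f2l : f2 <= n%:R * (1 - t) by exact: floor_le_tmp.
have f1g : n%:R * t < f1 + 1 by rewrite /f1 -(intrD _ _ 1) floorD1_gt.
have f2g : n%:R * (1 - t) < f2 + 1 by rewrite /f2 -(intrD _ _ 1) floorD1_gt.
have t20 : 0 < t2 by lra.
rewrite /cone -!(ler_int R) intrD p1 p2 -!pmulrn; apply/and4P; split.
- by lra.
- by lra.
- by move: f1l f2l f1g f2g hN3 t10; nra.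
- by move: f1l f2l f1g f2g hN4 t20; nra.
Qed.

(** Far points whose direction approaches [xi] strictly from one side. The distance [n0] may depend
    on the margin [eta0], but [eta] may not: this is a limit along cones that avoid the direction
    [xi] itself. *)
Definition side (s : bool) xi : set_system Z2 :=
  [set P | exists2 eta : R, 0 < eta & forall eta0, 0 < eta0 < eta -> exists n0 : nat,
     forall p, cone (if s then xi + eta0 else xi - eta) (if s then xi + eta else xi - eta0) n0 p -> P p].

Definition around xi : set_system Z2 :=
  [set P | exists2 eta : R, 0 < eta & exists n0 : nat,
     forall p, cone (xi - eta) (xi + eta) n0 p -> P p].

Lemma side_filter s xi : Filter (side s xi).
Proof.
split.
- by exists 1 => // eta0 _; exists 0%N.
- move=> P P' [e e0 h] [e' e'0 h'].
  exists (Num.min e e'); first by rewrite lt_min e0.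
  move=> eta0; rewrite lt_min => /andP[h0 /andP[h1 h2]].
  have [n hn] := h eta0 ltac:(by rewrite h0 h1).
  have [n' hn'] := h' eta0 ltac:(by rewrite h0 h2).
  have m1 : Num.min e e' <= e by rewrite ge_min lexx.
  have m2 : Num.min e e' <= e' by rewrite ge_min lexx orbT.
  exists (maxn n n') => p hp; split; [apply: hn|apply: hn']; apply: coneS hp;
    rewrite ?leq_maxl ?leq_maxr//; case: (s); lra.
- move=> P P' PP' [e e0 h]; exists e => // eta0 he; have [n hn] := h eta0 he.
  by exists n => p /hn/PP'.
Qed.

#[global] Existing Instance side_filter.

Lemma side_proper s xi : 0 < xi < 1 -> ProperFilter (side s xi).
Proof.
move=> /andP[x0 x1]; apply: Build_ProperFilter_ex.
move=> P [e e0 h].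
pose m := Num.min e (if s then 1 - xi else xi).
have m0 : 0 < m by rewrite lt_min e0; case: (s); lra.
have me : m <= e by rewrite ge_min lexx.
have m1 : m <= if s then 1 - xi else xi by rewrite ge_min lexx orbT.
have [n0 hn0] := h (m / 4) ltac:(by apply/andP; split; lra).
pose t := if s then xi + m / 2 else xi - m / 2.
have [||||N hN] := @vdir_cone (if s then xi + m / 4 else xi - 3 * m / 4) t
  (if s then xi + 3 * m / 4 else xi - m / 4) 0 n0.
- by move: m1; case: (s); lra.
- by rewrite /t; case: (s); lra.
- by rewrite /t; case: (s); lra.
- by move: m1; rewrite /t; case: (s) => ?; apply/andP; split; lra.
exists (0 + vdir t N); apply: hn0; apply: coneS (hN N (leqnn _)) => //; case: (s); lra.
Qed.

Lemma around_filter xi : Filter (around xi).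
Proof.
split.
- by exists 1 => //; exists 0%N.
- move=> P P' [e e0 [n hn]] [e' e'0 [n' hn']].
  have m1 : Num.min e e' <= e by rewrite ge_min lexx.
  have m2 : Num.min e e' <= e' by rewrite ge_min lexx orbT.
  exists (Num.min e e'); first by rewrite lt_min e0.
  exists (maxn n n') => p hp; split; [apply: hn|apply: hn']; apply: coneS hp;
    rewrite ?leq_maxl ?leq_maxr//; lra.
- by move=> P P' PP' [e e0 [n hn]]; exists e => //; exists n => p /hn/PP'.
Qed.

#[global] Existing Instance around_filter.

Lemma side_far s xi n0 : side s xi [set p | n0%:Z <= p.1 /\ n0%:Z <= p.2].
Proof. by exists 1 => // eta0 _; exists n0 => p /and4P[]. Qed.

(** A direction [zeta] strictly inside the one-sided interval has a full neighbourhood in one of its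
    closed cones. This is the source of the one-sided continuity of the limits, whichever side [s']
    is taken at [zeta]. *)
Lemma side_nearby s s' xi zeta eta (P : set Z2) : 0 < eta ->
  (forall eta0, 0 < eta0 < eta -> exists n0 : nat,
     forall p, cone (if s then xi + eta0 else xi - eta) (if s then xi + eta else xi - eta0) n0 p -> P p) ->
  (if s then xi < zeta < xi + eta else xi - eta < zeta < xi) -> side s' zeta P.
Proof.
move=> e0 h hz; pose d := Num.min `|zeta - xi| (eta - `|zeta - xi|).
have za : 0 < `|zeta - xi| < eta.
  move: hz; case: (s) => hz; [rewrite gtr0_norm|rewrite ltr0_norm]; lra.
have d0 : 0 < d by rewrite lt_min; lra.
have d1 : d <= `|zeta - xi| by rewrite ge_min lexx.
have d2 : d <= eta - `|zeta - xi| by rewrite ge_min lexx orbT.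
have [n0 hn0] := h (`|zeta - xi| / 2) ltac:(by apply/andP; split; lra).
exists (d / 2); first lra.
move=> eta0 he; exists n0 => p hp; apply: hn0; apply: coneS hp => //.
  by move: hz d1 d2; case: (s) => hz; [rewrite gtr0_norm|rewrite ltr0_norm]; case: (s'); lra.
by move: hz d1 d2; case: (s) => hz; [rewrite gtr0_norm|rewrite ltr0_norm]; case: (s'); lra.
Qed.

Lemma to_dir_around (v : nat -> Z2) (xi : R * R) : inU xi -> to_dir_infty v xi ->
  v @ \oo --> around xi.1.
Proof.
case: xi => x1 x2 /andP[/= /andP[x0 x1'] /eqP x2E] [/= hM h1 h2] P [e e0 [n0 hP]].
have hx : 0 < x1 / 2 by lra.
have hy : 0 < x2 / 2 by lra.
have hmin : 0 < Num.min x1 x2 / 2 by rewrite divr_gt0// lt_min; lra.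
move/cvgrPdist_lt : h1 => h1; move/cvgrPdist_lt : h2 => h2.
have := h1 _ hx; have := h1 _ e0; have := h2 _ hy.
have := hM (n0%:R / (Num.min x1 x2 / 2)); have := hM 0.
move=> A1 A2 A3 A4 A5.
case: A1 A2 A3 A4 A5 => N1 _ B1 [N2 _ B2] [N3 _ B3] [N4 _ B4] [N5 _ B5].
exists (N1 + N2 + N3 + N4 + N5)%N => // n /= nN; apply: hP.
have l0 := B1 n ltac:(rewrite /=; clear -nN; lia).
have ln0 := B2 n ltac:(rewrite /=; clear -nN; lia).
have k2 := B3 n ltac:(rewrite /=; clear -nN; lia).
have k1e := B4 n ltac:(rewrite /=; clear -nN; lia).
have k1 := B5 n ltac:(rewrite /=; clear -nN; lia).
rewrite /= in l0 ln0 k2 k1e k1; set l := l1norm (v n) in l0 ln0 k2 k1e k1.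
have q1 : x1 / 2 < (v n).1%:~R / l by move: k1; rewrite ltr_norml => /andP[]; lra.
have q2 : x2 / 2 < (v n).2%:~R / l by move: k2; rewrite ltr_norml => /andP[]; lra.
rewrite ltr_pdivlMr// in q1; rewrite ltr_pdivlMr// in q2.
have m1 : Num.min x1 x2 / 2 <= x1 / 2 by rewrite ler_pM2r// ge_min lexx.
have m2 : Num.min x1 x2 / 2 <= x2 / 2 by rewrite ler_pM2r// ge_min lexx orbT.
rewrite ltr_pdivrMr// in ln0.
have a1 : 0 < (v n).1%:~R :> R by apply: le_lt_trans q1; rewrite mulr_ge0// ltW.
have a2 : 0 < (v n).2%:~R :> R by apply: le_lt_trans q2; rewrite mulr_ge0// ltW.
have lE : l = ((v n).1 + (v n).2)%:~R.
  rewrite /l /l1norm intrD; congr (_ + _); congr (_%:~R).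
    by rewrite ger0_norm//; move: a1; rewrite ltr0z; exact: ltW.
  by rewrite ger0_norm//; move: a2; rewrite ltr0z; exact: ltW.
move: k1e; rewrite ltr_norml => /andP[r1 r2].
have r1' : (v n).1%:~R / l <= x1 + e by lra.
have r2' : x1 - e <= (v n).1%:~R / l by lra.
rewrite ler_pdivrMr// in r1'; rewrite ler_pdivlMr// in r2'.
apply/and4P; split; rewrite -?lE//.
  rewrite -(ler_int R) -pmulrn; apply: le_trans (ltW ln0) _; apply: le_trans (ltW q1).
  by rewrite mulrC ler_pM2r.
rewrite -(ler_int R) -pmulrn; apply: le_trans (ltW ln0) _; apply: le_trans (ltW q2).
by rewrite mulrC ler_pM2r.
Qed.

End cones.

(** * One-sided limits of ordered functions *)

Section ordered_functions.
Context {R : realType}.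
Implicit Types (t xi : R) (p : Z2) (F : Z2 -> R).

(** Monotonicity in the direction, valid far from the origin and between separated cones. One
    threshold [n0] serves all pairs of points in the two cones. *)
Definition ordered_fun F := forall t t', 0 < t -> t < t' -> t' < 1 ->
  exists n0, forall p p', cone 0 t n0 p -> cone t' 1 n0 p' -> F p <= F p'.

Lemma ordered_right_lim F xi : ordered_fun F -> 0 < xi < 1 ->
  exists l : R, F @ side true xi --> l.
Proof.
move=> oF /andP[x0 x1].
(* The right limit is the infimum of the asymptotic upper bounds on cones reaching beyond [xi];
   values in cones strictly to the right of [xi] are themselves such bounds. *)
pose A := [set r | exists t n0, xi < t < 1 /\ forall p, cone 0 t n0 p -> F p <= r].
have point t1 t2 n0 : 0 <= t1 -> t1 < t2 -> t2 <= 1 -> exists p, cone t1 t2 n0 p.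
  move=> h0 h1 h2; have [|||N hN] := @vdir_cone R t1 ((t1 + t2) / 2) t2 0 n0 h0; try lra.
  by exists (0 + vdir ((t1 + t2) / 2) N); exact: hN.
have Aexp t t' : xi < t -> t < t' -> t' < 1 -> exists n0, forall p, cone t' 1 n0 p -> A (F p).
  move=> h1 h2 h3; have [n0 hn0] := oF t t' ltac:(lra) h2 h3.
  by exists n0 => p' hp'; exists t, n0; split; [lra|move=> p hp; exact: hn0].
have A0 : A !=set0.
  have [n0 h] := @Aexp (xi + (1 - xi) / 3) (xi + (1 - xi) / 2) ltac:(lra) ltac:(lra) ltac:(lra).
  have [p hp] := point (xi + (1 - xi) / 2) 1 n0 ltac:(lra) ltac:(lra) ltac:(lra).
  by exists (F p); exact: h.
have Alb : has_lbound A.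
  have [n0 hn0] := oF (xi / 4) (xi / 2) ltac:(lra) ltac:(lra) ltac:(lra).
  have [p0 hp0] := point 0 (xi / 4) n0 ltac:(lra) ltac:(lra) ltac:(lra).
  exists (F p0) => r [t [n1 [ht hr]]].
  have [q hq] := point (xi / 2) t (maxn n0 n1) ltac:(lra) ltac:(lra) ltac:(lra).
  apply: le_trans (hn0 p0 q hp0 _) (hr q _).
    by apply: coneS hq; [lra|lra|exact: leq_maxl].
  by apply: coneS hq; [lra|lra|exact: leq_maxr].
exists (inf A); apply/cvgrPdist_lt => eps eps0.
have [r [t [n0 [ht hr]]] rlt] := inf_adherent eps0 (conj A0 Alb).
exists (t - xi); first lra.
move=> eta0 /andP[he0 het].
have [n1 hn1] := @Aexp (xi + eta0 / 2) (xi + eta0) ltac:(lra) ltac:(lra) ltac:(lra).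
exists (maxn n0 n1) => p hp.
have h1 : F p <= r by apply: hr; apply: coneS hp; [lra|lra|exact: leq_maxl].
have h2 : inf A <= F p.
  apply: ge_inf => //; apply: hn1; apply: coneS hp; [lra|lra|exact: leq_maxr].
by rewrite /= distrC ger0_norm; lra.
Qed.

Lemma cone_swap t1 t2 n0 p : cone t1 t2 n0 (swap2 p) = cone (1 - t2) (1 - t1) n0 p :> bool.
Proof.
rewrite /cone /swap2 /= [p.2 + p.1]addrC !intrD.
move: (p.1%:~R : R) (p.2%:~R : R) => x y.
rewrite andbCA; congr [&& _, _ & _]; rewrite andbC; congr andb; apply/idP/idP; nra.
Qed.

Lemma ordered_lim F xi s : ordered_fun F -> 0 < xi < 1 -> exists l : R, F @ side s xi --> l.
Proof.
case: s => oF x01; first exact: ordered_right_lim.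
(* Reflection reverses the order of directions and the sign restores the order of values, so left
   limits are right limits of this function. *)
have oF' : ordered_fun (fun p => - F (swap2 p)).
  move=> t t' t0 tt' t1; have [n0 h] := oF (1 - t') (1 - t) ltac:(lra) ltac:(lra) ltac:(lra).
  exists n0 => p p' hp hp'; rewrite lerN2; apply: h; rewrite cone_swap.
    by rewrite subr0 opprB addrC subrK.
  by rewrite subrr opprB addrC subrK.
have [|l hl] := @ordered_right_lim _ (1 - xi) oF'; first by lra.
exists (- l); apply/cvgrPdist_lt => eps eps0.
move/cvgrPdist_lt : hl => /(_ eps eps0)[e e0 h].
exists e => // eta0 he; have [n0 hn0] := h eta0 he; exists n0 => p hp.
have := hn0 (swap2 p); rewrite /= cone_swap.
have -> : 1 - (1 - xi + e) = xi - e by ring.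
have -> : 1 - (1 - xi + eta0) = xi - eta0 by ring.
move=> /(_ hp); have -> : swap2 (swap2 p) = p by case: (p).
have -> : - l - F p = - (l - - F p) by ring.
by rewrite normrN.
Qed.

Lemma side_left s xi t n0 : 0 < xi < 1 -> xi < t -> side s xi [set p | cone 0 t n0 p].
Proof.
move=> /andP[x0 x1] xt; have m1 : Num.min xi (t - xi) <= xi by rewrite ge_min lexx.
have m2 : Num.min xi (t - xi) <= t - xi by rewrite ge_min lexx orbT.
exists (Num.min xi (t - xi)); first by rewrite lt_min x0 subr_gt0.
move: (Num.min xi (t - xi)) m1 m2 => m m1 m2 eta0 /andP[e0 em]; exists n0 => p.
by case: s => hp; apply: coneS hp => //; lra.
Qed.

Lemma side_right s xi t n0 : 0 < xi < 1 -> t < xi -> side s xi [set p | cone t 1 n0 p].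
Proof.
move=> /andP[x0 x1] xt; have m1 : Num.min (1 - xi) (xi - t) <= 1 - xi by rewrite ge_min lexx.
have m2 : Num.min (1 - xi) (xi - t) <= xi - t by rewrite ge_min lexx orbT.
exists (Num.min (1 - xi) (xi - t)); first by rewrite lt_min !subr_gt0 x1.
move: (Num.min (1 - xi) (xi - t)) m1 m2 => m m1 m2 eta0 /andP[e0 em]; exists n0 => p.
by case: s => hp; apply: coneS hp => //; lra.
Qed.

Lemma ordered_lim_lt F xi zeta s s' (l l' : R) : ordered_fun F -> 0 < xi < 1 -> 0 < zeta < 1 ->
  F @ side s xi --> l -> F @ side s' zeta --> l' -> xi < zeta -> l <= l'.
Proof.
move=> oF x01 z01 hl hl' xz; apply/ler_addgt0Pr => eps eps0.
have e2 : 0 < eps / 2 by rewrite divr_gt0.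
have [pf pf'] := (side_proper s x01, side_proper s' z01).
move: (x01) (z01) => /andP[x0 _] /andP[_ z1].
have h1 : xi < xi + (zeta - xi) / 3 by lra.
have h2 : xi + 2 * (zeta - xi) / 3 < zeta by lra.
have [n0 hn0] := oF (xi + (zeta - xi) / 3) (xi + 2 * (zeta - xi) / 3)
  ltac:(lra) ltac:(lra) ltac:(lra).
move/cvgrPdist_lt : hl => /(_ _ e2) hl; move/cvgrPdist_lt : hl' => /(_ _ e2) hl'.
have [p [/= cp hp]] := filter_ex (filterI (side_left s n0 x01 h1) hl).
have [p' [/= cp' hp']] := filter_ex (filterI (side_right s' n0 z01 h2) hl').
have := hn0 p p' cp cp'.
move: (F p) (F p') hp hp' => y y'; rewrite !ltr_norml => /andP[A B] /andP[C D].
by clear -A B C D; lra.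
Qed.

(** The two sides of [xi] are not separated by cones, so a direction slightly to the right is
    inserted: its limit dominates the left limit and is close to the right one. *)
Lemma ordered_lim_le F xi (l l' : R) : ordered_fun F -> 0 < xi < 1 ->
  F @ side false xi --> l -> F @ side true xi --> l' -> l <= l'.
Proof.
move=> oF x01 hl hl'; apply/ler_addgt0Pr => eps eps0.
have e2 : 0 < eps / 2 by rewrite divr_gt0.
move/cvgrPdist_lt : hl' => /(_ _ e2)[eta eta0 h].
move: (x01) => /andP[x0 x1].
have m0 : 0 < Num.min eta (1 - xi) by rewrite lt_min eta0 subr_gt0.
have m1 : Num.min eta (1 - xi) <= eta by rewrite ge_min lexx.
have m2 : Num.min eta (1 - xi) <= 1 - xi by rewrite ge_min lexx orbT.
pose z := xi + Num.min eta (1 - xi) / 2.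
have xz : xi < z by rewrite /z; lra.
have z01 : 0 < z < 1 by rewrite /z; lra.
have [lz hz] := ordered_lim true oF z01.
have pf := side_proper true z01.
have hP : side true z [set p | `|l' - F p| < eps / 2].
  apply: (@side_nearby R true true xi z eta) => //.
  by rewrite /z; lra.
have lez := ordered_lim_lt oF x01 z01 hl hz xz.
move/cvgrPdist_lt : hz => /(_ _ e2) hz.
have [p [/= hp hp']] := filter_ex (filterI hz hP).
move: (F p) hp hp' => y; rewrite !ltr_norml => /andP[A B] /andP[C D].
by clear -lez A B C D; lra.
Qed.

(** Points in a narrow cone around [xi] are squeezed between one point on its right and one on its
    left, where the one-sided limits apply. *)
Lemma ordered_around F xi (l : R) : ordered_fun F -> 0 < xi < 1 ->
  F @ side true xi --> l -> F @ side false xi --> l -> F @ around xi --> l.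
Proof.
move=> oF /andP[x0 x1] h1 h2; apply/cvgrPdist_lt => eps eps0.
move/cvgrPdist_lt : h1 => /(_ _ eps0)[e e0 h].
move/cvgrPdist_lt : h2 => /(_ _ eps0)[e' e'0 h'].
have [m [m0 [me me'] [mx mx']]] : exists m : R, [/\ 0 < m, m <= e /\ m <= e' &
    m <= xi /\ m <= 1 - xi].
  exists (Num.min (Num.min e e') (Num.min xi (1 - xi))).
  by rewrite !lt_min e0 e'0 x0 subr_gt0 x1 !ge_min !lexx !orbT.
have [z01 z01'] : 0 < xi + m / 2 < 1 /\ 0 < xi - m / 2 < 1.
  by clear -m0 mx mx' x0 x1; split; lra.
have P1 : side true (xi + m / 2) [set p | `|l - F p| < eps].
  by apply: (@side_nearby R true true xi _ e) => //; clear -m0 me; lra.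
have P2 : side true (xi - m / 2) [set p | `|l - F p| < eps].
  by apply: (@side_nearby R false true xi _ e') => //; clear -m0 me'; lra.
have [n3 hn3] : exists n3, forall p p', cone 0 (xi + m / 8) n3 p ->
    cone (xi + m / 4) 1 n3 p' -> F p <= F p'.
  by apply: oF; clear -m0 mx mx' x0 x1; lra.
have [n4 hn4] : exists n3, forall p p', cone 0 (xi - m / 4) n3 p ->
    cone (xi - m / 8) 1 n3 p' -> F p <= F p'.
  by apply: oF; clear -m0 mx mx' x0 x1; lra.
have d1 : xi + m / 4 < xi + m / 2 by clear -m0; lra.
have d2 : xi - m / 2 < xi - m / 4 by clear -m0; lra.
have [pf pf'] := (side_proper true z01, side_proper true z01').
have [q [/= cq hq]] := filter_ex (filterI (side_right true n3 z01 d1) P1).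
have [q' [/= cq' hq']] := filter_ex (filterI (side_left true n4 z01' d2) P2).
exists (m / 8); first by rewrite divr_gt0.
exists (maxn n3 n4) => p cp.
have b1 : F p <= F q.
  by apply: hn3 cq; apply: coneS cp; [clear -mx m0; lra|lra|exact: leq_maxl].
have b2 : F q' <= F p.
  by apply: hn4 cq' _; apply: coneS cp; [lra|clear -mx' m0; lra|exact: leq_maxr].
move: (F p) (F q) (F q') b1 b2 hq hq' => y y1 y2 b1 b2.
rewrite /= !ltr_norml => /andP[A B] /andP[C D].
by clear -b1 b2 A B C D; apply/andP; split; lra.
Qed.

End ordered_functions.

(** * Busemann limits of an ordered environment *)

Section busemann.
Context {R : realType}.
Local Notation E := (@envT R).
Implicit Types (w : Z2 -> R * R) (x y z p : Z2) (s b : bool) (xi zeta : R * R).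

Definition delta w x y p : R := passage_time w x p - passage_time w y p.

(** The denominator [k.+2] keeps every term strictly between 0 and 1 when [t] is. *)
Definition one_sided s (t : R) (k : nat) : R :=
  if s then t + (1 - t) / k.+2%:R else t - t / k.+2%:R.

(* The reference points are taken relative to x, which makes bus exactly
   translation covariant and a function of the weights above x or y. *)
Definition bus s xi x y w : R :=
  fine (limn_esup (fun k => limn_esup (fun n =>
    (delta w x y (x + vdir (one_sided s xi.1 k) n))%:E))).

Definition star w := forall x,
  ordered_fun (fun p => incr true w x p) /\ ordered_fun (fun p => - incr false w x p).

Lemma limn_esup_between (u : (\bar R)^nat) (l r : R) N :
  (forall n, (N <= n)%N -> (l%:E <= u n <= r%:E)%E) ->
  (l%:E <= limn_esup u <= r%:E)%E.
Proof.
move=> h; rewrite limn_esup_lim; have /cvg_lim -> // := @cvg_esups_inf _ u.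
apply/andP; split.
  apply: le_ereal_inf_tmp => _ [n _ <-].
  have /andP[h1 _] := h (maxn N n) (leq_maxl _ _).
  apply: le_trans h1 _; apply: ereal_sup_ubound; exists (maxn N n) => //=.
  exact: leq_maxr.
apply: (@le_trans _ _ (esups u N)); first by apply: ereal_inf_lbound; exists N.
by apply: ge_ereal_sup => _ [n /= Nn <-]; have /andP[] := h n Nn.
Qed.

Lemma bus_lim w s xi x y (l : R) : inU xi -> delta w x y @ side s xi.1 --> l ->
  bus s xi x y w = l.
Proof.
move=> /andP[/andP[x0 x1] _] hl; rewrite /bus.
set u := fun k => limn_esup _.
suff : limn_esup u = l%:E by move=> ->.
have key (eps : R) : 0 < eps -> ((l - eps)%:E <= limn_esup u <= (l + eps)%:E)%E.
  move=> eps0; move/cvgrPdist_lt : hl => /(_ _ eps0)[eta eta0 h].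
  have [K hK] := archi_mul 1 eta0.
  apply: (@limn_esup_between u _ _ K) => k kK.
  have k2 : 0 < k.+2%:R :> R by rewrite ltr0n.
  have k21 : 1 <= k.+2%:R * eta by apply: hK; rewrite -addn2 (leq_trans kK) ?leq_addr.
  pose d : R := k.+2%:R^-1.
  have d0 : 0 < d by rewrite invr_gt0.
  have d1 : d < 1 by rewrite invf_lt1// ltr1n.
  have de : d <= eta by rewrite /d -[X in X <= _]mul1r ler_pdivrMr// mulrC.
  have [n0 hn0] : exists n0, forall p, cone
     (if s then xi.1 + (1 - xi.1) * d / 2 else xi.1 - eta)
     (if s then xi.1 + eta else xi.1 - xi.1 * d / 2) n0 p -> `|l - delta w x y p| < eps.
    by case: (s) h => h; apply: h; clear -x0 x1 d0 d1 de eta0; apply/andP; split; nra.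
  have t1 : 0 < one_sided s xi.1 k < 1.
    by rewrite /one_sided -/d; clear -x0 x1 d0 d1; case: s; apply/andP; split; nra.
  have [N hN] : exists N, forall n, (N <= n)%N -> cone
     (if s then xi.1 + (1 - xi.1) * d / 2 else xi.1 - eta)
     (if s then xi.1 + eta else xi.1 - xi.1 * d / 2) n0 (x + vdir (one_sided s xi.1 k) n).
    have m0 : 0 <= if s then xi.1 + (1 - xi.1) * d / 2 else xi.1 - xi.1 * (1 + d) / 2.
      by clear -x0 x1 d0 d1; case: s; nra.
    have m1 : (if s then xi.1 + (1 - xi.1) * d / 2 else xi.1 - xi.1 * (1 + d) / 2) < one_sided s xi.1 k.
      by rewrite /one_sided -/d; clear -x0 x1 d0 d1; case: s; nra.
    have m2 : one_sided s xi.1 k < if s then xi.1 + eta else xi.1 - xi.1 * d / 2.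
      by rewrite /one_sided -/d; clear -x0 x1 d0 d1 de; case: s; nra.
    have [||||N hN] := @vdir_cone R (if s then xi.1 + (1 - xi.1) * d / 2 else
        Num.max (xi.1 - eta) (xi.1 - xi.1 * (1 + d) / 2)) (one_sided s xi.1 k)
       (if s then xi.1 + eta else xi.1 - xi.1 * d / 2) x n0 => //.
    - by case: (s) m0 => // m0; rewrite le_max m0 orbT.
    - case: (s) m1 => // m1; rewrite gt_max m1 andbT /one_sided -/d.
      by clear -x0 x1 d0 d1 de; nra.
    exists N => n /hN; apply: coneS => //.
    by case: (s) => //; rewrite le_max lexx.
  apply: (@limn_esup_between _ _ _ N) => n /hN/hn0.
  by rewrite ltr_norml !lee_fin => /andP[A B]; clear -A B; apply/andP; split; lra.
apply/eqP; rewrite eq_le; apply/andP; split.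
  by apply/lee_addgt0Pr => eps eps0; have /andP[_] := key eps eps0; rewrite EFinD.
apply/lee_addgt0Pr => eps eps0.
by have /andP[h _] := key eps eps0; rewrite -leeBlDr// -EFinB.
Qed.

Lemma bus_shift s xi x y z w : bus s xi (x + z) (y + z) w = bus s xi x y (shift_env z w).
Proof.
rewrite /bus; congr (fine (limn_esup _)); apply/funext => k.
congr (limn_esup _); apply/funext => n; congr EFin.
by rewrite /delta !pt_shift [x + vdir _ _ + z]addrAC.
Qed.

Lemma measurable_bus d (T : measurableType d) (W : T -> Z2 -> R * R) s xi x y :
  (forall z, le2 x z || le2 y z -> measurable_fun setT (fun t => W t z)) ->
  measurable_fun setT (fun t => bus s xi x y (W t)).
Proof.
move=> mW; apply: measurableT_comp; first exact: fine_measurable.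
apply: measurable_fun_limn_esup => k; apply: measurable_fun_limn_esup => n.
apply/measurable_EFinP; apply: measurable_funB; apply: measurable_pt => z h _ _;
  by apply: mW; rewrite h ?orbT.
Qed.

Opaque bus.

Lemma delta_xx w x : delta w x x = fun=> 0.
Proof. by apply/funext => p; rewrite /delta subrr. Qed.

Lemma delta_split w x y z : delta w x y = fun p => delta w x z p + delta w z y p.
Proof. by apply/funext => p; rewrite /delta; ring. Qed.

Lemma delta_opp w x y : delta w x y = fun p => - delta w y x p.
Proof. by apply/funext => p; rewrite /delta opprB. Qed.

Lemma delta_step w x b : delta w x (x + step b) = fun p => incr b w x p.
Proof. by []. Qed.

(* Limits of increments along lattice steps determine all limits. *)
Lemma delta_cvg_gen w (F : set_system Z2) (FF : Filter F) :
  (forall x b, exists l : R, delta w x (x + step b) @ F --> l) ->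
  forall x y, exists l : R, delta w x y @ F --> l.
Proof.
move=> h x y.
have hp z t : exists l : R, delta w z (path_end z t) @ F --> l.
  elim: t z => [|b t IH] z; first by rewrite path_end0 delta_xx; exists 0; exact: cvg_cst.
  rewrite path_end_cons (delta_split w _ _ (z + step b)).
  have [l1 h1] := h z b; have [l2 h2] := IH (z + step b).
  by exists (l1 + l2); exact: cvgD.
pose z : Z2 := (Num.min x.1 y.1, Num.min x.2 y.2).
have [t1 <-] : exists t, path_end z t = x.
  by apply: path_exists; rewrite /le2 /= !ge_min !lexx.
have [t2 <-] : exists t, path_end z t = y.
  by apply: path_exists; rewrite /le2 /= !ge_min !lexx !orbT.
have [l1 h1] := hp z t1; have [l2 h2] := hp z t2.
exists (- l1 + l2); rewrite (delta_split w _ _ z) (delta_opp w _ z).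
by apply: cvgD => //; exact: cvgN.
Qed.

Lemma bus_xx s xi x w : inU xi -> bus s xi x x w = 0.
Proof. by move=> hxi; apply: bus_lim => //; rewrite delta_xx; exact: cvg_cst. Qed.

Section star_env.
Variable w : Z2 -> R * R.
Hypothesis sw : star w.

Lemma bus_cvg s xi x y : inU xi -> delta w x y @ side s xi.1 --> bus s xi x y w.
Proof.
move=> hxi; have x01 : 0 < xi.1 < 1 by case/andP: hxi.
have [l hl] : exists l : R, delta w x y @ side s xi.1 --> l.
  apply: (@delta_cvg_gen w _ _) => z b; rewrite delta_step.
  have [ua ub] := sw z; case: b; first exact: ordered_lim.
  have [l hl] := ordered_lim s ub x01; exists (- l).
  have -> : (fun p => incr false w z p) = (fun p => - - incr false w z p).
    by apply/funext => p; rewrite opprK.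
  exact: (cvgN hl).
by rewrite (bus_lim hxi hl).
Qed.

Lemma bus_cocycle s xi x y z : inU xi -> bus s xi x y w = bus s xi x z w + bus s xi z y w.
Proof.
move=> hxi; have x01 : 0 < xi.1 < 1 by case/andP: hxi.
apply: bus_lim => //; rewrite (delta_split w _ _ z).
by apply: cvgD; exact: bus_cvg.
Qed.

Lemma min_close (a0 a1 a2 c1 c2 d1 d2 eps : R) : a0 = Num.min (d1 + a1) (d2 + a2) ->
  `|c1 - (a0 - a1)| < eps -> `|c2 - (a0 - a2)| < eps ->
  `|Num.min (d1 - c1) (d2 - c2)| <= eps.
Proof.
move=> e; rewrite !ltr_norml ler_norml => /andP[A B] /andP[C D]; move: e.
by case: (lerP (d1 + a1) (d2 + a2)) => h; case: (lerP (d1 - c1) (d2 - c2)) => h' e;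
  apply/andP; split; lra.
Qed.

Lemma bus_min s xi x : inU xi ->
  Num.min ((w (x + e1)).1 - bus s xi x (x + e1) w) ((w (x + e2)).2 - bus s xi x (x + e2) w) = 0.
Proof.
move=> hxi; have x01 : 0 < xi.1 < 1 by case/andP: hxi.
have pf := side_proper s x01.
apply/eqP; rewrite -normr_le0; apply/ler_addgt0Pr => eps eps0; rewrite add0r.
have /cvgrPdist_lt/(_ _ eps0) h1 := @bus_cvg s xi x (x + step true) hxi.
have /cvgrPdist_lt/(_ _ eps0) h2 := @bus_cvg s xi x (x + step false) hxi.
have far := side_far s xi.1 (absz x.1 + absz x.2 + 1).
have [p [[/= g1 g2] [/= f1 f2]]] := filter_ex (filterI (filterI h1 h2) far).
have l1 : le2 (x + e1) p by clear -f1 f2; rewrite /le2 /=; lia.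
have l2 : le2 (x + e2) p by clear -f1 f2; rewrite /le2 /=; lia.
exact: (min_close (pt_start_min w l1 l2) g1 g2).
Qed.

Lemma bus_le_step xi x :
  inU xi -> bus false xi x (x + e1) w <= bus true xi x (x + e1) w /\
            bus true xi x (x + e2) w <= bus false xi x (x + e2) w.
Proof.
move=> hxi; have x01 : 0 < xi.1 < 1 by case/andP: hxi.
have [ua ub] := sw x; split.
  exact: (ordered_lim_le ua x01 (@bus_cvg false xi x (x + step true) hxi)
    (@bus_cvg true xi x (x + step true) hxi)).
rewrite -lerN2; apply: (ordered_lim_le ub x01).
  exact: (cvgN (@bus_cvg false xi x (x + step false) hxi)).
exact: (cvgN (@bus_cvg true xi x (x + step false) hxi)).
Qed.

Lemma bus_lt_step s s' xi zeta x : inU xi -> inU zeta -> xi.1 < zeta.1 ->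
  bus s xi x (x + e1) w <= bus s' zeta x (x + e1) w /\
  bus s' zeta x (x + e2) w <= bus s xi x (x + e2) w.
Proof.
move=> hxi hz xz; have x01 : 0 < xi.1 < 1 by case/andP: hxi.
have z01 : 0 < zeta.1 < 1 by case/andP: hz.
have [ua ub] := sw x; split.
  exact: (ordered_lim_lt ua x01 z01 (@bus_cvg s xi x (x + step true) hxi)
    (@bus_cvg s' zeta x (x + step true) hz) xz).
rewrite -lerN2; apply: (ordered_lim_lt ub x01 z01 _ _ xz).
  exact: (cvgN (@bus_cvg s xi x (x + step false) hxi)).
exact: (cvgN (@bus_cvg s' zeta x (x + step false) hz)).
Qed.

Lemma dist_half (a b u eps : R) : `|a - u| < eps / 2 -> `|b - u| < eps / 2 -> `|b - a| < eps.
Proof. by rewrite !ltr_norml => /andP[A B] /andP[C D]; apply/andP; split; lra. Qed.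

(** An estimate for the limit at [xi] holds on all cones of one side, hence for the limits at nearby
    [zeta]. The sign [s'] is free, so this covers limits through U0 as well as those of both
    families. *)
Lemma bus_near s xi x y (eps : R) : inU xi -> 0 < eps -> exists2 del : R, 0 < del &
  forall s' zeta, inU zeta ->
    (if s then xi.1 < zeta.1 < xi.1 + del else xi.1 - del < zeta.1 < xi.1) ->
    `|bus s' zeta x y w - bus s xi x y w| < eps.
Proof.
move=> hxi eps0; have e2 : 0 < eps / 2 by rewrite divr_gt0.
have /cvgrPdist_lt/(_ _ e2)[del del0 h] := @bus_cvg s xi x y hxi.
exists del => // s' zeta hz hd.
have z01 : 0 < zeta.1 < 1 by case/andP: hz.
have pf := side_proper s' z01.
have hP := @side_nearby R s s' xi.1 zeta.1 del _ del0 h hd.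
have /cvgrPdist_lt/(_ _ e2) h' := @bus_cvg s' zeta x y hz.
have [p [/= g1 g2]] := filter_ex (filterI hP h').
exact: dist_half g1 g2.
Qed.

(** These directions form the random set U0 of the theorem. *)
Definition cont_dir xi := inU xi /\ forall x y, bus true xi x y w = bus false xi x y w.

Lemma cont_dir_step xi : inU xi ->
  (forall x b, bus true xi x (x + step b) w = bus false xi x (x + step b) w) -> cont_dir xi.
Proof.
move=> hxi h; split; [exact: hxi|move=> x y].
have hp z t : bus true xi z (path_end z t) w = bus false xi z (path_end z t) w.
  elim: t z => [|b t IH] z.
    by rewrite path_end0 !(bus_xx _ _ _ hxi).
  rewrite path_end_cons (@bus_cocycle true xi z _ (z + step b) hxi).
  by rewrite (@bus_cocycle false xi z _ (z + step b) hxi) h IH.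
pose z : Z2 := (Num.min x.1 y.1, Num.min x.2 y.2).
have [t1 et1] : exists t, path_end z t = x.
  by apply: path_exists; rewrite /le2 /= !ge_min !lexx.
have [t2 et2] : exists t, path_end z t = y.
  by apply: path_exists; rewrite /le2 /= !ge_min !lexx !orbT.
have := hp z t1; have := hp z t2; rewrite et1 et2.
rewrite (@bus_cocycle true xi z y x hxi) (@bus_cocycle false xi z y x hxi) => + e.
by rewrite e => /addrI.
Qed.

Lemma cont_dir_around xi x y : cont_dir xi -> delta w x y @ around xi.1 --> bus true xi x y w.
Proof.
move=> [hxi hc]; have x01 : 0 < xi.1 < 1 by case/andP: hxi.
have [l hl] : exists l : R, delta w x y @ around xi.1 --> l.
  apply: (@delta_cvg_gen w _ _) => z b.
  have [ua ub] := sw z; exists (bus true xi z (z + step b) w); case: b.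
    apply: (ordered_around ua x01); first exact: (@bus_cvg true xi z (z + step true)).
    by rewrite hc; exact: (@bus_cvg false xi z (z + step true)).
  rewrite delta_step.
  have -> : (fun p => incr false w z p) = (fun p => - - incr false w z p).
    by apply/funext => p; rewrite opprK.
  rewrite -[bus true xi _ _ w]opprK; apply: cvgN; apply: (ordered_around ub x01).
    exact: (cvgN (@bus_cvg true xi z (z + step false) hxi)).
  by rewrite hc; exact: (cvgN (@bus_cvg false xi z (z + step false) hxi)).
suff -> : bus true xi x y w = l by [].
apply: bus_lim => //; apply: cvg_trans hl; apply: cvg_app => P [e e0 [n0 h]].
by exists e => // eta0 he; exists n0 => p hp; apply: h; apply: coneS hp => //; clear -he e0; lra.
Qed.

(** The open intervals ]lo, hi[ are nonempty and pairwise disjoint; a rational chosen in each gives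
    an injection. *)
Lemma disjoint_gaps_countable (A : set (R * R)) (lo hi : R * R -> R) :
  (forall xi, A xi -> inU xi /\ lo xi < hi xi) ->
  (forall xi zeta, A xi -> A zeta -> xi.1 < zeta.1 -> hi xi <= lo zeta) -> countable A.
Proof.
move=> hA hlt.
have ex xi : exists q : rat, A xi -> lo xi < ratr q < hi xi.
  have [a|na] := pselect (A xi); last by exists 0.
  have [q /= hq] := rat_in_itvoo (hA xi a).2; exists q => _.
  by move: hq; rewrite in_itv.
have [f hf] := choice ex.
apply/countable_injP; exists (fun xi => pickle (f xi)) => xi zeta.
rewrite !inE => a1 a2 /(pcan_inj (@pickleK rat)) e.
have [i1 _] := hA _ a1; have [i2 _] := hA _ a2.
have /andP[l1 h1] := hf _ a1; have /andP[l2 h2] := hf _ a2; rewrite e in l1 h1.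
have [lt|lt|eq] := ltgtP xi.1 zeta.1.
- by exfalso; have hh := hlt _ _ a1 a2 lt; clear -hh l2 h1; lra.
- by exfalso; have hh := hlt _ _ a2 a1 lt; clear -hh l1 h2; lra.
- apply: injective_projections => //.
  by case/andP: i1 => _ /eqP ->; case/andP: i2 => _ /eqP ->; rewrite eq.
Qed.

Lemma cont_dir_cocountable : countable (Udir `\` [set xi | cont_dir xi]).
Proof.
(* The jumps of one increment are countable by monotonicity, and the cocycle property reduces all
   pairs (x,y) to the countably many lattice steps. *)
pose J (xb : Z2 * bool) := [set xi : R * R | inU xi /\
  bus true xi xb.1 (xb.1 + step xb.2) w <> bus false xi xb.1 (xb.1 + step xb.2) w].
have sub : Udir `\` [set xi | cont_dir xi] `<=` \bigcup_xb J xb.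
  move=> xi [hxi nc]; apply: contrapT => nJ; apply: nc; apply: (cont_dir_step hxi) => x b.
  apply: contrapT => ne; apply: nJ; exists (x, b); first exact: I.
  exact: (conj hxi ne).
apply: sub_countable (subset_card_le sub) _.
apply: bigcup_countable; first exact: countableP.
move=> [x b] _; rewrite /J /=; case: b => /=.
  apply: (@disjoint_gaps_countable _ (fun xi => bus false xi x (x + e1) w)
    (fun xi => bus true xi x (x + e1) w)).
    move=> xi [hxi ne]; split; first exact: hxi.
    rewrite lt_neqAle (bus_le_step x hxi).1 andbT; apply/eqP => e.
    exact: (ne (esym e)).
  by move=> xi zeta [hxi _] [hz _] xz; exact: (bus_lt_step true false x hxi hz xz).1.
apply: (@disjoint_gaps_countable _ (fun xi => - bus false xi x (x + e2) w)
    (fun xi => - bus true xi x (x + e2) w)).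
  move=> xi [hxi ne]; split; first exact: hxi.
  by rewrite ltrN2 lt_neqAle (bus_le_step x hxi).2 andbT; exact/eqP/ne.
by move=> xi zeta [hxi _] [hz _] xz; rewrite lerN2; exact: (bus_lt_step true false x hxi hz xz).2.
Qed.

End star_env.

Lemma star_pathwise (T : Type) (W : Z2 -> T -> R * R) (om : T) : star (env W om) ->
  busemann_pathwise W (fun om => [set xi | cont_dir (env W om) xi])
    (fun xi x y om => bus true xi x y (env W om))
    (fun s xi x y om => bus s xi x y (env W om)) om.
Proof.
move=> sw; split.
- by split; [move=> xi []|exact: cont_dir_cocountable].
- move=> xi hc x y v hv; have h : delta (env W om) x y @ around xi.1 --> bus true xi x y (env W om).
    exact: cont_dir_around.
  exact: (@cvg_comp _ _ _ v (delta (env W om) x y) _ _ _ (to_dir_around hc.1 hv) h).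
- move=> xi hxi x y; split=> eps eps0.
    have [del del0 h] := bus_near sw true x y hxi eps0.
    by exists del => [|zeta [hz _] hd]; [exact: del0|exact: h].
  have [del del0 h] := bus_near sw false x y hxi eps0.
  by exists del => [|zeta [hz _] hd]; [exact: del0|exact: h].
- split.
  + by move=> s xi hxi x y z; exact: bus_cocycle.
  + by move=> s xi hxi x; exact: bus_min.
  + move=> xi zeta hxi hz xz x; split; apply/andP; split.
    * exact: (bus_le_step sw x hxi).1.
    * exact: (bus_lt_step sw true false x hxi hz xz).1.
    * exact: (bus_lt_step sw true false x hxi hz xz).2.
    * exact: (bus_le_step sw x hxi).2.
  + move=> xi zn x y hxi hzn; split=> -[_ [hlt hcv]] s; apply/cvgrPdist_lt => eps eps0.
      have [del del0 h] := bus_near sw true x y hxi eps0.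
      move/cvgrPdist_lt : hcv => /(_ _ del0); apply: filterS => n; rewrite ltr_norml => /andP[A B].
      rewrite distrC; apply: h; first exact: hzn.
      by rewrite hlt /=; clear -A B; lra.
    have [del del0 h] := bus_near sw false x y hxi eps0.
    move/cvgrPdist_lt : hcv => /(_ _ del0); apply: filterS => n; rewrite ltr_norml => /andP[A B].
    rewrite distrC; apply: h; first exact: hzn.
    by rewrite hlt andbT; clear -A B; lra.
  + move=> xi hc x y; have [hxi hcc] := hc; split; [exact: (Logic.eq_refl _)|exact/esym/hcc|move=> eps eps0].
    have [d1 d10 h1] := bus_near sw true x y hxi eps0.
    have [d2 d20 h2] := bus_near sw false x y hxi eps0.
    exists (Num.min d1 d2); first by rewrite lt_min d10.
    move=> zeta [hz _]; rewrite lt_min => /andP[n1 n2].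
    have /andP[A B] : - d1 < zeta.1 - xi.1 < d1 by rewrite -ltr_norml.
    have /andP[C D] : - d2 < zeta.1 - xi.1 < d2 by rewrite -ltr_norml.
    have [lt|lt|eq] := ltgtP xi.1 zeta.1.
    * by apply: (h1 _ _ hz); rewrite lt /=; clear -A B; lra.
    * by rewrite [bus true xi x y _]hcc; apply: (h2 _ _ hz); rewrite lt andbT; clear -C D; lra.
    * have -> : zeta = xi.
        apply: injective_projections => //.
        by case/andP: hxi => _ /eqP ->; case/andP: hz => _ /eqP ->; rewrite eq.
      by rewrite subrr normr0.
Qed.

End busemann.

(** * Almost every environment is ordered *)

(** A cone of slope [t] at the origin lies in the wider cone of slope k/n at the point (c,d) once a
    + b is large: the bounded translation is absorbed by the gap k - t n. *)
Lemma shift_left_arith {R : realType} (a b c d n k X t : R) :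
  0 < k < n -> `|c| + `|d| <= X - 1 ->
  a <= t * (a + b) -> X * n <= (a + b) * (k - t * n) -> (a - c) * (n - k) <= k * (b - d - 1).
Proof.
move=> /andP[k0 kn] xx h1 h2.
have q1 : a * n <= t * (a + b) * n by rewrite ler_pM2r//; lra.
have g1 : - `|c| * n <= c * (n - k).
  apply: le_trans (_ : - `|c| * (n - k) <= _).
    by have := normr_ge0 c; nra.
  by rewrite ler_pM2r ?subr_gt0// lerNl -normrN ler_norm.
have g2 : k * (d + 1) <= n * (`|d| + 1).
  apply: le_trans (_ : k * (`|d| + 1) <= _).
    by rewrite ler_pM2l// lerD2r ler_norm.
  by have := normr_ge0 d; nra.
have g3 : n * (`|c| + `|d| + 1) <= n * X by rewrite ler_pM2l; lra.
by nra.
Qed.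

Lemma shift_right_arith {R : realType} (a b c d n k X t : R) :
  0 < k < n -> `|c| + `|d| <= X - 1 ->
  t * (a + b) <= a -> X * n <= (a + b) * (t * n - k) -> (b - d) * k <= (n - k) * (a - c - 1).
Proof.
move=> /andP[k0 kn] xx h1 h2.
have q1 : t * (a + b) * n <= a * n by rewrite ler_pM2r//; lra.
have g1 : - `|d| * n <= d * k.
  apply: le_trans (_ : - `|d| * k <= _).
    by have := normr_ge0 d; nra.
  by rewrite ler_pM2r// lerNl -normrN ler_norm.
have g2 : (n - k) * (c + 1) <= n * (`|c| + 1).
  apply: le_trans (_ : (n - k) * (`|c| + 1) <= _).
    by rewrite ler_pM2l ?subr_gt0// lerD2r ler_norm.
  by have := normr_ge0 c; nra.
have g3 : n * (`|c| + `|d| + 1) <= n * X by rewrite ler_pM2l; lra.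
by nra.
Qed.

Section almost_sure.
Context {R : realType}.
Local Notation E := (@envT R).

Lemma incr_shift b (w : E) x p : incr b (shift_env x w) 0 (p - x) = incr b w x p.
Proof. by rewrite /incr !pt_shift subrK !add0r [step b + x]addrC. Qed.

Definition sep (q : nat * nat) := ((0 < q.1) && (q.1 + 3 <= q.2))%N.

(* Directions q.1/q.2, (q.1+1)/q.2 and (q.1+2)/q.2 in (0,1). *)
Definition bad_dir (q : nat * nat) : set E :=
  if sep q then star_null q.1 (q.2 - q.1) (q.2 - q.1 - 2) (q.1 + 2) else set0.

Definition bad_env : set E :=
  \bigcup_(xq : Z2 * (nat * nat)) (shift_env xq.1 @^-1` bad_dir xq.2).

Lemma measurable_bad_dir q : measurable (bad_dir q).
Proof. by rewrite /bad_dir; case: ifP => // _; exact: measurable_star_null. Qed.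

Lemma measurable_shift_pre z (A : set E) : measurable A -> measurable (shift_env z @^-1` A : set E).
Proof. by move=> mA; rewrite -[X in measurable X]setTI; exact: measurable_shift_env. Qed.

Lemma measurable_bad_env : measurable bad_env.
Proof.
apply: countable_bigcupT_measurable; first exact: countableP.
by move=> xq; apply: measurable_shift_pre; exact: measurable_bad_dir.
Qed.

Lemma null_countable_bigcup d (T : measurableType d) (I : countType) (Q : probability T R)
    (F : I -> set T) :
  (forall i, measurable (F i)) -> (forall i, Q (F i) = 0%E) -> Q (\bigcup_i F i) = 0%E.
Proof.
move=> mF F0; have mU : measurable (\bigcup_i F i).
  by apply: countable_bigcupT_measurable; first exact: countableP.
pose G n := if unpickle n is Some i then F i else set0.
apply: measure_negligible => //; apply: (@negligibleS _ _ _ _ (\bigcup_n G n)).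
  by move=> w [i _ Fi]; exists (pickle i) => //; rewrite /G pickleK.
apply: negligible_bigcup => n; rewrite /G; case: unpickle => [i|]; last exact: negligible_set0.
exists (F i); split; [exact: mF|exact: F0|exact: subset_refl].
Qed.

Lemma bad_env0 (Q : probability E R) ell : percolation Q ell -> Q bad_env = 0%E.
Proof.
move=> H; have QL := perc_site H; apply: null_countable_bigcup => -[x [m N]].
  by apply: measurable_shift_pre; exact: measurable_bad_dir.
rewrite /= QL.1; last exact: measurable_bad_dir.
rewrite /bad_dir; case: ifP => [/andP[/= m0 mN]|_]; last exact: measure0.
(* The middle direction (m+1)/N is the separating ray. *)
apply: (@star_null0 R Q ell H _ _ _ _ m.+1 (N - m.+1)); clear -m0 mN; nia.
Qed.

Lemma star_of_good (w : E) : ~ bad_env w -> star w.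
Proof.
move=> nb x.
have key (t t' : R) : 0 < t -> t < t' -> t' < 1 -> exists n0, forall p p',
    cone 0 t n0 p -> cone t' 1 n0 p' ->
    incr true w x p <= incr true w x p' /\ incr false w x p' <= incr false w x p.
  move=> t0 tt' t1.
  (* If N (t' - t) >= 4, three consecutive multiples of 1/N fit strictly between [t] and [t']: the
     edges of the two cones and the ray between them. *)
  have [N [m [m0 h1 h2 mN]]] : exists N m, [/\ (0 < m)%N, t * N%:R < m%:R,
      m.+2%:R < t' * N%:R & (m + 3 <= N)%N].
    have d0 : 0 < t' - t by rewrite subr_gt0.
    have [N hN] := archi_mul 4 d0; exists N, (Num.truncn (t * N%:R)).+1.
    have hN' := hN N (leqnn _).
    have tN : 0 <= t * N%:R by rewrite mulr_ge0// ltW.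
    have h1 : t * N%:R < (Num.truncn (t * N%:R)).+1%:R by exact: truncnS_gt.
    have h2 : (Num.truncn (t * N%:R))%:R <= t * N%:R by rewrite truncn_le.
    have h3 : (Num.truncn (t * N%:R)).+1.+2%:R < t' * N%:R.
      rewrite -addn3 natrD; move: (Num.truncn _)%:R h2 => k; clear -hN' t0; nra.
    split=> //.
    have : (Num.truncn (t * N%:R)).+1.+2%:R < N%:R :> R.
      apply: lt_le_trans h3 _; rewrite ler_piMl//; exact: ltW.
    by rewrite ltr_nat; move: (Num.truncn _) => k; clear; lia.
  have sq : sep (m, N) by rewrite /sep /= m0.
  have : ~ star_null m (N - m) (N - m - 2) (m + 2) (shift_env x w).
    by move=> hs; apply: nb; exists (x, (m, N)) => //=; rewrite /bad_dir sq.
  rewrite /star_null => /existsNP[n0 /not_implyP[_ hn0]].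
  have ok (p p' : Z2) : cone_pair m (N - m) (N - m - 2) (m + 2) n0 (p - x) (p' - x) ->
      incr true w x p <= incr true w x p' /\ incr false w x p' <= incr false w x p.
    move=> cp; apply: contrapT => no; apply: hn0.
    pose i1 : int := (p - x).2; pose i2 : int := (p' - x).1.
    exists (absz i1 + absz i2)%N; first exact: I.
    exists (p - x, p' - x); first exact: I.
    split; [exact: cp|split; [|split]] => /=.
    - by rewrite -[X in X <= _]/i1; move: i1 i2; clear; lia.
    - by rewrite -[X in X <= _]/i2; move: i1 i2; clear; lia.
    by rewrite /ordered !incr_shift.
  pose X : R := (absz x.1 + absz x.2 + 1)%:R.
  have X0 : 0 < X by rewrite ltr0n addn1.
  have dm : 0 < m%:R - t * N%:R by rewrite subr_gt0.
  have dm' : 0 < t' * N%:R - m.+2%:R by rewrite subr_gt0.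
  have [n1 hn1] := archi_mul (X * N%:R) dm; have [n2 hn2] := archi_mul (X * N%:R) dm'.
  exists (n0 + n1 + n2 + absz x.1 + absz x.2 + 2)%N => p p' /and4P[c1 c2 _ c3] /and4P[c1' c2' c3' _].
  apply: ok.
  have na (z : int) : `|z%:~R| = (absz z)%:R :> R by rewrite -intr_norm natr_absz.
  have xx : `|x.1%:~R| + `|x.2%:~R| <= X - 1 :> R by rewrite !na /X !natrD addrK.
  have s1 : X * N%:R <= (p.1 + p.2)%:~R * (m%:R - t * N%:R).
    apply: le_trans (hn1 n1 (leqnn _)) _; rewrite ler_pM2r// pmulrn ler_int.
    by clear -c1 c2; lia.
  have s2 : X * N%:R <= (p'.1 + p'.2)%:~R * (t' * N%:R - m.+2%:R).
    apply: le_trans (hn2 n2 (leqnn _)) _; rewrite ler_pM2r// pmulrn ler_int.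
    by clear -c1' c2'; lia.
  have NR : 0 < N%:R :> R by rewrite ltr0n; clear -mN; lia.
  have mNR : m%:R + 3 <= N%:R :> R by rewrite -natrD ler_nat.
  have mR : 0 < m%:R :> R by rewrite ltr0n.
  rewrite /cone_pair; apply/and5P; split; last (apply/andP; split).
  - by rewrite /=; clear -c1; lia.
  - by rewrite /=; clear -c2; lia.
  - by rewrite /=; clear -c1'; lia.
  - by rewrite /=; clear -c2'; lia.
  - rewrite -(ler_int R) !intrM -!pmulrn natrB ?(leq_trans _ mN) ?leq_addr//.
    rewrite /= !(intrD, intrN) /=; move: c3 s1; rewrite intrD.
    by apply: shift_left_arith => //; clear -mNR mR; lra.
  - rewrite -(ler_int R) !intrM -!pmulrn -subnDA natrB; last by clear -mN; lia.
    rewrite natrD /= !(intrD, intrN) /=; move: c3' s2; rewrite -[m.+2]addn2 !natrD intrD.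
    by apply: shift_right_arith => //; clear -mNR mR; lra.
split=> t t' t0 tt' t1; have [n0 h] := key t t' t0 tt' t1; exists n0 => p p' hp hp'.
  exact: (h p p' hp hp').1.
by rewrite lerN2; exact: (h p p' hp hp').2.
Qed.

End almost_sure.

(** * Means of the Busemann limits *)

Lemma measurable_lt_set {R : realType} d (T : measurableType d) (f g : T -> R) :
  measurable_fun setT f -> measurable_fun setT g -> measurable [set x | f x < g x].
Proof.
move=> mf mg.
rewrite (_ : [set x | _] = setT `&` (fun x => g x - f x) @^-1` `]0, +oo[%classic); last first.
  by apply/seteqP; split=> x /=; rewrite in_itv /= andbT subr_gt0 => // -[].
exact: (measurable_funB mg mf).
Qed.

(** * Comparison of expectations off a null set *)

Section almost_everywhere.
Context {R : realType} {d : measure_display} {T : measurableType d}.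
Variables (Q : probability T R) (N : set T).
Hypotheses (mN : measurable N) (N0 : Q N = 0%E).

Lemma Ex_le_off f g : intg Q f -> intg Q g -> (forall x, ~ N x -> f x <= g x) ->
  Ex Q f <= Ex Q g.
Proof.
move=> hf hg fg; rewrite -lee_fin -!ExE//.
rewrite (negligible_integral mN measurableT hf N0) (negligible_integral mN measurableT hg N0).
have mD : measurable (setT `\` N) by exact: measurableD.
apply: le_integral => //.
- exact: (integrableS measurableT mD (@subsetT _ _) hf).
- exact: (integrableS measurableT mD (@subsetT _ _) hg).
- by move=> x; rewrite inE => -[_ /fg]; rewrite lee_fin.
Qed.

Lemma Ex_off_eq f g : intg Q f -> intg Q g -> (forall x, ~ N x -> f x <= g x) ->
  Ex Q f = Ex Q g -> Q [set x | f x < g x] = 0%E.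
Proof.
move=> hf hg fg e.
have mf := intg_meas hf; have mg := intg_meas hg.
have mlt := measurable_lt_set mf mg.
pose h x := Num.max (g x - f x) 0.
have hd : intg Q (fun x => g x - f x) by exact: intgB.
have mh : measurable_fun setT h by apply: measurable_maxr => //; exact: measurable_funB.
have hh : intg Q h.
  apply: (intg_le mh (intg_norm hd)) => x; rewrite /h.
  by case: (lerP (g x - f x) 0) => // _; rewrite normr0.
have h0 x : 0 <= h x by rewrite le_max lexx orbT.
have Eh : Ex Q h = 0.
  apply/eqP; rewrite eq_le Ex_ge0// andbT.
  have -> : 0 = Ex Q (fun x => g x - f x) by rewrite ExB// e subrr.
  apply: Ex_le_off => // x /fg xfg; rewrite /h.
  by case: (lerP (g x - f x) 0) => //; rewrite subr_ge0.
pose F (n : nat) := [set x | n.+1%:R^-1 <= h x].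
have mF n : measurable (F n).
  rewrite (_ : F n = setT `&` h @^-1` `[n.+1%:R^-1, +oo[%classic); last first.
    by apply/seteqP; split=> x /=; rewrite /F /= in_itv /= andbT => // -[].
  exact: mh.
have F0 n : Q (F n) = 0%E.
  rewrite prE//; congr EFin; apply/eqP; rewrite eq_le pr_ge0 andbT.
  have c0 : 0 < n.+1%:R^-1 :> R by rewrite invr_gt0.
  by have := @markov_pr R d T Q h (F n) _ c0 (mF n) hh h0 (fun x Fx => Fx); rewrite Eh mul0r.
apply/eqP; rewrite eq_le measure_ge0 andbT.
apply: (@le_trans _ _ (Q (\bigcup_n F n))).
  apply: le_measure; rewrite ?inE//; first exact: bigcupT_measurable.
  move=> x /= lt; have d0 : 0 < g x - f x by rewrite subr_gt0.
  have [n hn] := archi_mul 1 d0; exists n => //; rewrite /F /= /h.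
  rewrite le_max; apply/orP; left; rewrite -[X in X <= _]mul1r ler_pdivrMr// mulrC.
  exact: hn (leqnSn n).
by rewrite (@null_countable_bigcup R _ T nat Q F mF F0).
Qed.

Lemma limn_einf_ge (u : (\bar R)^nat) (l : \bar R) M :
  (forall n, (M <= n)%N -> (l <= u n)%E) -> (l <= limn_einf u)%E.
Proof.
move=> h; rewrite limn_einf_lim; have /cvg_lim -> // := @cvg_einfs_sup _ u.
apply: (@le_trans _ _ (einfs u M)); last by apply: ereal_sup_ubound; exists M.
by apply: le_ereal_inf_tmp => _ [n /= Mn <-]; exact: h.
Qed.

Lemma limn_einf_le (u : (\bar R)^nat) (l : \bar R) :
  (forall n, (u n <= l)%E) -> (limn_einf u <= l)%E.
Proof.
move=> h; rewrite limn_einf_lim; have /cvg_lim -> // := @cvg_einfs_sup _ u.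
apply: ge_ereal_sup => _ [n _ <-]; apply: le_trans (h n).
by apply: ereal_inf_lbound; exists n => /=.
Qed.

(** The functions f n need not converge: eventual domination of [g] bounds it by their lower limit.
    Integrability of [g] comes out together with the bound on its mean. *)
Lemma fatou_bound (f : nat -> T -> R) (g : T -> R) (C : R) :
  measurable_fun setT g -> (forall n, intg Q (f n)) -> (forall n x, 0 <= f n x) ->
  (forall n, Ex Q (f n) <= C) ->
  (forall x, ~ N x -> 0 <= g x /\ exists M, forall n, (M <= n)%N -> g x <= f n x) ->
  intg Q g /\ Ex Q g <= C.
Proof.
move=> mg hf f0 fC hg.
have mD : measurable (setT `\` N) by exact: measurableD.
have sD : setT `\` N `<=` setT by [].
have key : (\int[Q]_(x in setT `\` N) (g x)%:E <= C%:E)%E.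
  apply: (@le_trans _ _ (\int[Q]_(x in setT `\` N) limn_einf (fun n => (f n x)%:E))%E).
    apply: ge0_le_integral => //.
    - by move=> x [_ /hg[]]; rewrite lee_fin.
    - by apply/measurable_EFinP; exact: measurable_funS mg.
    - rewrite (_ : (fun x => _) = (fun x => - limn_esup (fun n => - (f n x)%:E))%E); last first.
        by apply/funext => x; rewrite -[RHS]/(- limn_esup (-%E \o (fun n => (f n x)%:E)))%E limn_esupN oppeK.
      apply: measurableT_comp; first exact: oppe_measurable.
      apply: measurable_fun_limn_esup => n; apply: measurableT_comp; first exact: oppe_measurable.
      by apply/measurable_EFinP; exact: measurable_funS (intg_meas (hf n)).
    - move=> x [_ /hg[_ [M hM]]]; apply: (@limn_einf_ge _ _ M) => n /hM.
      by rewrite lee_fin.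
  apply: le_trans (fatou _ mD _ _) _.
  - by move=> n; apply/measurable_EFinP; exact: measurable_funS (intg_meas (hf n)).
  - by move=> n x _; rewrite lee_fin.
  apply: limn_einf_le => n.
  by rewrite -(negligible_integral mN measurableT (hf n) N0) ExE// lee_fin.
have ig : intg Q g.
  apply/(negligible_integrable mN measurableT _ N0); first exact/measurable_EFinP.
  apply/integrableP; split; first by apply/measurable_EFinP; exact: measurable_funS mg.
  apply: le_lt_trans (_ : (C%:E < +oo)%E); last exact: ltry.
  apply: le_trans key; rewrite le_eqVlt; apply/orP; left; apply/eqP.
  by apply: eq_integral => x; rewrite inE => -[_ /hg[g0 _]] /=; rewrite ger0_norm.
split=> //; rewrite -lee_fin -ExE//.
by rewrite (negligible_integral mN measurableT ig N0).
Qed.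

End almost_everywhere.


Section means.
Context {R : realType}.
Local Notation E := (@envT R).
Variables (Q : probability E R) (ell : R * R -> R).
Hypothesis H : percolation Q ell.
Implicit Types (w : Z2 -> R * R) (xi : R * R) (s b : bool).

(** The e1 increment grows when the direction turns right and the e2 increment when it turns left,
    so far points strictly on the corresponding side of [xi] give lower bounds. *)
Lemma bus_ge_incr w b s xi x (t : R) : star w -> inU xi ->
  (if b then 0 < t < xi.1 else xi.1 < t < 1) ->
  exists n0, forall p, (if b then cone 0 t n0 p else cone t 1 n0 p) ->
    incr b w x p <= bus s xi x (x + step b) w.
Proof.
move=> sw hxi ht; have x01 : 0 < xi.1 < 1 by case/andP: hxi.
have pf := side_proper s x01.
have [ua ub] := sw x; have hc := @bus_cvg R w sw s xi x (x + step b) hxi.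
set l := bus _ _ _ _ _ in hc *; move: l hc => l hc; case: b ht hc => /andP[t1 t2] hc.
  have /andP[x0 x1] := x01.
  have [n0 h] := ua t ((t + xi.1) / 2) t1 ltac:(lra) ltac:(lra).
  exists n0 => p hp; apply/ler_addgt0Pr => eps eps0.
  move/cvgrPdist_lt : hc => /(_ _ eps0) hc.
  have lt : (t + xi.1) / 2 < xi.1 by lra.
  have [p' [/= g1 g2]] := filter_ex (filterI hc (@side_right R s xi.1 _ n0 x01 lt)).
  have h' : incr true w x p <= incr true w x p' := h p p' hp g2.
  have e : delta w x (x + step true) p' = incr true w x p' by [].
  by rewrite e ltr_norml in g1; have /andP[A B] := g1; clear -A B h'; lra.
have /andP[x0 x1] := x01.
have [n0 h] := ub ((t + xi.1) / 2) t ltac:(lra) ltac:(lra) t2.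
exists n0 => p hp; apply/ler_addgt0Pr => eps eps0.
move/cvgrPdist_lt : hc => /(_ _ eps0) hc.
have lt : xi.1 < (t + xi.1) / 2 by lra.
have [p' [/= g1 g2]] := filter_ex (filterI hc (@side_left R s xi.1 _ n0 x01 lt)).
have h' : - incr false w x p' <= - incr false w x p := h p' p g2 hp.
have e : delta w x (x + step false) p' = incr false w x p' by [].
by rewrite e ltr_norml in g1; have /andP[A B] := g1; clear -A B h'; lra.
Qed.

Lemma min_eq0_ge0 (a b : R) : Num.min a b = 0 -> 0 <= a /\ 0 <= b.
Proof. by move=> <-; rewrite !ge_min !lexx orbT. Qed.

Lemma bus_le_edge w b s xi x : star w -> inU xi ->
  bus s xi x (x + step b) w <= edge w (x + step b) b.
Proof.
move=> sw hxi; have [h1 h2] := min_eq0_ge0 (@bus_min R w sw s xi x hxi).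
by case: b; rewrite -subr_ge0; [exact: h1|exact: h2].
Qed.

Lemma bus_le_pt w s xi x y : star w -> inU xi -> le2 x y ->
  bus s xi x y w <= passage_time w x y.
Proof.
move=> sw hxi xy; have x01 : 0 < xi.1 < 1 by case/andP: hxi.
have pf := side_proper s x01.
have hc := @bus_cvg R w sw s xi x y hxi.
set l := bus _ _ _ _ _ in hc *; move: l hc => l hc.
apply/ler_addgt0Pr => eps eps0; move/cvgrPdist_lt : hc => /(_ _ eps0) hc.
have far := side_far s xi.1 (absz y.1 + absz y.2).
have [p [/= g1 [/= f1 f2]]] := filter_ex (filterI hc far).
have yp : le2 y p by clear -f1 f2; rewrite /le2; apply/andP; split; lia.
have tri := pt_tri w xy yp; move: g1; rewrite /delta ltr_norml => /andP[A B].
by clear -A B tri; lra.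
Qed.

Lemma max_incr (F : nat -> R) n (c : R) : (0 < n)%N -> n%:R * c <= F n - F 0%N ->
  exists2 j, (j < n)%N & c <= F j.+1 - F j.
Proof.
move=> n0 h; apply: contrapT => nex.
have lt j : (j < n)%N -> F j.+1 - F j < c.
  by move=> jn; rewrite ltNge; apply/negP => cj; apply: nex; exists j.
suff : forall k, (k < n)%N -> F k.+1 - F 0%N < k.+1%:R * c.
  by move=> /(_ n.-1); rewrite prednK// leqnn => /(_ isT); lra.
elim=> [|k IH] kn; first by rewrite mul1r; exact: lt.
have := IH (ltnW kn); have := lt _ kn; rewrite -[k.+2%:R]natr1; lra.
Qed.

Lemma cone_vec (t1 t2 : R) n0 m n : cone t1 t2 n0 (vec m n) =
  [&& (n0 <= m)%N, (n0 <= n)%N, t1 * (m + n)%:R <= m%:R & m%:R <= t2 * (m + n)%:R].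
Proof. by []. Qed.

Lemma measurable_bus_env s xi x y : measurable_fun setT (fun w : E => bus s xi x y w).
Proof.
apply: (@measurable_bus R _ E (fun w => w)) => z _.
exact: (@measurable_coord R setT z I).
Qed.

(* The increments of L(0, .) over a segment whose directions stay on one side
   of xi are eventually below the Busemann limit, while their averaged mean is a
   difference quotient of the time constant; Fatou's lemma compares the two. *)
Lemma mean_lower_eps b s xi p q l (eps : R) : (0 < p)%N -> (0 < q)%N -> (0 < l)%N ->
  inU xi -> 0 < eps ->
  (if b then (p + l)%:R * xi.2 < xi.1 * q%:R else xi.1 * (q + l)%:R < xi.2 * p%:R) ->
  intg Q (fun w : E => bus s xi 0 (0 + step b) w) /\
  lam ell (p + b * l) (q + ~~ b * l) - lam ell p q - eps <=
    l%:R * Ex Q (fun w : E => bus s xi 0 (0 + step b) w).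
Proof.
move=> p0 q0 l0 hxi eps0 hdir.
set D := lam ell (p + b * l) (q + ~~ b * l) - lam ell p q.
pose F n j := ept Q (n * p + b * j) (n * q + ~~ b * j).
have lR : 0 < l%:R :> R by rewrite ltr0n.
pose c : R := (D - eps) / l%:R.
have lc : l%:R * c = D - eps by rewrite /c mulrC divfK// lt0r_neq0.
have pq : (0 < p + q)%N by lia.
have [M0 hM0] := ept_le H pq eps0.
(* At scale n the mean passage time gains at least n(D - eps) over n l unit steps, so one of them
   gains at least [c]. Any such choice is acceptable for Fatou's lemma. *)
have ex k : exists j, (j < (M0 + k.+1) * l)%N /\ c <= F (M0 + k.+1)%N j.+1 - F (M0 + k.+1)%N j.
  set n := (M0 + k.+1)%N; have n0 : (0 < n)%N by rewrite /n; lia.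
  have nR : 0 < n%:R :> R by rewrite ltr0n.
  suff [j jn hj] : exists2 j, (j < n * l)%N & c <= F n j.+1 - F n j by exists j.
  apply: max_incr; first by rewrite muln_gt0 n0.
  have -> : F n (n * l)%N = ept Q (n * (p + b * l)) (n * (q + ~~ b * l)).
    by rewrite /F !mulnDr !mulnA ![(n * (nat_of_bool _))%N]mulnC -!mulnA.
  have -> : F n 0%N = ept Q (n * p) (n * q) by rewrite /F !muln0 !addn0.
  have g1 := @ept_ge R Q ell H (n * (p + b * l)) (n * (q + ~~ b * l)) ltac:(nia).
  rewrite (lam_hom H _ _ n0) in g1.
  have g2 := hM0 n ltac:(rewrite /n; lia).
  rewrite natrM -mulrA lc /D; clear -g1 g2; nra.
have [j hj] := choice ex.
pose v k := vec ((M0 + k.+1) * p + b * (j k).+1) ((M0 + k.+1) * q + ~~ b * (j k).+1).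
(* Nonnegative because the first edge followed by a geodesic is a competing path. The increments are
   to be bounded from below, so they are subtracted from the edge before Fatou's lemma is used. *)
pose f k := fun w : E => edge w (0 + step b) b - incr b w 0 (v k).
pose g := fun w : E => edge w (0 + step b) b - bus s xi 0 (0 + step b) w.
have vE k : v k = 0 + step b + vec ((M0 + k.+1) * p + b * j k) ((M0 + k.+1) * q + ~~ b * j k).
  by rewrite /v /vec /step add0r; case: (b); congr pair; rewrite /=; clear; lia.
have lev k : le2 (0 + step b) (v k).
  by rewrite vE /le2 /=; clear; apply/andP; split; lia.
have ie : intg Q (fun w : E => edge w (0 + step b) b) by exact/sqint_intg/(sqint_edge H).
have ii k : intg Q (fun w : E => incr b w 0 (v k)).
  by apply: intgB; exact: (intg_pt H).
have mg : measurable_fun setT g.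
  by apply: measurable_funB; [exact: intg_meas ie|exact: measurable_bus_env].
have [||||ig Eg] := @fatou_bound R _ E Q bad_env (@measurable_bad_env R) (bad_env0 H) f g
   (Ex Q (fun w : E => edge w (0 + step b) b) - c) mg.
- by move=> k; exact: intgB.
- by move=> k w; have := pt_step_le w (lev k); rewrite /f /incr; clear; lra.
(* By stationarity L(step b, v) has the mean of the passage time to v - step b, so the mean of the
   increment at its start equals an increment of [F] at the endpoint. *)
- move=> k; rewrite ExB// lerD2l lerN2 ExB; [|exact: (intg_pt H)|exact: (intg_pt H)].
  rewrite -/(ept Q _ _) [in X in _ - Ex Q X]vE (Ex_pt H).
  exact: (hj k).2.
- move=> w nb; have sw := star_of_good nb; split.
    by rewrite /g subr_ge0; exact: bus_le_edge.
  pose t : R := if b then (p + l)%:R / (p + l + q)%:R else p%:R / (p + q + l)%:R.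
  have h2 : xi.2 = 1 - xi.1 by case/andP: hxi => _ /eqP.
  have S1 : 0 < (p + l + q)%:R :> R by rewrite ltr0n; lia.
  have S2 : 0 < (p + q + l)%:R :> R by rewrite ltr0n; lia.
  have ht : if b then 0 < t < xi.1 else xi.1 < t < 1.
    rewrite /t; clear -hdir h2 S1 S2 p0 q0 l0; case: b hdir => hdir; apply/andP; split.
    - by rewrite divr_gt0// ltr0n; lia.
    - by rewrite ltr_pdivrMr// (natrD _ (p + l)); move: hdir; rewrite h2; lra.
    - by rewrite ltr_pdivlMr//; move: hdir; rewrite h2 !natrD; lra.
    - by rewrite ltr_pdivrMr// mul1r ltr_nat; lia.
  have [n0 hn0] := bus_ge_incr s 0 sw hxi ht.
  exists n0 => k kn; rewrite /g /f lerD2l lerN2; apply: hn0.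
  have [jn _] := hj k; rewrite /t /v !cone_vec; clear -jn kn S1 S2 p0 q0 l0.
  move: jn; set n := (M0 + k.+1)%N => jn; have nn0 : (n0 <= n)%N by rewrite /n; lia.
  have np : (n <= n * p)%N by nia.
  have nq : (n <= n * q)%N by nia.
  case: b.
    rewrite !mul1n !mul0n !addn0; apply/and4P; split; [lia|lia|by rewrite mul0r|].
    rewrite mulrAC ler_pdivlMr// -!natrM ler_nat.
    suff : ((n * p + (j k).+1) * q <= (p + l) * (n * q))%N by nia.
    have : ((n * p + (j k).+1) <= (p + l) * n)%N by nia.
    by move: (n * p + (j k).+1)%N => A; nia.
  rewrite !mul1n !mul0n !addn0; apply/and4P; split; [lia|lia| |by rewrite mul1r ler_nat; lia].
  rewrite mulrAC ler_pdivrMr// -!natrM ler_nat.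
  suff : (p * (n * q + (j k).+1) <= n * p * (q + l))%N by nia.
  have : ((n * q + (j k).+1) <= (q + l) * n)%N by nia.
  by move: (n * q + (j k).+1)%N => A; nia.
have eb : (fun w : E => bus s xi 0 (0 + step b) w) = (fun w : E => edge w (0 + step b) b - g w).
  by apply/funext => w; rewrite /g subKr.
have ib : intg Q (fun w : E => bus s xi 0 (0 + step b) w) by rewrite eb; exact: intgB.
split; first exact: ib.
rewrite -lc ler_pM2l// eb ExB//; clear -Eg; lra.
Qed.

Lemma bus_sum w s xi m n : star w -> inU xi ->
  bus s xi 0 (vec m n) w = \sum_(i < m) bus s xi 0 (0 + step true) (shift_env (vec i 0) w) +
    \sum_(j < n) bus s xi 0 (0 + step false) (shift_env (vec m j) w).
Proof.
move=> sw hxi.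
have st b z : bus s xi z (z + step b) w = bus s xi 0 (0 + step b) (shift_env z w).
  by rewrite -bus_shift !add0r [step b + z]addrC.
have rec (F : nat -> R) k : \sum_(i < k.+1) F i = \sum_(i < k) F i + F k by exact: big_ord_recr.
elim: n => [|n IH].
  rewrite big_ord0 addr0; elim: m => [|m IH]; first by rewrite big_ord0 (bus_xx _ _ _ hxi).
  rewrite (rec (fun i => bus s xi 0 (0 + step true) (shift_env (vec i 0) w))) -IH -st.
  rewrite (@bus_cocycle R w sw s xi 0 _ (vec m 0) hxi).
  by congr (_ + bus s xi _ _ w); rewrite /vec; congr pair; rewrite /=; lia.
rewrite (rec (fun j => bus s xi 0 (0 + step false) (shift_env (vec m j) w))) addrA -IH -st.
rewrite (@bus_cocycle R w sw s xi 0 _ (vec m n) hxi).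
by congr (_ + bus s xi _ _ w); rewrite /vec; congr pair; rewrite /=; lia.
Qed.

Lemma intg_bus b s xi : inU xi -> intg Q (fun w : E => bus s xi 0 (0 + step b) w).
Proof.
move=> hxi; have := hxi; case/andP=> /andP[x0 x1] /eqP x2.
have x20 : 0 < xi.2 by lra.
have [N hN] := archi_mul (2 * xi.2 + 1) x0; have [N' hN'] := archi_mul (2 * xi.1 + 1) x20.
case: b.
  have h := hN N.+1 (leqnSn _).
  have hd : (1 + 1)%:R * xi.2 < xi.1 * N.+1%:R by move: h; rewrite mulrC [xi.1 * _]mulrC; lra.
  by have [] := @mean_lower_eps true s xi 1 N.+1 1 1 isT isT isT hxi ltr01 hd.
have h := hN' N'.+1 (leqnSn _).
have hd : xi.1 * (1 + 1)%:R < xi.2 * N'.+1%:R by move: h; rewrite [xi.2 * _]mulrC; lra.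
by have [] := @mean_lower_eps false s xi N'.+1 1 1 1 isT isT isT hxi ltr01 hd.
Qed.

Definition mbus b s xi : R := Ex Q (fun w : E => bus s xi 0 (0 + step b) w).

Lemma mean_lower b s xi p q l : (0 < p)%N -> (0 < q)%N -> (0 < l)%N -> inU xi ->
  (if b then (p + l)%:R * xi.2 < xi.1 * q%:R else xi.1 * (q + l)%:R < xi.2 * p%:R) ->
  lam ell (p + b * l) (q + ~~ b * l) - lam ell p q <= l%:R * mbus b s xi.
Proof.
move=> p0 q0 l0 hxi hd; apply/ler_addgt0Pr => eps eps0.
by have [_] := mean_lower_eps s p0 q0 l0 hxi eps0 hd; rewrite -/(mbus _ _ _); lra.
Qed.

(** Summed along a staircase path, the cocycle is at most L(0,(m,n)), which bounds the left side by
    the mean passage time. Applied at large multiples of (m,n), the linear left side gives the time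
    constant. *)
Lemma mean_upper s xi m n : inU xi -> (0 < m + n)%N ->
  m%:R * mbus true s xi + n%:R * mbus false s xi <= lam ell m n.
Proof.
move=> hxi mn.
have key m' n' : m'%:R * mbus true s xi + n'%:R * mbus false s xi <= ept Q m' n'.
  have [F1 F1E] : exists F : nat -> E -> R,
      F = fun i w => bus s xi 0 (0 + step true) (shift_env (vec i 0) w) by exact: (ex_intro _ _ (Logic.eq_refl _)).
  have [F2 F2E] : exists F : nat -> E -> R,
      F = fun j w => bus s xi 0 (0 + step false) (shift_env (vec m' j) w) by exact: (ex_intro _ _ (Logic.eq_refl _)).
  have i1 k : intg Q (F1 k).
    by rewrite F1E; exact: (intg_shift (perc_site H) _ (intg_bus true s hxi)).
  have i2 k : intg Q (F2 k).
    by rewrite F2E; exact: (intg_shift (perc_site H) _ (intg_bus false s hxi)).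
  have e1 k : Ex Q (F1 k) = mbus true s xi.
    by rewrite F1E; exact: (Ex_shift (perc_site H) _ (intg_bus true s hxi)).
  have e2 k : Ex Q (F2 k) = mbus false s xi.
    by rewrite F2E; exact: (Ex_shift (perc_site H) _ (intg_bus false s hxi)).
  have I1 := @intg_sum R _ E Q m' F1 (fun k _ => i1 k).
  have I2 := @intg_sum R _ E Q n' F2 (fun k _ => i2 k).
  have S1 := @Ex_sum R _ E Q m' F1 (fun k _ => i1 k).
  have S2 := @Ex_sum R _ E Q n' F2 (fun k _ => i2 k).
  rewrite (eq_bigr (fun=> mbus true s xi) (fun (k : 'I_m') _ => e1 k)) sumr_const card_ord in S1.
  rewrite (eq_bigr (fun=> mbus false s xi) (fun (k : 'I_n') _ => e2 k)) sumr_const card_ord in S2.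
  have S := ExD I1 I2; rewrite S1 S2 in S.
  have -> : m'%:R * mbus true s xi + n'%:R * mbus false s xi =
      mbus true s xi *+ m' + mbus false s xi *+ n' by move: (mbus _ _ _) (mbus _ _ _) => a b;
    rewrite !mulr_natl.
  rewrite -S.
  apply: (@Ex_le_off R _ E Q bad_env (@measurable_bad_env R) (bad_env0 H) _ _
    (intgD I1 I2) (intg_pt H _ _)).
  move=> w /star_of_good sw; have le0 : le2 0 (vec m' n') by clear; rewrite /le2 /=; lia.
  have h := bus_le_pt s sw hxi le0; rewrite (bus_sum s m' n' sw hxi) in h.
  by rewrite F1E F2E; exact: h.
apply/ler_addgt0Pr => eps eps0.
have [M0 /(_ M0.+1 (leqnSn _)) hM] := ept_le H mn eps0.
have := le_trans (key _ _) hM; rewrite !natrM -!mulrA -mulrDr ler_pM2l//.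
Qed.

End means.

(** * Identification of the means with the gradient of the time constant *)

Section gradient_means.
Context {R : realType}.
Local Notation E := (@envT R).
Variables (Q : probability E R) (ell : R * R -> R).
Hypothesis H : percolation Q ell.
Implicit Types (xi y : R * R) (s b : bool).

Local Notation mb := (mbus Q).
Local Notation D1 := ('D_((1 : R), (0 : R)) ell).
Local Notation D2 := ('D_((0 : R), (1 : R)) ell).

Lemma ell_cont y (eps : R) : 0 < y.1 -> 0 < y.2 -> 0 < eps ->
  exists2 del : R, 0 < del &
  forall z, `|z.1 - y.1| < del -> `|z.2 - y.2| < del -> `|ell z - ell y| < eps.
Proof.
move=> y1 y2 eps0; have := differentiable_continuous (perc_diff H y1 y2).
move=> /cvgrPdist_lt/(_ _ eps0)/nbhs_ballP[del /= del0 h]; exists del => // z h1 h2.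
by rewrite distrC; apply: h; split; rewrite /ball /= distrC.
Qed.

Lemma lam_approx y (eps : R) : 0 < y.1 -> 0 < y.2 -> 0 < eps ->
  exists2 del : R, 0 < del & forall k p q : nat, (0 < k)%N ->
    `|p%:R / k%:R - y.1| < del -> `|q%:R / k%:R - y.2| < del ->
    `|lam ell p q - k%:R * ell y| <= eps * k%:R.
Proof.
move=> y1 y2 eps0; have [del del0 h] := ell_cont y1 y2 eps0.
exists del => // k p q k0 h1 h2; have kR : 0 < k%:R :> R by rewrite ltr0n.
have -> : lam ell p q = k%:R * ell (p%:R / k%:R, q%:R / k%:R).
  rewrite -(perc_hom H) ?divr_ge0// /lam; congr (ell (_, _));
  by rewrite mulrC divfK// lt0r_neq0.
rewrite -mulrBr normrM (gtr0_norm kR) mulrC ler_pM2r//; apply: ltW.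
exact: (h (p%:R / k%:R, q%:R / k%:R)).
Qed.

Lemma grid_close (a e : R) (k p : nat) : (0 < k)%N -> k%:R * a - 1 <= p%:R <= k%:R * a + 1 ->
  1 < k%:R * e -> `|p%:R / k%:R - a| < e.
Proof.
move=> k0 /andP[h1 h2] h3; have kR : 0 < k%:R :> R by rewrite ltr0n.
have -> : p%:R / k%:R - a = (p%:R - k%:R * a) / k%:R by field; rewrite lt0r_neq0.
rewrite normrM (gtr0_norm (_ : 0 < k%:R^-1)) ?invr_gt0// ltr_pdivrMr//.
by rewrite ltr_norml; apply/andP; split; lra.
Qed.

Lemma truncn_between (x : R) : 0 <= x -> (Num.truncn x)%:R <= x < (Num.truncn x).+1%:R.
Proof. by move=> x0; apply/truncn_itv. Qed.

Lemma abs_bound (a d : R) : `|d| <= 1 -> - `|a| <= d * a.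
Proof.
move=> h; have : `|d * a| <= `|a| by rewrite normrM ler_piMl.
by rewrite ler_norml => /andP[].
Qed.

Lemma mean_upper_real s xi y : inU xi -> 0 < y.1 -> 0 < y.2 ->
  y.1 * mb true s xi + y.2 * mb false s xi <= ell y.
Proof.
move=> hxi y1 y2; apply/ler_addgt0Pr => eps eps0.
have mu p q (pq : (0 < p + q)%N) := @mean_upper R Q ell H s xi p q hxi pq.
move: mu; set H1 := mb true s xi; set H2 := mb false s xi => mu; clearbody H1 H2.
have e20 : 0 < eps / 2 by lra.
have [del del0 h] := lam_approx y1 y2 e20.
have [N1 hN1] := archi_mul 2 del0.
have [N2 hN2] := archi_mul (`|H1| + `|H2|) e20.
pose k := (N1 + N2).+1; have k0 : (0 < k)%N by [].
have kR : 0 < k%:R :> R by rewrite ltr0n.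
have kd := hN1 k ltac:(clear; rewrite /k; lia); have ke := hN2 k ltac:(clear; rewrite /k; lia).
have /andP[p1 p2] := truncn_between (mulr_ge0 (ltW kR) (ltW y1)).
have /andP[q1 q2] := truncn_between (mulr_ge0 (ltW kR) (ltW y2)).
rewrite -natr1 in p2; rewrite -natr1 in q2.
move: p1 p2 q1 q2; set p := Num.truncn _; set q := Num.truncn _ => p1 p2 q1 q2.
have q3 : q.+1%:R = q%:R + 1 :> R by rewrite -natr1.
have g1 : `|p%:R / k%:R - y.1| < del.
  by apply: (grid_close k0); [clear -p1 p2; apply/andP; split|clear -kd]; lra.
have g2 : `|q.+1%:R / k%:R - y.2| < del.
  by apply: (grid_close k0); [clear -q1 q2 q3; apply/andP; split|clear -kd]; lra.
have := h k p q.+1 k0 g1 g2; rewrite ler_norml => /andP[_ up].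
(* The successor keeps the integer vector nonzero; it moves by at most one unit, which vanishes
   after division by [k]. *)
have low := mu p q.+1 ltac:(by rewrite addnS).
have b1 : - `|H1| <= (p%:R - k%:R * y.1) * H1.
  by apply: abs_bound; rewrite ler_norml; clear -p1 p2; apply/andP; split; lra.
have b2 : - `|H2| <= (q.+1%:R - k%:R * y.2) * H2.
  by apply: abs_bound; rewrite ler_norml; clear -q1 q2 q3; apply/andP; split; lra.
rewrite -(ler_pM2l kR); clear -up low b1 b2 ke; nra.
Qed.

(** Homogeneity is available for integer factors. Writing (1 + 1/k) xi as (k+1)(xi/k) makes the
    radial difference quotient with step 1/k equal to ell xi exactly. *)
Lemma euler xi : 0 < xi.1 -> 0 < xi.2 -> ell xi = xi.1 * D1 xi + xi.2 * D2 xi.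
Proof.
move=> x1 x2; apply/eqP; rewrite -subr_eq0 -normr_le0; apply/ler_addgt0Pr => eps eps0.
rewrite add0r; have [del del0 h] := directional H xi.1 xi.2 x1 x2 eps0.
have [N hN] := archi_mul 2 del0; pose k := N.+1.
have kR : 0 < k%:R :> R by rewrite ltr0n.
have kd := hN k (leqnSn _).
have := h k%:R^-1; rewrite gtr0_norm ?invr_gt0// kR /= invf_plt ?posrE//.
have -> : del^-1 < k%:R.
  by rewrite -[X in X < _]mul1r ltr_pdivrMr//; lra.
move=> /(_ isT); rewrite invrK.
have e (x : R) : x + k%:R^-1 * x = k.+1%:R * (x / k%:R).
  by rewrite -[k.+1%:R]natr1; field; rewrite lt0r_neq0.
have ek : ell xi = k%:R * ell (xi.1 / k%:R, xi.2 / k%:R).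
  have x1k := ltW (divr_gt0 x1 kR); have x2k := ltW (divr_gt0 x2 kR).
  rewrite -(perc_hom H)//; congr ell.
  by apply: injective_projections; rewrite /= mulrC divfK// lt0r_neq0.
rewrite !e (perc_hom H)//; last 2 first.
- exact: (ltW (divr_gt0 x1 kR)).
- exact: (ltW (divr_gt0 x2 kR)).
suff -> : k%:R * (k.+1%:R * ell (xi.1 / k%:R, xi.2 / k%:R) - ell xi) = ell xi by [].
rewrite mulrBr mulrCA -ek -[k.+1%:R]natr1; ring.
Qed.

Lemma quotient_bound (h a b d eps : R) : h != 0 -> `|h^-1 * (a - b) - d| <= eps ->
  `|a - b - h * d| <= eps * `|h|.
Proof.
move=> h0 le; have -> : a - b - h * d = (h^-1 * (a - b) - d) * h by field.
by rewrite normrM ler_pM2r// normr_gt0.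
Qed.

(** The factor 5 collects e and 2e from the difference quotients with steps h and 2h, and e from
    each of the two lattice approximations. *)
Lemma grad_lower_arith (k h l d c e E1 E0 Ex L1 L0 : R) : 0 < l -> k * h = l -> 0 < k ->
  `|E1 - Ex - - h * d| <= e * `|- h| -> `|E0 - Ex - - (2 * h) * d| <= e * `|- (2 * h)| -> 0 < h ->
  `|L1 - k * E1| <= e * h * k -> `|L0 - k * E0| <= e * h * k -> L1 - L0 <= l * c ->
  d <= c + 5 * e.
Proof.
move=> l0 kh k0 h1 h2 hp h3 h4 h5.
have n1 : `|- h| = h by rewrite normrN gtr0_norm.
have n2 : `|- (2 * h)| = 2 * h by rewrite normrN gtr0_norm//; lra.
rewrite n1 in h1; rewrite n2 in h2.
move: h1 h2 h3 h4; rewrite !ler_norml => /andP[a1 a2] /andP[b1 b2] /andP[c1 c2] /andP[d1 d2].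
have A : k * (E1 - Ex + h * d) >= - (e * l) by rewrite -kh; clear -k0 a1; nra.
have B : k * (E0 - Ex + 2 * h * d) <= 2 * (e * l) by rewrite -kh; clear -k0 b2; nra.
have C : e * h * k = e * l by rewrite -kh; ring.
have D : k * (h * d) = l * d by rewrite mulrA kh.
rewrite C in c1 c2 d1 d2; rewrite -(ler_pM2l l0); clear -A B D c1 d2 h5; nra.
Qed.

(** The hypothesis concerns segments strictly to the left of [xi], so the derivative is read off
    between xi.1 - 2h and xi.1 - h, where lattice approximations still stay on that side. *)
Lemma grad_lower1 xi (c : R) : inU xi ->
  (forall p q l : nat, (0 < p)%N -> (0 < q)%N -> (0 < l)%N ->
     (p + l)%:R * xi.2 < xi.1 * q%:R -> lam ell (p + l) q - lam ell p q <= l%:R * c) ->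
  D1 xi <= c.
Proof.
move=> /andP[/andP[x1 x1'] /eqP x2E] hc; have x2 : 0 < xi.2 by lra.
apply/ler_addgt0Pr => eps eps0; pose e := eps / 5; have e0 : 0 < e by rewrite /e; lra.
have [del del0 hd] := directional H 1 0 x1 x2 e0.
have [M1 hM1] := archi_mul 3 del0; have [M2 hM2] := archi_mul 3 x1.
pose M := (M1 + M2).+1; have MR : 0 < M%:R :> R by rewrite ltr0n.
pose h : R := M%:R^-1; have h0 : 0 < h by rewrite invr_gt0.
have hM : M%:R * h = 1 by rewrite mulfV// lt0r_neq0.
have m1 := hM1 M ltac:(clear; rewrite /M; lia); have m2 := hM2 M ltac:(clear; rewrite /M; lia).
have hdel : 3 * h <= del by rewrite -(ler_pM2l MR); lra.
have hx : 3 * h <= xi.1 by rewrite -(ler_pM2l MR); lra.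
have d1 := hd (- h); have d2 := hd (- (2 * h)).
rewrite !normrN !mulr1 !mulr0 !addr0 mul1r mul0r addr0 gtr0_norm// in d1.
rewrite !normrN !mulr1 !mulr0 !addr0 mul1r mul0r addr0 gtr0_norm in d2; last by lra.
have {}d1 := quotient_bound (ltr0_neq0 (_ : - h < 0)) (d1 ltac:(apply/andP; split; lra)).
have {}d2 := quotient_bound (ltr0_neq0 (_ : - (2 * h) < 0)) (d2 ltac:(apply/andP; split; lra)).
have {}d1 := d1 ltac:(lra); have {}d2 := d2 ltac:(lra).
have eh : 0 < e * h by rewrite mulr_gt0.
have [del1 del10 a1] := @lam_approx (xi.1 - h, xi.2) _ ltac:(rewrite /=; lra) x2 eh.
have [del2 del20 a2] := @lam_approx (xi.1 - 2 * h, xi.2) _ ltac:(rewrite /=; lra) x2 eh.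
have [N1 hN1] := archi_mul 2 del10; have [N2 hN2] := archi_mul 2 del20.
have [N3 hN3] := archi_mul 2 (ltac:(clear -hx h0; lra) : 0 < xi.1 - 2 * h).
(* At mesh 1/k the length h is exactly [l] lattice steps. *)
pose l := (N1 + N2 + N3).+1; pose k := (M * l)%N.
have l0 : (0 < l)%N by []. have k0 : (0 < k)%N by rewrite muln_gt0.
have lR : 0 < l%:R :> R by rewrite ltr0n. have kR : 0 < k%:R :> R by rewrite ltr0n.
have kh : k%:R * h = l%:R by rewrite /k natrM mulrAC hM mul1r.
have kl : (l <= k)%N by rewrite /k leq_pmull.
have [Nk1 Nk2 Nk3] : [/\ N1 <= k, N2 <= k & N3 <= k]%N.
  by move: (k) kl; rewrite /l; clear => k' ?; split; lia.
have n1 := hN1 k Nk1; have n2 := hN2 k Nk2.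
have n3 := hN3 k Nk3.
have /andP[p1 p2] := truncn_between (ltac:(clear -n3; lra) : 0 <= k%:R * (xi.1 - 2 * h)).
have /andP[q1 q2] := truncn_between (mulr_ge0 (ltW kR) (ltW x2)).
move: p1 p2 q1 q2; set p := Num.truncn _; set q := Num.truncn _ => p1 p2 q1 q2.
have p3 : p.+1%:R = p%:R + 1 :> R by rewrite -natr1.
have q3 : q.+1%:R = q%:R + 1 :> R by rewrite -natr1.
have k2h : k%:R * (xi.1 - 2 * h) = k%:R * xi.1 - 2 * l%:R by rewrite -kh; ring.
have k1h : k%:R * (xi.1 - h) = k%:R * xi.1 - l%:R by rewrite -kh; ring.
have pl : (p + l)%:R = p%:R + l%:R :> R by rewrite natrD.
have pp : (0 < p)%N by rewrite -(ltr_nat R); clear -p2 p3 n3; lra.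
have g0 : `|p%:R / k%:R - (xi.1 - 2 * h, xi.2).1| < del2.
  by apply: (grid_close k0); [clear -p1 p2 p3; apply/andP; split|clear -n2]; rewrite /=; lra.
have g1 : `|(p + l)%:R / k%:R - (xi.1 - h, xi.2).1| < del1.
  by apply: (grid_close k0); [clear -p1 p2 p3 pl k1h k2h; apply/andP; split|clear -n1]; rewrite /=; lra.
have g2 : `|q.+1%:R / k%:R - xi.2| < del2.
  by apply: (grid_close k0); [clear -q1 q2 q3; apply/andP; split|clear -n2]; lra.
have g3 : `|q.+1%:R / k%:R - xi.2| < del1.
  by apply: (grid_close k0); [clear -q1 q2 q3; apply/andP; split|clear -n1]; lra.
have dir : (p + l)%:R * xi.2 < xi.1 * q.+1%:R.
  apply: (@le_lt_trans _ _ ((k%:R * xi.1 - l%:R) * xi.2)).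
    by rewrite ler_pM2r//; clear -pl p1 k2h; lra.
  apply: (@lt_trans _ _ (k%:R * xi.1 * xi.2)); first by rewrite ltr_pM2r//; clear -lR; lra.
  by rewrite mulrAC [ltLHS]mulrC ltr_pM2l.
have := grad_lower_arith lR kh kR d1 d2 h0 (a1 k _ _ k0 g1 g3) (a2 k _ _ k0 g0 g2)
  (hc p q.+1 l pp isT l0 dir).
by clear; rewrite /e; lra.
Qed.

Lemma grad_lower2 xi (c : R) : inU xi ->
  (forall p q l : nat, (0 < p)%N -> (0 < q)%N -> (0 < l)%N ->
     xi.1 * (q + l)%:R < xi.2 * p%:R -> lam ell p (q + l) - lam ell p q <= l%:R * c) ->
  D2 xi <= c.
Proof.
move=> /andP[/andP[x1 x1'] /eqP x2E] hc; have x2 : 0 < xi.2 by lra.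
apply/ler_addgt0Pr => eps eps0; pose e := eps / 5; have e0 : 0 < e by rewrite /e; lra.
have [del del0 hd] := directional H 0 1 x1 x2 e0.
have [M1 hM1] := archi_mul 3 del0; have [M2 hM2] := archi_mul 3 x2.
pose M := (M1 + M2).+1; have MR : 0 < M%:R :> R by rewrite ltr0n.
pose h : R := M%:R^-1; have h0 : 0 < h by rewrite invr_gt0.
have hM : M%:R * h = 1 by rewrite mulfV// lt0r_neq0.
have m1 := hM1 M ltac:(clear; rewrite /M; lia); have m2 := hM2 M ltac:(clear; rewrite /M; lia).
have hdel : 3 * h <= del by rewrite -(ler_pM2l MR); lra.
have hx : 3 * h <= xi.2 by rewrite -(ler_pM2l MR); lra.
have d1 := hd (- h); have d2 := hd (- (2 * h)).
rewrite !normrN !mulr1 !mulr0 !addr0 mul1r mul0r add0r gtr0_norm// in d1.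
rewrite !normrN !mulr1 !mulr0 !addr0 mul1r mul0r add0r gtr0_norm in d2; last by lra.
have {}d1 := quotient_bound (ltr0_neq0 (_ : - h < 0)) (d1 ltac:(apply/andP; split; lra)).
have {}d2 := quotient_bound (ltr0_neq0 (_ : - (2 * h) < 0)) (d2 ltac:(apply/andP; split; lra)).
have {}d1 := d1 ltac:(lra); have {}d2 := d2 ltac:(lra).
have eh : 0 < e * h by rewrite mulr_gt0.
have [del1 del10 a1] := @lam_approx (xi.1, xi.2 - h) _ x1 ltac:(rewrite /=; lra) eh.
have [del2 del20 a2] := @lam_approx (xi.1, xi.2 - 2 * h) _ x1 ltac:(rewrite /=; lra) eh.
have [N1 hN1] := archi_mul 2 del10; have [N2 hN2] := archi_mul 2 del20.
have [N3 hN3] := archi_mul 2 (ltac:(clear -hx h0; lra) : 0 < xi.2 - 2 * h).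
pose l := (N1 + N2 + N3).+1; pose k := (M * l)%N.
have l0 : (0 < l)%N by []. have k0 : (0 < k)%N by rewrite muln_gt0.
have lR : 0 < l%:R :> R by rewrite ltr0n. have kR : 0 < k%:R :> R by rewrite ltr0n.
have kh : k%:R * h = l%:R by rewrite /k natrM mulrAC hM mul1r.
have kl : (l <= k)%N by rewrite /k leq_pmull.
have [Nk1 Nk2 Nk3] : [/\ N1 <= k, N2 <= k & N3 <= k]%N.
  by move: (k) kl; rewrite /l; clear => k' ?; split; lia.
have n1 := hN1 k Nk1; have n2 := hN2 k Nk2.
have n3 := hN3 k Nk3.
have /andP[q1 q2] := truncn_between (ltac:(clear -n3; lra) : 0 <= k%:R * (xi.2 - 2 * h)).
have /andP[p1 p2] := truncn_between (mulr_ge0 (ltW kR) (ltW x1)).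
move: p1 p2 q1 q2; set p := Num.truncn _; set q := Num.truncn _ => p1 p2 q1 q2.
have p3 : p.+1%:R = p%:R + 1 :> R by rewrite -natr1.
have q3 : q.+1%:R = q%:R + 1 :> R by rewrite -natr1.
have k2h : k%:R * (xi.2 - 2 * h) = k%:R * xi.2 - 2 * l%:R by rewrite -kh; ring.
have k1h : k%:R * (xi.2 - h) = k%:R * xi.2 - l%:R by rewrite -kh; ring.
have ql : (q + l)%:R = q%:R + l%:R :> R by rewrite natrD.
have qp : (0 < q)%N by rewrite -(ltr_nat R); clear -q2 q3 n3; lra.
have g0 : `|q%:R / k%:R - (xi.1, xi.2 - 2 * h).2| < del2.
  by apply: (grid_close k0); [clear -q1 q2 q3; apply/andP; split|clear -n2]; rewrite /=; lra.
have g1 : `|(q + l)%:R / k%:R - (xi.1, xi.2 - h).2| < del1.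
  by apply: (grid_close k0); [clear -q1 q2 q3 ql k1h k2h; apply/andP; split|clear -n1]; rewrite /=; lra.
have g2 : `|p.+1%:R / k%:R - xi.1| < del2.
  by apply: (grid_close k0); [clear -p1 p2 p3; apply/andP; split|clear -n2]; lra.
have g3 : `|p.+1%:R / k%:R - xi.1| < del1.
  by apply: (grid_close k0); [clear -p1 p2 p3; apply/andP; split|clear -n1]; lra.
have dir : xi.1 * (q + l)%:R < xi.2 * p.+1%:R.
  apply: (@le_lt_trans _ _ (xi.1 * (k%:R * xi.2 - l%:R))).
    by rewrite ler_pM2l//; clear -ql q1 k2h; lra.
  apply: (@lt_trans _ _ (xi.1 * (k%:R * xi.2))); first by rewrite ltr_pM2l//; clear -lR; lra.
  by rewrite mulrCA [k%:R * _]mulrC -mulrA mulrCA ltr_pM2l// mulrC.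
have := grad_lower_arith lR kh kR d1 d2 h0 (a1 k _ _ k0 g3 g1) (a2 k _ _ k0 g2 g0)
  (hc p.+1 q l isT qp l0 dir).
by clear; rewrite /e; lra.
Qed.

Lemma mean_grad s xi : inU xi -> mb true s xi = D1 xi /\ mb false s xi = D2 xi.
Proof.
move=> hxi; have := hxi; case/andP=> /andP[x1 x1'] /eqP x2E.
have x2 : 0 < xi.2 by lra.
have l1 : D1 xi <= mb true s xi.
  apply: (grad_lower1 hxi) => p q l p0 q0 l0 dir.
  have := @mean_lower R Q ell H true s xi p q l p0 q0 l0 hxi dir.
  by rewrite mul1n mul0n addn0.
have l2 : D2 xi <= mb false s xi.
  apply: (grad_lower2 hxi) => p q l p0 q0 l0 dir.
  have := @mean_lower R Q ell H false s xi p q l p0 q0 l0 hxi dir.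
  by rewrite mul1n mul0n addn0.
have := mean_upper_real s hxi x1 x2; rewrite (euler x1 x2).
move: l1 l2; set H1 := mb true s xi; set H2 := mb false s xi.
clearbody H1 H2; move: (D1 xi) (D2 xi) => g1 g2 l1 l2 u.
by split; apply/eqP; rewrite eq_le ?l1 ?l2 andbT; nra.
Qed.

(** The upper bound on means says that the tangent plane at [xi] lies below [ell] everywhere in the
    open quadrant. With equal gradients, Euler's identity makes this plane agree with [ell] at both
    points, against strict convexity at the midpoint. *)
Lemma grad_inj xi zeta : inU xi -> inU zeta -> xi <> zeta ->
  ~ (D1 xi = D1 zeta /\ D2 xi = D2 zeta).
Proof.
move=> hxi hz ne [e1 e2].
have := hxi; case/andP=> /andP[x1 x1'] /eqP x2E; have x2 : 0 < xi.2 by lra.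
have := hz; case/andP=> /andP[z1 z1'] /eqP z2E; have z2 : 0 < zeta.2 by lra.
have h01 : 0 < (2^-1 : R) < 1 by apply/andP; split; lra.
have := perc_conv H hxi hz ne h01; set y := _ + _.
have y1E : y.1 = 2^-1 * xi.1 + (1 - 2^-1) * zeta.1 by [].
have y2E : y.2 = 2^-1 * xi.2 + (1 - 2^-1) * zeta.2 by [].
have y1 : 0 < y.1 by rewrite y1E; lra.
have y2 : 0 < y.2 by rewrite y2E; lra.
have := mean_upper_real true hxi y1 y2; have [-> ->] := mean_grad true hxi.
rewrite (euler x1 x2) (euler z1 z2) -e1 -e2 y1E y2E.
move: (ell y) (D1 xi) (D2 xi) => L g1 g2; lra.
Qed.

Lemma cont_dir_ae xi : inU xi ->
  exists A : set E, [/\ measurable A, Q A = 1%E & A `<=` [set w | cont_dir w xi]].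
Proof.
move=> hxi; have QL := perc_site H.
(* The two one-sided limits are ordered in opposite ways for e1 and e2; [b] is therefore both the
   step and the sign of the larger limit. *)
pose N b := [set w : E | bus (~~ b) xi 0 (0 + step b) w < bus b xi 0 (0 + step b) w].
have N0 b : Q (N b) = 0%E.
  apply: (@Ex_off_eq R _ E Q bad_env (@measurable_bad_env R) (bad_env0 H)).
  - exact: (intg_bus H b (~~ b) hxi).
  - exact: (intg_bus H b b hxi).
  - move=> w /star_of_good sw; have [h1 h2] := bus_le_step sw 0 hxi.
    by case: (b); [exact: h1|exact: h2].
  - have [a1 a2] := mean_grad true hxi; have [c1 c2] := mean_grad false hxi.
    by case: (b); [exact: (eq_trans c1 (esym a1))|exact: (eq_trans a2 (esym c2))].
have mN b : measurable (N b).
  exact: measurable_lt_set (@measurable_bus_env R _ _ _ _) (@measurable_bus_env R _ _ _ _).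
pose B := bad_env `|` \bigcup_(xb : Z2 * bool) (shift_env xb.1 @^-1` N xb.2).
have mU : measurable (\bigcup_(xb : Z2 * bool) (shift_env xb.1 @^-1` N xb.2) : set E).
  apply: countable_bigcupT_measurable; first exact: countableP.
  by move=> xb; exact: measurable_shift_pre.
have mB : measurable B by apply: measurableU; [exact: measurable_bad_env|exact: mU].
have U0 : Q (\bigcup_(xb : Z2 * bool) (shift_env xb.1 @^-1` N xb.2)) = 0%E.
  apply: (@null_countable_bigcup R _ E _ Q (fun xb : Z2 * bool => shift_env xb.1 @^-1` N xb.2)).
    by move=> xb; exact: measurable_shift_pre.
  by move=> xb; rewrite QL.1; [exact: N0|exact: mN].
have B0 : Q B = 0%E.
  rewrite (prE Q mB); congr EFin; apply/eqP; rewrite eq_le pr_ge0 andbT.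
  apply: le_trans (pr_setU Q (@measurable_bad_env R) mU) _.
  by rewrite /pr U0 (bad_env0 H) /= addr0.
exists (~` B); split; first exact: measurableC.
  by rewrite probability_setC// B0 sube0.
move=> w nB; have sw : star w by apply: star_of_good => bw; apply: nB; left.
apply: (cont_dir_step sw hxi) => x b.
have st s : bus s xi x (x + step b) w = bus s xi 0 (0 + step b) (shift_env x w).
  by rewrite -bus_shift !add0r [step b + x]addrC.
have nlt : ~ (bus (~~ b) xi x (x + step b) w < bus b xi x (x + step b) w).
  by rewrite !st => lt; apply: nB; right; exists (x, b) => //; exact: lt.
have [h1 h2] := bus_le_step sw x hxi.
apply/eqP; rewrite eq_le; apply/andP; split; case: b nlt {st} => nlt.
- by rewrite leNgt; apply/negP; exact: nlt.
- exact: h2.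
- exact: h1.
- by rewrite leNgt; apply/negP; exact: nlt.
Qed.

End gradient_means.

(** * Ergodicity *)

Lemma sigma_algebra_preimage (T U : Type) (f : T -> U) (G : set (set U)) (F : set (set T)) :
  sigma_algebra setT F -> (forall A, G A -> F (f @^-1` A)) ->
  forall A, <<s G >> A -> F (f @^-1` A).
Proof.
move=> [F0 FC FU] GF; apply: (smallest_sub _ (_ : G `<=` [set A | F (f @^-1` A)])) => //.
split=> /=.
- by rewrite preimage_set0.
- by move=> A FA; rewrite setTD preimage_setC -setTD; exact: FC.
- by move=> A FA; rewrite preimage_bigcup; exact: FU.
Qed.

Section ergodic.
Context {R : realType}.
Local Notation E := (@envT R).
Variable Q : probability E R.
Hypothesis QL : site_law Q.

Definition symd (A C : set E) : set E := (A `\` C) `|` (C `\` A).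

Lemma measurable_symd A C : measurable A -> measurable C -> measurable (symd A C).
Proof. by move=> mA mC; apply: measurableU; exact: measurableD. Qed.

(** Events that depend, up to small probability, on finitely many sites. They form a sigma-algebra
    containing the cylinders, hence every event is of this kind. *)
Definition local_approx (A : set E) := measurable A /\ forall eps : R, 0 < eps ->
  exists (s : seq Z2) (C : set E), <<s cyl_env [set` s] >> C /\ pr Q (symd A C) <= eps.

Lemma cyl_env_mono (S S' : set Z2) (A : set E) : S `<=` S' ->
  <<s cyl_env S >> A -> <<s cyl_env S' >> A.
Proof.
move=> SS'; apply: smallest_sub; first exact: smallest_sigma_algebra.
by move=> _ [z [B [Sz mB ->]]]; apply: sub_sigma_algebra; exists z, B; split=> //; exact: SS'.
Qed.

Lemma cyl_env_setU (S : set Z2) (A B : set E) :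
  <<s cyl_env S >> A -> <<s cyl_env S >> B -> <<s cyl_env S >> (A `|` B).
Proof.
exact: (@measurableU _ (g_sigma_algebraType (cyl_env S))).
Qed.

Lemma local_approx0 : local_approx set0.
Proof.
split=> // eps eps0; exists [::], set0; split.
  exact: (@measurable0 _ (g_sigma_algebraType (cyl_env [set` [::]]))).
by rewrite /symd !setD0 setU0 /pr measure0 ltW.
Qed.

Lemma local_approxC A : local_approx A -> local_approx (~` A).
Proof.
move=> [mA hA]; split; first exact: measurableC.
move=> eps /hA[s [C [sC hC]]]; exists s, (~` C); split.
  exact: (@measurableC _ (g_sigma_algebraType (cyl_env [set` s]))).
have -> : symd (~` A) (~` C) = symd A C; last exact: hC.
by rewrite /symd !setDE !setCK [~` C `&` A]setIC [~` A `&` C]setIC setUC.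
Qed.

Lemma local_approxU A B : local_approx A -> local_approx B -> local_approx (A `|` B).
Proof.
move=> [mA hA] [mB hB]; split; first exact: measurableU.
move=> eps eps0; have e2 : 0 < eps / 2 by lra.
have [s [C [sC hC]]] := hA _ e2; have [s' [C' [sC' hC']]] := hB _ e2.
exists (s ++ s'), (C `|` C'); split.
  apply: cyl_env_setU; [apply: cyl_env_mono sC|apply: cyl_env_mono sC'] => z /= zs;
  by rewrite mem_cat zs ?orbT.
have mC := cyl_env_measurable sC; have mC' := cyl_env_measurable sC'.
have m1 := measurable_symd mA mC; have m2 := measurable_symd mB mC'.
have sub : symd (A `|` B) (C `|` C') `<=` symd A C `|` symd B C'.
  move=> w [[[a|b] n]|[[c|c] n]].
  - by left; left; split=> // c; apply: n; left.
  - by right; left; split=> // c; apply: n; right.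
  - by left; right; split=> // a; apply: n; left.
  - by right; right; split=> // a; apply: n; right.
have m3 := measurable_symd (measurableU _ _ mA mB) (measurableU _ _ mC mC').
have := pr_le Q m3 (measurableU _ _ m1 m2) sub; have := pr_setU Q m1 m2; lra.
Qed.

Lemma local_approx_bigsetU (F : (set E)^nat) n : (forall k, local_approx (F k)) ->
  local_approx (\big[setU/set0]_(k < n) F k).
Proof.
move=> hF; elim: n => [|n IH]; first by rewrite big_ord0; exact: local_approx0.
by rewrite big_ord_recr; exact: local_approxU.
Qed.

Lemma local_approx_bigcup (F : (set E)^nat) : (forall k, local_approx (F k)) ->
  local_approx (\bigcup_k F k).
Proof.
move=> hF; pose G n := \big[setU/set0]_(k < n) F k.
have hG n : local_approx (G n) by exact: local_approx_bigsetU.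
have mG n : measurable (G n) by case: (hG n).
have GU : \bigcup_k F k = \bigcup_n G n.
  apply/seteqP; split=> w [n _ h].
    by exists n.+1 => //; rewrite /G big_ord_recr; right.
  by move: h; rewrite /G -bigcup_mkord => -[k _ Fk]; exists k.
have ndG : nondecreasing_seq G.
  move=> m n mn; apply/subsetPset; rewrite /G -!bigcup_mkord => w [k /= km Fk].
  by exists k => //=; exact: leq_trans mn.
have mU : measurable (\bigcup_k F k) by apply: bigcupT_measurable => k; case: (hF k).
split=> // eps eps0; have e2 : 0 < eps / 2 by lra.
have [n hn] : exists n, pr Q (\bigcup_k F k) - eps / 2 <= pr Q (G n).
  apply: contrapT => nex.
  have : pr Q (\bigcup_n G n) <= pr Q (\bigcup_k F k) - eps / 2.
    apply: pr_bigcup => // n; rewrite leNgt; apply/negP => lt.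
    by apply: nex; exists n; exact: ltW.
  by rewrite -GU; lra.
have [_ /(_ _ e2)[s [C [sC hC]]]] := hG n; exists s, C; split=> //.
have mC := cyl_env_measurable sC.
have m1 := measurable_symd (mG n) mC; have m3 := measurable_symd mU mC.
have m2 : measurable ((\bigcup_k F k) `\` G n) by exact: measurableD.
have subU : G n `<=` \bigcup_k F k by rewrite GU => w ?; exists n.
have sub : symd (\bigcup_k F k) C `<=` ((\bigcup_k F k) `\` G n) `|` symd (G n) C.
  move=> w [[u nc]|[c nu]].
    by have [g|ng] := pselect (G n w); [right; left|left].
  by right; right; split=> // g; apply: nu; exact: subU.
have dif : pr Q ((\bigcup_k F k) `\` G n) = pr Q (\bigcup_k F k) - pr Q (G n).
  apply: EFin_inj; rewrite -prE// EFinB -!prE//.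
  have e : G n = (\bigcup_k F k) `&` G n by rewrite setIC; apply/esym/setIidPl.
  rewrite {2}e; apply: measureD => //.
  exact: le_lt_trans (probability_le1 Q mU) (ltry 1).
have := pr_le Q m3 (measurableU _ _ m2 m1) sub; have := pr_setU Q m2 m1; rewrite dif; lra.
Qed.

Lemma measurable_local_approx (A : set E) : measurable A -> local_approx A.
Proof.
apply: smallest_sub.
  split; first exact: local_approx0.
    by move=> A0 hA; rewrite setTD; exact: local_approxC.
  exact: local_approx_bigcup.
move=> D [z [B [_ mB DE]]].
have cD : <<s cyl_env [set` [:: z]] >> D.
  by apply: sub_sigma_algebra; exists z, B; split=> //=; rewrite inE.
split; first exact: cyl_env_measurable cD.
move=> eps eps0; exists [:: z], D; split=> //.
by rewrite /symd setDv setU0 /pr measure0 ltW.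
Qed.

(** Here [c] and [b] are the probabilities of the invariant event and of its local approximation,
    [a] that of their symmetric difference, and [d], [f], [g] those of covering unions. The chain
    reads c <= b^2 + 2e <= (c + e)^2 + 2e <= c^2 + 5e. *)
Lemma zero_one_arith (a b c d f g e eps : R) : a <= e -> 0 <= c -> c <= 1 -> 0 <= b ->
  f <= c + a -> b <= f -> d <= a + a -> g <= b ^+ 2 + d -> c <= g ->
  0 < e -> e <= 1 -> e <= eps / 5 -> c <= c ^+ 2 + eps.
Proof.
move=> ae c0 c1 b0 h1 h2 h3 h4 h5 e0 e1 e5.
have : b ^+ 2 <= (c + e) ^+ 2 by rewrite !expr2 ler_pM//; lra.
have : c * e <= e by rewrite ler_piMl// ltW.
have : e * e <= e by rewrite ler_piMl// ltW.
rewrite !expr2; nra.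
Qed.

(* A local approximation of an invariant event is nearly independent of its far
   translates. *)
Lemma invariant_zero_one (A : set E) : measurable A ->
  (forall z, shift_env z @^-1` A = A) -> Q A = 0%E \/ Q A = 1%E.
Proof.
move=> mA inv; have [_ hA] := measurable_local_approx mA.
have p0 := pr_ge0 Q A; have p1 := pr_le1 Q mA.
suff h : pr Q A <= pr Q A ^+ 2.
  have [e|e] : pr Q A = 0 \/ pr Q A = 1.
    by have [->|n0] := eqVneq (pr Q A) 0; [left|right; apply/eqP; rewrite eq_le p1 /=;
      have : 0 < pr Q A by [rewrite lt0r n0]; nra].
  - by left; rewrite prE// e.
  - by right; rewrite prE// e.
apply/ler_addgt0Pr => eps eps0.
pose e := Num.min (eps / 5) 1.
have e0 : 0 < e by rewrite lt_min ltr01 andbT; lra.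
have e1 : e <= 1 by rewrite ge_min lexx orbT.
have e5 : e <= eps / 5 by rewrite ge_min lexx.
have [s [C [sC hC]]] := hA _ e0; have mC := cyl_env_measurable sC.
have [K hK] : exists K, forall x : Z2, x \in s -> (absz x.1 <= K)%N.
  exists (\max_(x <- s) absz x.1) => x xs.
  by apply: (leq_bigmax_seq (F := fun x : Z2 => absz x.1)).
(* First coordinates of the approximating sites lie in [-K,K], so this translation makes the two
   sets of sites disjoint. *)
pose z : Z2 := ((K + K + 1)%N%:Z, 0%:Z).
have sC' : <<s cyl_env [set y | y - z \in s] >> (shift_env z @^-1` C : set E).
  apply: (@sigma_algebra_preimage _ _ (shift_env z) (cyl_env [set` s]) _ _ _ _ sC).
    exact: smallest_sigma_algebra.
  move=> _ [x [B [xs mB ->]]]; apply: sub_sigma_algebra.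
  by exists (x + z), B; split=> //=; rewrite addrK.
have dis : [set` s] `&` [set y | y - z \in s] = set0.
  apply/seteqP; split=> // y [/= /hK h1 /hK /= h2].
  by clear -h1 h2; lia.
have ind := QL.2 _ _ _ _ dis sC sC'.
have mC' := measurable_shift_pre z mC.
have indp : pr Q (C `&` shift_env z @^-1` C) = pr Q C ^+ 2.
  apply: EFin_inj; rewrite -prE; last exact: measurableI.
  by rewrite ind QL.1// prE// -EFinM expr2.
have ms := measurable_symd mA mC; have ms' := measurable_shift_pre z ms.
have prs : pr Q (shift_env z @^-1` symd A C) = pr Q (symd A C) by rewrite /pr QL.1.
have subA : A `<=` (C `&` shift_env z @^-1` C) `|` (symd A C `|` shift_env z @^-1` symd A C).
  move=> w Aw; have Aw' : A (shift_env z w) by rewrite -(inv z) in Aw.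
  have [c|nc] := pselect (C w); last by right; left; left.
  by have [c'|nc'] := pselect (C (shift_env z w)); [left|right; right; left].
have subC : C `<=` A `|` symd A C.
  by move=> w c; have [a|na] := pselect (A w); [left|right; right].
have mI := measurableI _ _ mC mC'; have mU := measurableU _ _ ms ms'.
have := pr_le Q mA (measurableU _ _ mI mU) subA; have := pr_setU Q mI mU.
have := pr_setU Q ms ms'; have := pr_le Q mC (measurableU _ _ mA ms) subC.
have := pr_setU Q mA ms; rewrite indp prs.
have c0 := pr_ge0 Q C.
move=> h1 h2 h3 h4 h5; exact: (zero_one_arith hC p0 p1 c0 h1 h2 h3 h4 h5 e0 e1 e5).
Qed.

End ergodic.

Section process_components.
Context {R : realType} {T : Type}.
Variables (W : Z2 -> T -> R * R) (B : bool -> R * R -> Z2 -> Z2 -> T -> R).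

Lemma psi_process_shiftZ z om om' : (forall x, W (x + z) om = W x om') ->
  (forall s xi x u, B s xi (x + z) (x + z + u) om = B s xi x (x + u) om') ->
  shiftZ z (psi_process W B om) = psi_process W B om'.
Proof.
move=> hW hB; apply/funext => -[x [[xi s] k]].
by rewrite /shiftZ /psi_process /= hW !hB.
Qed.

Lemma psi_process_ind (K : (T -> R) -> Prop) x xi s k : K (fun=> 0) ->
  K (fun om => (W x om).1) -> K (fun om => (W x om).2) ->
  K (B s xi x (x + e1)) -> K (B s xi x (x + e2)) ->
  K (fun om => psi_process W B om (x, (xi, s, k))).
Proof.
move=> K0 K1 K2 K3 K4; rewrite /psi_process /=; case: (inU xi) => //.
by case: k => -[|[|[|k]]] /=.
Qed.

End process_components.

Lemma psi_process_env {R : realType} (T : Type) (W : Z2 -> T -> R * R)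
    (B : bool -> R * R -> Z2 -> Z2 -> (Z2 -> R * R) -> R) :
  psi_process W (fun s xi x y om => B s xi x y (env W om)) =
  psi_process (fun z w => w z) B \o env W.
Proof. by []. Qed.

Section busemann_process.
Context {R : realType} {d : measure_display} {T : measurableType d}.
Local Notation E := (@envT R).
Variables (P : probability T R) (W : Z2 -> T -> R * R).
Hypothesis iid : iid_field P W.

Definition env_process : E -> (Z2 * ((R * R) * bool * 'I_4) -> R) :=
  psi_process (fun z (w : E) => w z) (@bus R).

Lemma env_process_shift z w : shiftZ z (env_process w) = env_process (shift_env z w).
Proof.
rewrite /env_process; apply: psi_process_shiftZ => [x|s xi x u].
  exact: (Logic.eq_refl _).
by rewrite -bus_shift [x + z + u]addrAC.
Qed.

(** There are uncountably many directions, but the cylinder sigma-algebra is generated by single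
    coordinates, each of which is measurable. *)
Lemma measurable_env_process G : cyl_sigma G -> measurable (env_process @^-1` G : set E).
Proof.
apply: sigma_algebra_preimage; first exact: smallest_sigma_algebra.
move=> _ [[x [[xi s] k]] [B [mB ->]]].
have mx := @measurable_coord R setT x I.
have mc : measurable_fun setT (fun w : E => env_process w (x, (xi, s, k))).
  apply: (@psi_process_ind R E (fun z (w : E) => w z) (@bus R) (fun f => measurable_fun setT f)).
  - exact: measurable_cst.
  - exact: (measurableT_comp measurable_fst mx).
  - exact: (measurableT_comp measurable_snd mx).
  - exact: measurable_bus_env.
  - exact: measurable_bus_env.
by have := mc measurableT B mB; rewrite setTI.
Qed.

(** Stationarity and ergodicity pass to factors: equivariance pulls an invariant event of the
    process back to an invariant event of the environment. *)
Lemma equivariant_stationary_ergodic (J : Type) (Phi : E -> (Z2 * J -> R)) :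
  (forall z w, shiftZ z (Phi w) = Phi (shift_env z w)) ->
  (forall G, cyl_sigma G -> measurable (Phi @^-1` G : set E)) ->
  stationary_ergodic P (Phi \o env W).
Proof.
move=> hs hm.
have pre G : P ((Phi \o env W) @^-1` G) = env_law iid (Phi @^-1` G).
  by rewrite env_lawE -comp_preimage.
split.
  move=> z G hG.
  have -> : shiftZ z \o (Phi \o env W) = (fun om => Phi (shift_env z (env W om))).
    by apply/funext => om; exact: (hs z (env W om)).
  have h := esym (env_law_shift iid z (hm _ hG)).
  exact: h.
move=> G hG inv; rewrite (pre G); apply: invariant_zero_one.
- by split; [exact: env_law_shift|exact: env_law_indep].
- exact: hm.
- move=> z; apply/funext => w.
  have h : G (shiftZ z (Phi w)) = G (Phi w) := congr1 (fun X : set _ => X (Phi w)) (inv z).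
  by rewrite hs in h; exact: h.
Qed.

Lemma busemann_stationary_ergodic :
  stationary_ergodic P (psi_process W (fun s xi x y om => bus s xi x y (env W om))).
Proof.
rewrite (psi_process_env W (@bus R)) -/env_process.
exact: (equivariant_stationary_ergodic env_process_shift measurable_env_process).
Qed.

End busemann_process.

(** * Transfer to the law of the environment *)

Section transfer.
Context {R : realType} {d : measure_display} {T : measurableType d}.
Variables (P : probability T R) (W : Z2 -> T -> R * R) (ell : R * R -> R).
Hypothesis iid : iid_field P W.
Hypothesis hell : is_time_constant P W ell.
Local Notation E := (@envT R).
Local Notation Q := (env_law iid).

Lemma env_pres (A : set E) : measurable A -> P (env W @^-1` A) = Q A.
Proof. by []. Qed.

Lemma sq_intg_of_moment (X : T -> R) (eps : R) : measurable_fun setT X -> 0 < eps ->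
  (\int[P]_om ((`|X om| `^ (2 + eps))%:E) < +oo)%E -> intg P (fun om => X om ^+ 2).
Proof.
move=> mX eps0 fin.
have mp : measurable_fun setT (fun om => `|X om| `^ (2 + eps)).
  apply: (@measurableT_comp _ _ _ _ _ _ (fun x : R => x `^ (2 + eps))).
    exact: measurable_powR.
  exact: measurableT_comp.
have i1 : intg P (fun om => `|X om| `^ (2 + eps)).
  apply/integrableP; split; first exact/measurable_EFinP.
  apply: le_lt_trans fin; rewrite le_eqVlt; apply/orP; left; apply/eqP.
  by apply: eq_integral => om _ /=; rewrite ger0_norm// powR_ge0.
have mX2 : measurable_fun setT (fun om => X om ^+ 2) by exact: measurable_funX.
apply: (intg_le mX2 (intgD (intg_cst P 1) i1)) => om.
rewrite normrX; set a := `|X om|; have a0 : 0 <= a by exact: normr_ge0.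
have pw : 0 <= a `^ (2 + eps) by exact: powR_ge0.
have [a1|a1] := lerP a 1.
  have : a ^+ 2 <= 1 by rewrite expr_le1.
  by clear -pw; lra.
have : a ^+ 2 <= a `^ (2 + eps).
  by rewrite -powR_mulrn//; apply: ler_powR; [exact: ltW|rewrite lerDl ltW].
by clear; lra.
Qed.

Lemma env_sqint (eps : R) b : 0 < eps ->
  (\int[P]_om ((`|(W 0%R om).1| `^ (2 + eps))%:E) < +oo)%E ->
  (\int[P]_om ((`|(W 0%R om).2| `^ (2 + eps))%:E) < +oo)%E ->
  sqint Q (fun w : E => edge w 0 b).
Proof.
move=> eps0 f1 f2; have [mW _ _] := iid.
have mx := @measurable_coord R setT 0 I.
have me : measurable_fun setT (fun w : E => edge w 0 b).
  case: b; first exact: (measurableT_comp measurable_fst mx).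
  exact: (measurableT_comp measurable_snd mx).
split; first exact: me.
have me2 : measurable_fun setT (fun w : E => edge w 0 b ^+ 2) by exact: measurable_funX.
apply: ((@intg_preserving R _ _ T E P Q (env W) (measurable_env_W iid) env_pres _ me2).2).
case: (b).
- apply: (sq_intg_of_moment _ eps0 f1).
  exact: (measurableT_comp measurable_fst (mW 0)).
- apply: (sq_intg_of_moment _ eps0 f2).
  exact: (measurableT_comp measurable_snd (mW 0)).
Qed.

Lemma measurable_env_pre (A : set E) : measurable A -> measurable (env W @^-1` A).
Proof. by move=> mA; have := measurable_env_W iid measurableT mA; rewrite setTI. Qed.

Lemma floor_natr k : Num.floor (k%:R : R) = k%:Z.
Proof. exact: (intrKfloor k%:Z). Qed.

(** If every tail event had probability above [del], the increasing union of their complements would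
    have probability at most 1 - del; yet it contains almost every sample point, namely all where
    the limit exists. *)
Lemma env_tail m n (eps del : R) : 0 < eps -> 0 < del ->
  exists r0, pr Q (tc_tail ell m n eps r0) <= del.
Proof.
move=> eps0 del0; have [N [mN N0 hN]] := hell (ler0n R m) (ler0n R n).
pose A r0 := env W @^-1` tc_tail ell m n eps r0.
have mA r0 : measurable (A r0) by apply: measurable_env_pre; exact: measurable_tc_tail.
apply: contrapT => nex.
have nA r0 : del < pr P (A r0).
  by rewrite ltNge; apply/negP => le; apply: nex; exists r0; exact: le.
have mF r0 : measurable (~` A r0) by exact: measurableC.
have ndF : nondecreasing_seq (fun r0 => ~` A r0).
  move=> r r' rr'; apply/subsetPset; apply: subsetC => om [q /= rq h].
  by exists q => //=; exact: leq_trans rr' rq.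
have le r0 : pr P (~` A r0) <= 1 - del.
  by have := nA r0; rewrite pr_setC//; lra.
have := pr_bigcup mF ndF le.
have sub : ~` N `<=` \bigcup_r ~` A r.
  move=> om nN.
  have : (fun r : nat => passage_time (env W om) 0
      (Num.floor (r%:R * m%:R : R), Num.floor (r%:R * n%:R : R)) / r%:R) @ \oo --> ell (m%:R, n%:R).
    by apply: contrapT => nc; apply: nN; exact: hN.
  move=> /cvgrPdist_lt/(_ _ eps0)[r0 _ B]; exists r0.+1 => // -[r /= rr]; rewrite /tc_dev /=.
  have r1 : 0 < r%:R :> R by rewrite ltr0n; exact: leq_trans rr.
  have := B r (ltnW rr); rewrite /= -!natrM !floor_natr -/(vec (r * m) (r * n)).
  set X := passage_time _ _ _ => lt; apply/negP; rewrite -leNgt.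
  have -> : X - r%:R * ell (m%:R, n%:R) = - (r%:R * (ell (m%:R, n%:R) - X / r%:R)).
    by field; rewrite lt0r_neq0.
  by rewrite normrN normrM (gtr0_norm r1) mulrC ler_pM2r// ltW.
have mU : measurable (\bigcup_r ~` A r) by exact: bigcupT_measurable.
have pN : pr P N = 0 by rewrite /pr N0.
have := pr_le P (measurableC mN) mU sub; rewrite pr_setC// pN.
by clear -del0; lra.
Qed.

(** Both almost sure limits are read at a common sample point: the sequence towards (ks,kt) is the
    subsequence of indices nk of the one towards (s,t), up to the factor [k]. *)
Lemma env_hom (k : nat) (s t : R) : (0 < k)%N -> 0 <= s -> 0 <= t ->
  ell (k%:R * s, k%:R * t) = k%:R * ell (s, t).
Proof.
move=> k0 s0 t0; have kR : 0 < k%:R :> R by rewrite ltr0n.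
have [N [mN N0 hN]] := hell s0 t0.
have [N' [mN' N0' hN']] := hell (mulr_ge0 (ltW kR) s0) (mulr_ge0 (ltW kR) t0).
have [om [nN nN']] : exists om, ~ N om /\ ~ N' om.
  apply: contrapT => nex.
  have sub : setT `<=` N `|` N'.
    move=> om _; apply: contrapT => nU; apply: nex; exists om.
    by split=> h; apply: nU; [left|right].
  have := pr_le P measurableT (measurableU _ _ mN mN') sub.
  have := pr_setU P mN mN'; rewrite /pr N0 N0' probability_setT /=; lra.
have c1 := contrapT (fun nc => nN (hN om nc)).
have c2 := contrapT (fun nc => nN' (hN' om nc)).
apply/eqP; rewrite -subr_eq0 -normr_le0; apply/ler_addgt0Pr => eps eps0; rewrite add0r.
pose e : R := eps / (1 + k%:R).
have e0 : 0 < e by rewrite divr_gt0// addr_gt0.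
have ee : e + k%:R * e = eps by rewrite /e; field; rewrite lt0r_neq0// addr_gt0.
move/cvgrPdist_lt : c1 => /(_ _ e0)[n1 _ B1]; move/cvgrPdist_lt : c2 => /(_ _ e0)[n2 _ B2].
pose n := (n1 + n2).+1; have nR : 0 < n%:R :> R by rewrite ltr0n.
have /= h1 := B1 (n * k)%N ltac:(rewrite /= /n; clear -k0; nia).
have /= h2 := B2 n ltac:(rewrite /= /n; clear; lia).
rewrite natrM -!mulrA in h1; move: h1 h2; set X := passage_time _ _ _ => h1 h2.
have h3 : `|k%:R * ell (s, t) - X / n%:R| < k%:R * e.
  have -> : k%:R * ell (s, t) - X / n%:R = k%:R * (ell (s, t) - X / (n%:R * k%:R)).
    by field; rewrite !lt0r_neq0.
  by rewrite normrM (gtr0_norm kR) ltr_pM2l.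
move: h2 h3; rewrite !ltr_norml ler_norml => /andP[a1 a2] /andP[b1 b2].
by clear -a1 a2 b1 b2 ee; apply/andP; split; lra.
Qed.

Lemma Ebus (xi : R * R) s b u : percolation Q ell -> inU xi -> 0 + step b = u ->
  'E_P[(fun om => bus s xi 0%R u (env W om))]%E = (mbus Q b s xi)%:E.
Proof.
move=> H hxi <-; have ib := intg_bus H b s hxi.
have ic := (@intg_preserving R _ _ T E P Q (env W) (measurable_env_W iid) env_pres _
  (intg_meas ib)).1 ib.
rewrite unlock; apply: (eq_trans (ExE ic)); congr EFin.
exact: (@Ex_preserving R _ _ T E P Q (env W) (measurable_env_W iid) env_pres _ ib).
Qed.

Lemma bus_future s xi x y :
  measurable_wrt (future_sigma W x y) (fun om => bus s xi x y (env W om)).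
Proof.
move=> B mB.
(* Measurability of [bus] holds on any space where the weights above x or y are measurable; here the
   space carries exactly the sigma-algebra that they generate. *)
have := @measurable_bus R _ (g_sigma_algebraType [set A | exists (z : Z2) (B : set (R * R)),
   [/\ le2 x z || le2 y z, measurable B & A = W z @^-1` B]]) (env W) s xi x y.
move=> h; have := h _ measurableT B mB; rewrite setTI; apply.
move=> z hz _ C mC; rewrite setTI; apply: sub_sigma_algebra.
by exists z, C; split; [exact: hz|exact: mC|exact: (Logic.eq_refl _)].
Qed.

End transfer.

Theorem theorem2p2 (R : realType) (d : measure_display) (T : measurableType d)
    (P : probability T R) (W : Z2 -> T -> R * R) (ell : R * R -> R)
    (hSA : standing_assumption P W)
    (hell : is_time_constant P W ell)
    (hdiff : forall xi : R * R, 0 < xi.1 -> 0 < xi.2 -> differentiable ell xi)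
    (hconv : forall xi zeta : R * R, inU xi -> inU zeta -> xi <> zeta ->
       forall t : R, 0 < t < 1 ->
       ell (t *: xi + (1 - t) *: zeta) < t * ell xi + (1 - t) * ell zeta) :
  exists (U0 : T -> set (R * R)) (B : R * R -> Z2 -> Z2 -> T -> R)
         (Bpm : bool -> R * R -> Z2 -> Z2 -> T -> R),
  [/\
   (* the (random) set U0 : P(xi in U0) = 1 for every fixed xi in U *)
   (forall xi, inU xi -> exists A : set T,
       [/\ measurable A, P A = 1%E & A `<=` [set om | U0 om xi]]),
   (* almost surely: existence of the limits, (i), (iv), (v), (vi) *)
   (exists Om : set T, [/\ measurable Om, P Om = 1%E &
       forall om, Om om -> busemann_pathwise W U0 B Bpm om]),
   (* (ii) stationarity and joint ergodicity *)
   stationary_ergodic P (psi_process W Bpm),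
   (* (iii) measurability *)
   (forall s xi, inU xi -> forall x y : Z2,
       measurable_wrt (future_sigma W x y) (Bpm s xi x y)) &
   (* (vii) means = gradient of ell *)
   (forall s xi, inU xi ->
       'E_P[Bpm s xi 0%R e1]%E = ('D_((1:R), (0:R)) ell xi)%:E /\
       'E_P[Bpm s xi 0%R e2]%E = ('D_((0:R), (1:R)) ell xi)%:E) /\
   (* in particular: distinct directions have distinct expectations *)
   (forall s s' xi zeta, inU xi -> inU zeta -> xi <> zeta ->
       ('E_P[Bpm s xi 0%R e1]%E, 'E_P[Bpm s xi 0%R e2]%E)
       <> ('E_P[Bpm s' zeta 0%R e1]%E, 'E_P[Bpm s' zeta 0%R e2]%E))].
Proof.
have [iid _ [eps [eps0 [f1 f2]]] _] := hSA.
have H : percolation (env_law iid) ell.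
  split.
  - by split; [exact: env_law_shift|exact: env_law_indep].
  - by move=> b; exact: (env_sqint iid b eps0 f1 f2).
  - by move=> m n e del; exact: env_tail.
  - by move=> k s t; exact: (env_hom hell).
  - exact: hdiff.
  - exact: hconv.
have means s xi : inU xi ->
    'E_P[(fun om => bus s xi 0%R e1 (env W om))]%E = ('D_((1:R), (0:R)) ell xi)%:E /\
    'E_P[(fun om => bus s xi 0%R e2 (env W om))]%E = ('D_((0:R), (1:R)) ell xi)%:E.
  move=> hxi; have [m1 m2] := mean_grad H s hxi.
  by split; [rewrite (Ebus s H hxi (add0r (step true))) m1|
             rewrite (Ebus s H hxi (add0r (step false))) m2].
exists (fun om => [set xi | cont_dir (env W om) xi]),
  (fun xi x y om => bus true xi x y (env W om)), (fun s xi x y om => bus s xi x y (env W om)).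
split.
- move=> xi hxi; have [A [mA A1 AC]] := cont_dir_ae H hxi.
  exists (env W @^-1` A); split; [exact: (measurable_env_pre iid)|exact: A1|].
  by move=> om /AC.
- have mb := measurableC (@measurable_bad_env R).
  exists (env W @^-1` ~` bad_env); split; first exact: (measurable_env_pre iid).
    rewrite -(env_lawE iid) probability_setC; last exact: measurable_bad_env.
    by rewrite (bad_env0 H) sube0.
  by move=> om nb; apply: star_pathwise; exact: star_of_good nb.
- exact: busemann_stationary_ergodic.
- by move=> s xi _ x y; exact: bus_future.
- split; first by move=> s xi hxi; exact: means.
  move=> s s' xi zeta hxi hz ne.
  have [m1 m2] := means s xi hxi; have [n1 n2] := means s' zeta hz.
  have gi := grad_inj H hxi hz ne.
  move=> e; apply: gi; split; apply: EFin_inj.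
    exact: (eq_trans (esym m1) (eq_trans (congr1 fst e) n1)).
  exact: (eq_trans (esym m2) (eq_trans (congr1 snd e) n2)).
Qed.
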